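(* Over Kohlenbach's base theory $\mathsf{RCA}_0^\omega$, the principle $\mathsf{HBU}$ is equivalent to the principle $\mathsf{HBU}_{\text{ae}}$; that is, $\mathsf{RCA}_0^\omega \vdash \mathsf{HBU}\leftrightarrow \mathsf{HBU}_{\text{ae}}$.
   Context: $\mathsf{RCA}_0^\omega$ is Kohlenbach's base theory of higher-order Reverse Mathematics (finite-type arithmetic, conservative over $\mathsf{RCA}_0$). Real numbers are coded by fast-converging Cauchy sequences of rationals; a function $\Psi:\mathbb{R}\to\mathbb{R}$ (or on $[0,1]$) is a type-$(1\to1)$ functional respecting equality of reals, and need not be continuous. Let $I=[0,1]$ and, for $\Psi$ with values in $\mathbb{R}^+$ (the positive reals), let $I_x^\Psi=(x-\Psi(x),x+\Psi(x))$. $\mathsf{HBU}$: for every $\Psi:\mathbb{R}\to\mathbb{R}^+$ there are $y_0,\dots,y_k\in I$ such that every $x\in I$ lies in $\bigcup_{i\le k}I^\Psi_{y_i}$. A set $E\subseteq[0,1]$ is RM-closed if its complement is RM-open, i.e. given (via a code) as the union of a sequence of basic open intervals with rational endpoints. A set $A\subseteq\mathbb{R}$ has measure zero if for every $\varepsilon>0$ there is a sequence $(I_n)_{n\in\mathbb{N}}$ of basic open intervals covering $A$ with total length below $\varepsilon$. A function $\Psi:[0,1]\to\mathbb{R}$ is continuous almost everywhere if it is continuous at every point outside some RM-closed set $E\subseteq[0,1]$ of measure zero. $\mathsf{HBU}_{\text{ae}}$: $\mathsf{HBU}$ restricted to those $\Psi:[0,1]\to\mathbb{R}^+$ that are continuous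 almost everywhere, i.e. for every such $\Psi$ there are $y_0,\dots,y_k\in[0,1]$ with $[0,1]\subseteq\bigcup_{i\le k}I^\Psi_{y_i}$. *)

(* Defs.v *)
From Stdlib Require Import List.
Import ListNotations.

Set Implicit Arguments.
Unset Strict Implicit.
Unset Printing Implicit Defensive.

(* Terms and formulas are intrinsically typed, with de Bruijn indices: a context
   lists the types of the free variables, most recently bound first. *)

Inductive ty : Type :=
| tnat : ty
| tarr : ty -> ty -> ty.

Declare Scope ty_scope.
Delimit Scope ty_scope with ty.
Bind Scope ty_scope with ty.
Notation "s ~> t" := (tarr s t) (at level 55, right associativity) : ty_scope.
Notation ty0 := tnat.
Notation ty1 := (tnat ~> tnat)%ty.

Definition ctx := list ty.

Inductive var : ctx -> ty -> Type :=
| vz : forall G s, var (s :: G) s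
| vs : forall G s r, var G s -> var (r :: G) s.
Arguments vz {G s}.
Arguments vs {G s r} _.

(* [cK] and [cS] are the combinators Pi and Sigma; [crec] is the recursor R_0,
   which only constructs objects of type 0. *)
Inductive tm (G : ctx) : ty -> Type :=
| tvar : forall s, var G s -> tm G s
| tapp : forall s t, tm G (s ~> t) -> tm G s -> tm G t
| czero : tm G ty0
| cone : tm G ty0
| cadd : tm G (ty0 ~> ty0 ~> ty0)
| cmul : tm G (ty0 ~> ty0 ~> ty0)
| cK : forall s t, tm G (s ~> t ~> s)
| cS : forall r s t, tm G ((r ~> s ~> t) ~> (r ~> s) ~> r ~> t)
| crec : tm G ((ty0 ~> ty0 ~> ty0) ~> ty0 ~> ty0 ~> ty0).
Arguments tvar {G s} _.
Arguments tapp {G s t} _ _.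
Arguments czero {G}.
Arguments cone {G}.
Arguments cadd {G}.
Arguments cmul {G}.
Arguments cK {G s t}.
Arguments cS {G r s t}.
Arguments crec {G}.

(* Equality and order are primitive at type 0 only. *)
Inductive fm (G : ctx) : Type :=
| feq : tm G ty0 -> tm G ty0 -> fm G
| flt : tm G ty0 -> tm G ty0 -> fm G
| fbot : fm G
| fimp : fm G -> fm G -> fm G
| fand : fm G -> fm G -> fm G
| for_ : fm G -> fm G -> fm G
| fall : forall s, fm (s :: G) -> fm G
| fex : forall s, fm (s :: G) -> fm G.
Arguments fbot {G}.
Arguments fall {G} s _.
Arguments fex {G} s _.

Declare Scope tm_scope.
Delimit Scope tm_scope with tm.
Bind Scope tm_scope with tm.
Notation "t $ u" := (tapp t u) (at level 37, left associativity) : tm_scope.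
Notation "t + u" := (tapp (tapp cadd t) u) : tm_scope.
Notation "t * u" := (tapp (tapp cmul t) u) : tm_scope.
Notation "0" := czero : tm_scope.
Notation "1" := cone : tm_scope.
Notation var0 := (tvar vz).
Notation var1 := (tvar (vs vz)).
Notation var2 := (tvar (vs (vs vz))).

Declare Scope fm_scope.
Delimit Scope fm_scope with fm.
Bind Scope fm_scope with fm.
Notation "t == u" := (feq t%tm u%tm) (at level 70, no associativity) : fm_scope.
Notation "t < u" := (flt t%tm u%tm) (at level 70, no associativity) : fm_scope.
Notation "A //\ B" := (fand A B) (at level 80, right associativity) : fm_scope.
Notation "A \// B" := (for_ A B) (at level 85, right associativity) : fm_scope.
Notation "A ->> B" := (fimp A B) (at level 90, right associativity) : fm_scope.
Notation "A <<->> B" := (fand (fimp A B) (fimp B A)) (at level 95) : fm_scope.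
Notation "'ALL' s , A" := (fall s%ty A)
  (at level 200, s at level 60, A at level 200) : fm_scope.
Notation "'EX' s , A" := (fex s%ty A)
  (at level 200, s at level 60, A at level 200) : fm_scope.

Definition fnot {G} (A : fm G) : fm G := fimp A fbot.

Definition renaming (G D : ctx) := forall s, var G s -> var D s.
Definition substitution (G D : ctx) := forall s, var G s -> tm D s.

Definition var_case {G r s} (P : Type) (x : var (r :: G) s)
    (z : r = s -> P) (k : var G s -> P) : P :=
  match x in var D s' return
    match D with
    | [] => unit
    | r' :: G' => (r' = s' -> P) -> (var G' s' -> P) -> P
    end
  with
  | vz => fun z _ => z eq_refl
  | vs y => fun _ k => k y
  end z k.

Definition up_ren {G D} r (f : renaming G D) : renaming (r :: G) (r :: D) :=
  fun s x => var_case x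
    (fun e => match e in _ = s' return var (r :: D) s' with eq_refl => vz end)
    (fun y => vs (f s y)).

Fixpoint ren_tm {G D} (f : renaming G D) s (t : tm G s) : tm D s :=
  match t in tm _ s' return tm D s' with
  | tvar x => tvar (f _ x)
  | tapp t u => tapp (ren_tm f t) (ren_tm f u)
  | czero => czero
  | cone => cone
  | cadd => cadd
  | cmul => cmul
  | cK => cK
  | cS => cS
  | crec => crec
  end.

Definition wk {G r s} (t : tm G s) : tm (r :: G) s :=
  ren_tm (fun s x => vs x) t.

Definition up_sub {G D} r (f : substitution G D) : substitution (r :: G) (r :: D) :=
  fun s x => var_case x
    (fun e => match e in _ = s' return tm (r :: D) s' with eq_refl => var0 end)
    (fun y => wk (f s y)).

Fixpoint sub_tm {G D} (f : substitution G D) s (t : tm G s) : tm D s :=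
  match t in tm _ s' return tm D s' with
  | tvar x => f _ x
  | tapp t u => tapp (sub_tm f t) (sub_tm f u)
  | czero => czero
  | cone => cone
  | cadd => cadd
  | cmul => cmul
  | cK => cK
  | cS => cS
  | crec => crec
  end.

Fixpoint ren_fm {G D} (f : renaming G D) (A : fm G) : fm D :=
  match A with
  | feq t u => feq (ren_tm f t) (ren_tm f u)
  | flt t u => flt (ren_tm f t) (ren_tm f u)
  | fbot => fbot
  | fimp A B => fimp (ren_fm f A) (ren_fm f B)
  | fand A B => fand (ren_fm f A) (ren_fm f B)
  | for_ A B => for_ (ren_fm f A) (ren_fm f B)
  | fall s A => fall s (ren_fm (up_ren f) A)
  | fex s A => fex s (ren_fm (up_ren f) A)
  end.

Fixpoint sub_fm {G D} (f : substitution G D) (A : fm G) : fm D :=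
  match A with
  | feq t u => feq (sub_tm f t) (sub_tm f u)
  | flt t u => flt (sub_tm f t) (sub_tm f u)
  | fbot => fbot
  | fimp A B => fimp (sub_fm f A) (sub_fm f B)
  | fand A B => fand (sub_fm f A) (sub_fm f B)
  | for_ A B => for_ (sub_fm f A) (sub_fm f B)
  | fall s A => fall s (sub_fm (up_sub f) A)
  | fex s A => fex s (sub_fm (up_sub f) A)
  end.

Definition wk_fm {G r} (A : fm G) : fm (r :: G) := ren_fm (fun s x => vs x) A.

Definition scons {G D r} (t : tm D r) (f : substitution G D) :
    substitution (r :: G) D :=
  fun s x => var_case x
    (fun e => match e in _ = s' return tm D s' with eq_refl => t end) (f s).

Definition inst {G r} (A : fm (r :: G)) (t : tm G r) : fm G :=
  sub_fm (scons t (fun s x => tvar x)) A.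

(* A theory gives its axioms in every context; free variables are parameters,
   as in the universal closure. *)
Definition theory := forall G : ctx, fm G -> Prop.

Inductive prf (T : theory) : forall G, list (fm G) -> fm G -> Prop :=
| p_ax : forall G H (A : fm G), T G A -> prf T H A
| p_hyp : forall G H (A : fm G), In A H -> prf T H A
| p_raa : forall G H (A : fm G), prf T (fnot A :: H) fbot -> prf T H A
| p_impI : forall G H (A B : fm G), prf T (A :: H) B -> prf T H (fimp A B)
| p_impE : forall G H (A B : fm G), prf T H (fimp A B) -> prf T H A -> prf T H B
| p_andI : forall G H (A B : fm G), prf T H A -> prf T H B -> prf T H (fand A B)
| p_andE1 : forall G H (A B : fm G), prf T H (fand A B) -> prf T H A
| p_andE2 : forall G H (A B : fm G), prf T H (fand A B) -> prf T H B
| p_orI1 : forall G H (A B : fm G), prf T H A -> prf T H (for_ A B)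
| p_orI2 : forall G H (A B : fm G), prf T H B -> prf T H (for_ A B)
| p_orE : forall G H (A B C : fm G), prf T H (for_ A B) ->
    prf T (A :: H) C -> prf T (B :: H) C -> prf T H C
| p_allI : forall G H s (A : fm (s :: G)),
    prf T (map (@wk_fm G s) H) A -> prf T H (fall s A)
| p_allE : forall G H s (A : fm (s :: G)) (t : tm G s),
    prf T H (fall s A) -> prf T H (inst A t)
| p_exI : forall G H s (A : fm (s :: G)) (t : tm G s),
    prf T H (inst A t) -> prf T H (fex s A)
| p_exE : forall G H s (A : fm (s :: G)) (C : fm G), prf T H (fex s A) ->
    prf T (A :: map (@wk_fm G s) H) (wk_fm C) -> prf T H C
| p_refl : forall G H (t : tm G ty0), prf T H (feq t t)
| p_subst : forall G H (A : fm (ty0 :: G)) (t u : tm G ty0),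
    prf T H (feq t u) -> prf T H (inst A t) -> prf T H (inst A u).

Definition provable (T : theory) (A : fm []) : Prop := prf T [] A.

Fixpoint feqT {G} (s : ty) : tm G s -> tm G s -> fm G :=
  match s return tm G s -> tm G s -> fm G with
  | tnat => fun t u => feq t u
  | tarr a b => fun t u => fall a (feqT (tapp (wk t) var0) (tapp (wk u) var0))
  end.

Fixpoint qf {G} (A : fm G) : bool :=
  match A with
  | feq _ _ | flt _ _ | fbot => true
  | fimp A B | fand A B | for_ A B => andb (qf A) (qf B)
  | fall _ _ | fex _ _ => false
  end.

(* Given A(x, y) with y = variable 0 and x = variable 1 over the context G,
   the formula A(x, Y(x)) with x = variable 0 and Y = variable 1. *)
Definition ac_graph {G s t} (A : fm (t :: s :: G)) : fm (s :: (s ~> t)%ty :: G) :=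
  sub_fm (scons (var1 $ var0)%tm (scons var0 (fun r x => tvar (vs (vs x))))) A.

(* Given A(n) with n = variable 0, the formula A(n+1). *)
Definition at_succ {G} (A : fm (ty0 :: G)) : fm (ty0 :: G) :=
  sub_fm (scons (var0 + 1)%tm (fun r x => tvar (vs x))) A.

Local Open Scope tm_scope.
Local Open Scope fm_scope.

(* The arithmetical axioms are those of a discretely ordered semi-ring in
   recursive form; quantifier-free induction yields the usual algebraic laws.
   [ax_ext] is the full extensionality axiom at all types, [ax_qfac] is
   QF-AC^{1,0}. *)
Inductive RCA0w : forall G, fm G -> Prop :=
| ax_succ0 : forall G (m : tm G ty0), RCA0w (fnot (m + 1 == 0))
| ax_succ_inj : forall G (m n : tm G ty0), RCA0w (m + 1 == n + 1 ->> m == n)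
| ax_one : forall G, RCA0w (G := G) (0 + 1 == 1)
| ax_add0 : forall G (m : tm G ty0), RCA0w (m + 0 == m)
| ax_addS : forall G (m n : tm G ty0), RCA0w (m + (n + 1) == (m + n) + 1)
| ax_mul0 : forall G (m : tm G ty0), RCA0w (m * 0 == 0)
| ax_mulS : forall G (m n : tm G ty0), RCA0w (m * (n + 1) == m * n + m)
| ax_lt0 : forall G (m : tm G ty0), RCA0w (fnot (m < 0))
| ax_ltS : forall G (m n : tm G ty0),
    RCA0w (m < n + 1 <<->> (m < n \// m == n))
| ax_K : forall G s t (x : tm G s) (y : tm G t), RCA0w (feqT (cK $ x $ y) x)
| ax_S : forall G r s t (x : tm G (r ~> s ~> t)) (y : tm G (r ~> s)) (z : tm G r),
    RCA0w (feqT (cS $ x $ y $ z) (x $ z $ (y $ z)))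
| ax_rec0 : forall G (f : tm G (ty0 ~> ty0 ~> ty0)) (m : tm G ty0),
    RCA0w (crec $ f $ m $ 0 == m)
| ax_recS : forall G (f : tm G (ty0 ~> ty0 ~> ty0)) (m n : tm G ty0),
    RCA0w (crec $ f $ m $ (n + 1) == f $ n $ (crec $ f $ m $ n))
| ax_ext : forall G s t (f : tm G (s ~> t)) (x y : tm G s),
    RCA0w (feqT x y ->> feqT (f $ x) (f $ y))
| ax_ind : forall G (A : fm (ty0 :: G)), qf A = true ->
    RCA0w (inst A 0 ->> (ALL ty0, A ->> at_succ A) ->> ALL ty0, A)
| ax_qfac : forall G (A : fm (ty0 :: ty1 :: G)), qf A = true ->
    RCA0w ((ALL ty1, EX ty0, A) ->> EX ty1 ~> ty0, ALL ty1, ac_graph A).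

(* Bracket abstraction: [lam t] denotes the function mapping var0 to t. *)
Definition lam_var {G r s} (x : var (r :: G) s) : tm G (r ~> s) :=
  var_case x
    (fun e => match e in _ = s' return tm G (r ~> s') with
              | eq_refl => cS $ cK $ (cK (t := ty0))
              end)
    (fun y => cK $ tvar y).

Fixpoint lam {G r s} (t : tm (r :: G) s) : tm G (r ~> s) :=
  match t in tm _ s' return tm G (r ~> s') with
  | tvar x => lam_var x
  | tapp t u => cS $ lam t $ lam u
  | czero => cK $ 0
  | cone => cK $ 1
  | cadd => cK $ cadd
  | cmul => cK $ cmul
  | cK => cK $ cK
  | cS => cK $ cS
  | crec => cK $ crec
  end.

Definition cpred {G} : tm G (ty0 ~> ty0) := crec $ lam (lam var1) $ 0.
Definition cmonus {G} : tm G (ty0 ~> ty0 ~> ty0) :=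
  lam (lam (crec $ lam (lam (cpred $ var0)) $ var1 $ var0)).
Definition cpow2 {G} : tm G (ty0 ~> ty0) := crec $ lam (lam (var0 + var0)) $ 1.
Notation "t -| u" := (cmonus $ t $ u) (at level 50, left associativity) : tm_scope.

(* Cantor pairing j(a, b) = (0 + 1 + ... + (a+b)) + b, with its projections;
   [ctroot c] is the largest w such that 0 + 1 + ... + w <= c. *)
Definition ctri {G} : tm G (ty0 ~> ty0) := crec $ lam (lam (var0 + (var1 + 1))) $ 0.
Definition ctroot {G} : tm G (ty0 ~> ty0) :=
  crec $ lam (lam (var0 + (1 -| (ctri $ (var0 + 1) -| (var1 + 1))))) $ 0.
Definition cpair {G} : tm G (ty0 ~> ty0 ~> ty0) :=
  lam (lam (ctri $ (var1 + var0) + var0)).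
Definition csnd {G} : tm G (ty0 ~> ty0) := lam (var0 -| ctri $ (ctroot $ var0)).
Definition cfst {G} : tm G (ty0 ~> ty0) := lam (ctroot $ var0 -| csnd $ var0).

(* The number j(a, j(b, d)) codes the rational (a - b) / (d + 1); every number
   codes a rational. *)
Definition qmk {G} (a b d : tm G ty0) : tm G ty0 := cpair $ a $ (cpair $ b $ d).
Definition qpos {G} (c : tm G ty0) : tm G ty0 := cfst $ c.
Definition qneg {G} (c : tm G ty0) : tm G ty0 := cfst $ (csnd $ c).
Definition qden1 {G} (c : tm G ty0) : tm G ty0 := csnd $ (csnd $ c).
Definition qden {G} (c : tm G ty0) : tm G ty0 := qden1 c + 1.

Definition q0 {G} : tm G ty0 := qmk 0 0 0.
Definition q1 {G} : tm G ty0 := qmk 1 0 0.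
Definition qadd {G} : tm G (ty0 ~> ty0 ~> ty0) :=
  lam (lam (qmk (qpos var1 * qden var0 + qpos var0 * qden var1)
                (qneg var1 * qden var0 + qneg var0 * qden var1)
                (qden var1 * qden var0 -| 1))).
Definition qopp {G} : tm G (ty0 ~> ty0) := lam (qmk (qneg var0) (qpos var0) (qden1 var0)).
Definition qsub {G} : tm G (ty0 ~> ty0 ~> ty0) := lam (lam (qadd $ var1 $ (qopp $ var0))).
Definition qabs {G} : tm G (ty0 ~> ty0) :=
  lam (qmk ((qpos var0 -| qneg var0) + (qneg var0 -| qpos var0)) 0 (qden1 var0)).
(* max(q, 0) *)
Definition qplus {G} : tm G (ty0 ~> ty0) :=
  lam (qmk (qpos var0 -| qneg var0) 0 (qden1 var0)).
(* 2^-n *)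
Definition qhalf {G} (n : tm G ty0) : tm G ty0 := qmk 1 0 (cpow2 $ n -| 1).

Definition nle {G} (m n : tm G ty0) : fm G := m < n \// m == n.
Definition qlt {G} (c d : tm G ty0) : fm G :=
  qpos c * qden d + qneg d * qden c < qpos d * qden c + qneg c * qden d.
Definition qle {G} (c d : tm G ty0) : fm G :=
  nle (qpos c * qden d + qneg d * qden c) (qpos d * qden c + qneg c * qden d).

(* A real is a type-1 object x, the sequence of the rationals coded by x(n),
   with |x(n) - x(n+i)| < 2^-n for all n and i. *)
Definition isReal {G} (x : tm G ty1) : fm G :=
  ALL ty0, ALL ty0,
    qlt (qabs $ (qsub $ (wk (wk x) $ var1) $ (wk (wk x) $ (var1 + var0)))) (qhalf var1).

Definition req {G} (x y : tm G ty1) : fm G :=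
  ALL ty0, qle (qabs $ (qsub $ (wk x $ var0) $ (wk y $ var0)))
              (qadd $ qhalf var0 $ qhalf var0).
Definition rle {G} (x y : tm G ty1) : fm G :=
  ALL ty0, qle (wk x $ var0) (qadd $ (wk y $ var0) $ (qadd $ qhalf var0 $ qhalf var0)).
Definition rlt {G} (x y : tm G ty1) : fm G :=
  EX ty0, qlt (qadd $ (wk x $ var0) $ (qadd $ qhalf var0 $ qhalf var0)) (wk y $ var0).

Definition rconst {G} (c : tm G ty0) : tm G ty1 := cK $ c.
(* The shift of index makes the result fast-converging again. *)
Definition radd {G} : tm G (ty1 ~> ty1 ~> ty1) :=
  lam (lam (lam (qadd $ (var2 $ (var0 + 1)) $ (var1 $ (var0 + 1))))).
Definition rsub {G} : tm G (ty1 ~> ty1 ~> ty1) :=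
  lam (lam (lam (qsub $ (var2 $ (var0 + 1)) $ (var1 $ (var0 + 1))))).
Definition rabs {G} : tm G (ty1 ~> ty1) := lam (lam (qabs $ (var1 $ var0))).

Definition rpos {G} (x : tm G ty1) : fm G := isReal x //\ rlt (rconst q0) x.

(* A set of reals is a formula with the element as variable 0. *)

Definition rset (G : ctx) := fm (ty1 :: G).
Definition mem {G} (x : tm G ty1) (A : rset G) : fm G := inst A x.
Definition wk_set {G r} (A : rset G) : rset (r :: G) :=
  ren_fm (up_ren (fun s x => vs x)) A.

Definition setR {G} : rset G := isReal var0.
Definition setI {G} : rset G :=
  isReal var0 //\ rle (rconst q0) var0 //\ rle var0 (rconst q1).

Definition subset {G} (A B : rset G) : fm G := ALL ty1, A ->> B.

(* A basic open interval is coded by c = j(a, b), with a and b the codes of its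
   rational end-points; it is empty if its left end-point is not below its right
   one.  A type-1 object u codes the union of the intervals coded by the u(n). *)
Definition in_interval {G} (x : tm G ty1) (c : tm G ty0) : fm G :=
  rlt (rconst (cfst $ c)) x //\ rlt x (rconst (csnd $ c)).

Definition open_set {G} (u : tm G ty1) : rset G :=
  isReal var0 //\ EX ty0, in_interval var1 (wk (wk u) $ var0).

Definition closed_set {G} (u : tm G ty1) : rset G :=
  isReal var0 //\ fnot (open_set u).

Definition ilength {G} (c : tm G ty0) : tm G ty0 :=
  qplus $ (qsub $ (csnd $ c) $ (cfst $ c)).

(* The rational code of the sum of the lengths of v(0), ..., v(n-1). *)
Definition length_sum {G} : tm G (ty1 ~> ty0 ~> ty0) :=
  lam (crec $ lam (lam (qadd $ var0 $ ilength (var2 $ var1))) $ q0).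

(* The supremum of the partial sums is below eps; its existence as a real is
   not asserted. *)
Definition total_length_below {G} (v eps : tm G ty1) : fm G :=
  EX ty1, isReal var0 //\ rlt var0 (wk eps) //\
    ALL ty0, rle (rconst (length_sum $ wk (wk v) $ var0)) var1.

Definition measure_zero {G} (A : rset G) : fm G :=
  ALL ty1, rpos var0 ->>
    EX ty1, subset (wk_set (wk_set A)) (open_set var0) //\ total_length_below var0 var1.

(* F, restricted to D, maps reals to positive reals and respects equality of
   reals; nothing is required outside D. *)
Definition pos_function {G} (D : rset G) (F : tm G (ty1 ~> ty1)) : fm G :=
  (ALL ty1, D ->> rpos (wk F $ var0)) //\
  (ALL ty1, ALL ty1,
     mem var1 (wk_set (wk_set D)) //\ mem var0 (wk_set (wk_set D)) //\ req var1 var0 ->>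
     req (wk (wk F) $ var1) (wk (wk F) $ var0)).

Definition rdist {G} (x y : tm G ty1) : tm G ty1 := rabs $ (rsub $ x $ y).

Definition continuous_at {G} (D : rset G) (F : tm G (ty1 ~> ty1)) (x : tm G ty1) :
    fm G :=
  ALL ty1, rpos var0 ->>
    EX ty1, rpos var0 //\
      ALL ty1, mem var0 (wk_set (wk_set (wk_set D))) //\
              rlt (rdist (wk (wk (wk x))) var0) var1 ->>
        rlt (rdist (wk (wk (wk F)) $ wk (wk (wk x))) (wk (wk (wk F)) $ var0)) var2.

Definition continuous_ae {G} (F : tm G (ty1 ~> ty1)) : fm G :=
  EX ty1, subset (closed_set var0) setI //\ measure_zero (closed_set var0) //\
    ALL ty1, setI //\ fnot (closed_set var0) ->> continuous_at setI (wk (wk F)) var0.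

Definition in_canonical {G} (F : tm G (ty1 ~> ty1)) (y x : tm G ty1) : fm G :=
  rlt (rsub $ y $ (F $ y)) x //\ rlt x (radd $ y $ (F $ y)).

(* The finite sequence y_0, ..., y_k is given by k (variable 1) and a type
   0 -> 1 object (variable 0). *)
Definition finite_subcover {G} (F : tm G (ty1 ~> ty1)) : fm G :=
  EX ty0, EX ty0 ~> ty1,
    (ALL ty0, nle var0 var2 ->> mem (var1 $ var0) setI) //\
    (ALL ty1, setI ->>
      EX ty0, nle var0 (tvar (vs (vs (vs vz)))) //\
             in_canonical (wk (wk (wk (wk F)))) (var2 $ var0) var1).

Definition HBU : fm [] :=
  ALL ty1 ~> ty1, pos_function setR var0 ->> finite_subcover var0.

Definition HBUae : fm [] :=
  ALL ty1 ~> ty1, pos_function setI var0 //\ continuous_ae var0 ->> finite_subcover var0.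

(* Main.v *)
From Stdlib Require Import List FunctionalExtensionality PropExtensionality.
From Stdlib Require Import Classical ClassicalEpsilon PeanoNat Eqdep_dec.
From HB Require Import structures.
From mathcomp Require Import all_boot all_order all_algebra ring lra.
Require Import Defs.

(** By completeness it is enough to argue in an arbitrary model of the axioms,
    where the numbers embed in an ordered field, so that rational arithmetic is
    field arithmetic.

    HBU follows from itself restricted to functions on [0,1] by precomposing with
    the clamp onto [0,1].  For the converse let g : [0,1] -> [0,1] be a function
    of the Cantor type: it is locally constant off a closed null set, Hoelder
    continuous of exponent 1/2, and its values at dyadic points exhaust the dyadic
    points.  For any F with positive values the function min(1, F(g x))^2 / 256 is
    then continuous almost everywhere, however wild F is.  If the canonical cover
    of this function is witnessed by y_0, ..., y_k, then g y_0, ..., g y_k witness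
    the canonical cover of F: given z approximate it by g x with x dyadic, the
    error being small compared with a common lower bound of F(g y_0), ...,
    F(g y_k), which quantifier-free choice provides. *)

Set Implicit Arguments.
Unset Strict Implicit.
Unset Printing Implicit Defensive.

(** * Completeness *)

(** A model may be nonstandard and has only quantifier-free induction and QF-AC^{1,0}. So every
    auxiliary function must be a term, every induction must speak of explicit witnesses, and even
    the number k of points of a cover may be nonstandard. This is why g is defined by counting: let
    a_m(j) be the number of i < j whose last m base-4 digits are all 0 or 1; then g(x) is the limit
    of 2^-m a_m(floor(4^m x)). Only 2^m of the 4^m indices are counted, so g varies only inside
    about 2^m intervals of length about 4^-m, and a rise of 2^-m over a length 4^-m is what yields
    the exponent 1/2. The composite of F and g is constant wherever g is. The shape c^2 / 256 with c
    = min(1, F) inverts the modulus |g x - g y| <= 2^j |x - y| + 2 * 2^-j: with 2^-j between c/16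
    and c/8 the right side stays below c/2, and the rest of the radius absorbs the replacement of z
    by a dyadic value of g. The lower bound common to all F(g y_i) is 2^-N, where N is the sum of
    chosen indices at which positivity of the F(g y_i) shows. *)

Definition var_inv {r G} (P : forall s, var (r :: G) s -> Type)
    (hz : P r vz) (hs : forall s (y : var G s), P s (vs y)) s (x : var (r :: G) s) :
    P s x :=
  match x as x' in var D s' return
    match D return var D s' -> Type with
    | nil => fun _ => unit
    | r' :: G' => fun x => forall P : forall s, var (r' :: G') s -> Type,
        P r' vz -> (forall s (y : var G' s), P s (vs y)) -> P s' x
    end x'
  with
  | vz _ _ => fun P hz hs => hz
  | vs _ _ _ y => fun P hz hs => hs _ y
  end P hz hs.

Definition no_var s (x : var nil s) (P : Type) : P :=
  match x in var D s' return match D with nil => P | _ => unit end with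
  | vz _ _ => tt
  | vs _ _ _ _ => tt
  end.

Lemma varext (F : ty -> Type) G (f g : forall s, var G s -> F s) :
  (forall s x, f s x = g s x) -> f = g.
Proof.
move=> fg; apply: functional_extensionality_dep => s.
by apply: functional_extensionality_dep => x.
Qed.

Lemma varext_cons (F : ty -> Type) r G (f g : forall s, var (r :: G) s -> F s) :
  f r vz = g r vz -> (forall s y, f s (vs y) = g s (vs y)) -> f = g.
Proof. by move=> h1 h2; apply: varext; apply: var_inv. Qed.

Lemma varext_nil (F : ty -> Type) (f g : forall s, var nil s -> F s) : f = g.
Proof. by apply: varext => s x; exact: (no_var x). Qed.

(** * Renaming, substitution and weakening of derivations *)

Definition vars {G} : substitution G G := fun s x => tvar x.
Definition rs {G D} (f : renaming G D) : substitution G D := fun s x => tvar (f s x).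

Lemma up_ren_comp G D E r (f : renaming G D) (g : renaming D E) :
  (fun s x => up_ren g (up_ren f x)) = up_ren (r := r) (fun s x => g s (f s x)).
Proof. exact: varext_cons. Qed.

Lemma ren_ren G D E (f : renaming G D) (g : renaming D E) s (t : tm G s) :
  ren_tm g (ren_tm f t) = ren_tm (fun s x => g s (f s x)) t.
Proof. by elim: t => //= a b u -> v ->. Qed.

Lemma ren_fm_ren G D E (f : renaming G D) (g : renaming D E) (A : fm G) :
  ren_fm g (ren_fm f A) = ren_fm (fun s x => g s (f s x)) A.
Proof.
elim: A D E f g => {G} [G t u|G t u|G|G A IA B IB|G A IA B IB|G A IA B IB|G s A IA|G s A IA] D E f g //=.
all: by rewrite ?ren_ren ?IA ?IB ?up_ren_comp.
Qed.

Lemma sub_rs G D (f : renaming G D) s (t : tm G s) : sub_tm (rs f) t = ren_tm f t.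
Proof. by elim: t => //= a b u -> v ->. Qed.

Lemma up_sub_rs G D r (f : renaming G D) : up_sub (rs f) = rs (up_ren (r := r) f).
Proof. exact: varext_cons. Qed.

Lemma sub_fm_rs G D (f : renaming G D) (A : fm G) : sub_fm (rs f) A = ren_fm f A.
Proof.
elim: A D f => {G} [G t u|G t u|G|G A IA B IB|G A IA B IB|G A IA B IB|G s A IA|G s A IA] D f //=.
all: by rewrite ?sub_rs ?up_sub_rs ?IA ?IB.
Qed.

Lemma sub_ren G D E (f : renaming G D) (g : substitution D E) s (t : tm G s) :
  sub_tm g (ren_tm f t) = sub_tm (fun s x => g s (f s x)) t.
Proof. by elim: t => //= a b u -> v ->. Qed.

Lemma ren_sub G D E (f : substitution G D) (g : renaming D E) s (t : tm G s) :
  ren_tm g (sub_tm f t) = sub_tm (fun s x => ren_tm g (f s x)) t.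
Proof. by elim: t => //= a b u -> v ->. Qed.

Lemma up_sub_ren G D E r (f : renaming G D) (g : substitution D E) :
  (fun s x => up_sub g (up_ren f x)) = up_sub (r := r) (fun s x => g s (f s x)).
Proof. exact: varext_cons. Qed.

Lemma sub_fm_ren G D E (f : renaming G D) (g : substitution D E) (A : fm G) :
  sub_fm g (ren_fm f A) = sub_fm (fun s x => g s (f s x)) A.
Proof.
elim: A D E f g => {G} [G t u|G t u|G|G A IA B IB|G A IA B IB|G A IA B IB|G s A IA|G s A IA] D E f g //=.
all: by rewrite ?sub_ren ?IA ?IB ?up_sub_ren.
Qed.

Lemma up_sub_comp G D E r (f : substitution G D) (g : substitution D E) :
  (fun s x => sub_tm (up_sub g) (up_sub f x)) =
  up_sub (r := r) (fun s x => sub_tm g (f s x)).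
Proof.
apply: varext_cons => //= s y; rewrite /up_sub /= /wk.
by rewrite sub_ren ren_sub.
Qed.

Lemma sub_sub G D E (f : substitution G D) (g : substitution D E) s (t : tm G s) :
  sub_tm g (sub_tm f t) = sub_tm (fun s x => sub_tm g (f s x)) t.
Proof. by elim: t => //= a b u -> v ->. Qed.

Lemma sub_fm_sub G D E (f : substitution G D) (g : substitution D E) (A : fm G) :
  sub_fm g (sub_fm f A) = sub_fm (fun s x => sub_tm g (f s x)) A.
Proof.
elim: A D E f g => {G} [G t u|G t u|G|G A IA B IB|G A IA B IB|G A IA B IB|G s A IA|G s A IA] D E f g //=.
all: by rewrite ?sub_sub ?IA ?IB ?up_sub_comp.
Qed.

Lemma sub_vars G s (t : tm G s) : sub_tm vars t = t.
Proof. by elim: t => //= a b u -> v ->. Qed.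

Lemma up_vars G r : up_sub (r := r) (@vars G) = vars.
Proof. exact: varext_cons. Qed.

Lemma sub_fm_vars G (A : fm G) : sub_fm vars A = A.
Proof.
elim: A => {G} [G t u|G t u|G|G A IA B IB|G A IA B IB|G A IA B IB|G s A IA|G s A IA] //=.
all: by rewrite ?sub_vars ?up_vars ?IA ?IB.
Qed.

Lemma ren_sub_fm G D E (f : substitution G D) (g : renaming D E) (A : fm G) :
  ren_fm g (sub_fm f A) = sub_fm (fun s x => ren_tm g (f s x)) A.
Proof.
rewrite -sub_fm_rs sub_fm_sub; congr (sub_fm _ _).
by apply: varext => s x; rewrite sub_rs.
Qed.

Lemma sub_up_inst G D r (f : substitution G D) (A : fm (r :: G)) (t : tm D r) :
  inst (sub_fm (up_sub f) A) t = sub_fm (scons t f) A.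
Proof.
rewrite /inst sub_fm_sub; congr (sub_fm _ _).
by apply: varext_cons => //= s y; rewrite /up_sub /= /wk sub_ren sub_vars.
Qed.

Lemma ren_inst G D r (f : renaming G D) (A : fm (r :: G)) (t : tm G r) :
  ren_fm f (inst A t) = inst (ren_fm (up_ren f) A) (ren_tm f t).
Proof.
rewrite /inst ren_sub_fm sub_fm_ren; congr (sub_fm _ _).
exact: varext_cons.
Qed.

Lemma ren_wk_fm G D r (f : renaming G D) (A : fm G) :
  ren_fm (up_ren (r := r) f) (wk_fm A) = wk_fm (ren_fm f A).
Proof. by rewrite /wk_fm !ren_fm_ren. Qed.

Lemma ren_wk G D r (f : renaming G D) s (t : tm G s) :
  ren_tm (up_ren (r := r) f) (wk t) = wk (ren_tm f t).
Proof. by rewrite /wk !ren_ren. Qed.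

Lemma ren_feqT G D (f : renaming G D) s (t u : tm G s) :
  ren_fm f (feqT t u) = feqT (ren_tm f t) (ren_tm f u).
Proof.
by elim: s G D f t u => [|a Ia b Ib] G D f t u //=; rewrite Ib /= !ren_wk.
Qed.

Lemma ren_at_succ G D (f : renaming G D) (A : fm (ty0 :: G)) :
  ren_fm (up_ren f) (at_succ A) = at_succ (ren_fm (up_ren f) A).
Proof.
rewrite /at_succ ren_sub_fm sub_fm_ren; congr (sub_fm _ _).
exact: varext_cons.
Qed.

Lemma ren_ac_graph G D (f : renaming G D) s t (A : fm (t :: s :: G)) :
  ren_fm (up_ren (up_ren f)) (ac_graph A) = ac_graph (ren_fm (up_ren (up_ren f)) A).
Proof.
rewrite /ac_graph ren_sub_fm sub_fm_ren; congr (sub_fm _ _).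
apply: varext_cons => // r x.
by move: r x; apply: var_inv.
Qed.

Lemma qf_ren G D (f : renaming G D) (A : fm G) : qf (ren_fm f A) = qf A.
Proof.
by elim: A D f => {G} [G t u|G t u|G|G A IA B IB|G A IA B IB|G A IA B IB|G s A IA|G s A IA] D f //=;
  rewrite IA IB.
Qed.

(** The axioms are schemes in arbitrary terms and formulas, so a renamed instance is again an
    instance. Induction and choice rest on renaming commuting with [at_succ] and [ac_graph] and
    keeping formulas quantifier-free. *)
Lemma RCA0w_ren G D (f : renaming G D) (A : fm G) : RCA0w A -> RCA0w (ren_fm f A).
Proof.
move=> ax; case: G A / ax D f.
all: try by intros; constructor.
all: intros; rewrite /= ?ren_feqT /=.
- exact: ax_K.
- exact: ax_S.
- exact: ax_ext.
- rewrite ren_inst ren_at_succ; apply: (@ax_ind _ (ren_fm (up_ren f) A)).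
  by rewrite qf_ren.
- rewrite ren_ac_graph; apply: (@ax_qfac _ (ren_fm (up_ren (up_ren f)) A)).
  by rewrite qf_ren.
Qed.

Lemma prf_ren G (H : list (fm G)) (A : fm G) : prf RCA0w H A ->
  forall D (f : renaming G D) H', (forall B, In B H -> In (ren_fm f B) H') ->
  prf RCA0w H' (ren_fm f A).
Proof.
(* Under a quantifier all hypotheses are weakened; weakening commutes with the renaming lifted by
   [up_ren]. *)
have ext G' D r (f : renaming G' D) (H0 : list (fm G')) H' :
    (forall B, In B H0 -> In (ren_fm f B) H') ->
    forall B, In B (List.map (@wk_fm G' r) H0) ->
      In (ren_fm (up_ren f) B) (List.map (@wk_fm D r) H').
  move=> sub B /in_map_iff[C [<- HC]]; rewrite ren_wk_fm.
  by apply: in_map; apply: sub.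
have ext1 G' D (f : renaming G' D) C (H0 : list (fm G')) H' :
    (forall B, In B H0 -> In (ren_fm f B) H') ->
    forall B, In B (C :: H0) -> In (ren_fm f B) (ren_fm f C :: H').
  by move=> sub B [<-|HB]; [left|right; apply: sub].
elim=> {G H A} /=.
- by move=> G H A ax D f H' sub; apply: p_ax; apply: RCA0w_ren.
- by move=> G H A HA D f H' sub; apply: p_hyp; apply: sub.
- move=> G H A _ IH D f H' sub; apply: p_raa.
  by apply: (IH D f (fnot (ren_fm f A) :: H')); apply: (ext1 _ _ f (fnot A)).
- by move=> G H A B _ IH D f H' sub; apply: p_impI; apply: IH; apply: ext1.
- by move=> G H A B _ IH1 _ IH2 D f H' sub; apply: (p_impE (IH1 _ _ _ sub)); apply: IH2.
- by move=> G H A B _ IH1 _ IH2 D f H' sub; apply: p_andI; [apply: IH1|apply: IH2].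
- by move=> G H A B _ IH D f H' sub; apply: (p_andE1 (IH _ _ _ sub)).
- by move=> G H A B _ IH D f H' sub; apply: (p_andE2 (IH _ _ _ sub)).
- by move=> G H A B _ IH D f H' sub; apply: p_orI1; apply: IH.
- by move=> G H A B _ IH D f H' sub; apply: p_orI2; apply: IH.
- move=> G H A B C _ IH1 _ IH2 _ IH3 D f H' sub; apply: (p_orE (IH1 _ _ _ sub)).
  + by apply: IH2; apply: ext1.
  + by apply: IH3; apply: ext1.
- by move=> G H s A _ IH D f H' sub; apply: p_allI; apply: IH; apply: ext.
- by move=> G H s A t _ IH D f H' sub; rewrite ren_inst; apply: p_allE; apply: IH.
- move=> G H s A t _ IH D f H' sub; apply: (p_exI (t := ren_tm f t)).
  by rewrite -ren_inst; apply: IH.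
- move=> G H s A C _ IH1 _ IH2 D f H' sub; apply: (p_exE (IH1 _ _ _ sub)).
  by rewrite -ren_wk_fm; apply: IH2; apply: ext1; apply: ext.
- by move=> G H t D f H' sub; apply: p_refl.
- move=> G H A t u _ IH1 _ IH2 D f H' sub; rewrite ren_inst.
  apply: (p_subst (t := ren_tm f t)); first exact: IH1.
  by rewrite -ren_inst; apply: IH2.
Qed.

Lemma prf_wk G r (H : list (fm G)) (A : fm G) :
  prf RCA0w H A -> prf RCA0w (List.map (@wk_fm G r) H) (wk_fm A).
Proof. by move=> /prf_ren; apply=> B; apply: in_map. Qed.

(** The identity renaming in [prf_ren] leaves only the change of hypotheses. *)
Lemma prf_incl G (H H' : list (fm G)) (A : fm G) :
  prf RCA0w H A -> incl H H' -> prf RCA0w H' A.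
Proof.
have idr (B : fm G) : ren_fm (fun s x => x) B = B by rewrite -sub_fm_rs; apply: sub_fm_vars.
by move=> p sub; rewrite -(idr A); apply: prf_ren p _ _ _ _ => B /sub; rewrite idr.
Qed.

(** * Enumeration of formulas *)

Local Notation node := GenTree.Node.
Local Notation leaf := GenTree.Leaf.
Local Notation tree := (GenTree.tree nat).

(** Syntax is embedded in trees over [nat], a countable type, so that [pickle] numbers the formulas
    over each context. *)
Fixpoint ty_code (s : ty) : tree :=
  match s with
  | tnat => node 0 [::]
  | tarr a b => node 1 [:: ty_code a; ty_code b]
  end.

Lemma ty_code_inj : injective ty_code.
Proof. by elim=> [|a Ia b Ib] [|a' b'] //= [] /Ia-> /Ib->. Qed.

Fixpoint var_index G s (x : var G s) : nat :=
  match x with vz _ _ => 0 | vs _ _ _ y => (var_index y).+1 end.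

Lemma ty_eq_dec (s t : ty) : {s = t} + {s <> t}.
Proof. decide equality. Defined.

Lemma existT_inj (F : ty -> Type) s (x y : F s) : existT F s x = existT F s y -> x = y.
Proof. exact: (Eqdep_dec.inj_pair2_eq_dec _ ty_eq_dec). Qed.

Lemma var_index_inj G s (x : var G s) s' (x' : var G s') :
  var_index x = var_index x' -> existT (var G) s x = existT (var G) s' x'.
Proof.
elim: x s' x' => {G s} [G s|G s r x IH] s' x'.
  by move: s' x'; refine (var_inv _ _).
move: s' x'; refine (var_inv _ _) => //= s' y [] /IH h.
exact: (congr1 (fun p : {s & var G s} => existT (var (r :: G)) _ (vs (projT2 p))) h).
Qed.

Fixpoint tm_code G s (t : tm G s) : tree :=
  match t with
  | tvar s x => node 0 [:: leaf (var_index x)]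
  | tapp a b t u => node 1 [:: ty_code a; tm_code t; tm_code u]
  | czero => node 2 [::]
  | cone => node 3 [::]
  | cadd => node 4 [::]
  | cmul => node 5 [::]
  | cK a b => node 6 [:: ty_code a; ty_code b]
  | cS a b c => node 7 [:: ty_code a; ty_code b; ty_code c]
  | crec => node 8 [::]
  end.

(** Stating the conclusion for pairs of a type and a term lets the induction find out that the types
    agree; decidability of equality on [ty] then makes the terms equal. *)
Lemma tm_code_inj G s (t : tm G s) s' (t' : tm G s') :
  tm_code t = tm_code t' -> existT (tm G) s t = existT (tm G) s' t'.
Proof.
elim: t s' t' => [s0 x|a b t IHt u IHu|||||a b|a b c|] s' t'; case: t' => //=.
- by move=> s1 x1 [] /var_index_inj [] e; subst s1 => /(@existT_inj (var G) _ _ _) ->.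
- move=> a' b' t' u' [] /ty_code_inj e; subst a' => et eu.
  case: (IHt _ _ et) => e; subst b' => /(@existT_inj (tm G) _ _ _) ->.
  by case: (IHu _ _ eu) => /(@existT_inj (tm G) _ _ _) ->.
- by move=> a' b' [] /ty_code_inj-> /ty_code_inj->.
- by move=> a' b' c' [] /ty_code_inj-> /ty_code_inj-> /ty_code_inj->.
Qed.

Fixpoint fm_code G (A : fm G) : tree :=
  match A with
  | feq t u => node 0 [:: tm_code t; tm_code u]
  | flt t u => node 1 [:: tm_code t; tm_code u]
  | fbot => node 2 [::]
  | fimp A B => node 3 [:: fm_code A; fm_code B]
  | fand A B => node 4 [:: fm_code A; fm_code B]
  | for_ A B => node 5 [:: fm_code A; fm_code B]
  | fall s A => node 6 [:: ty_code s; fm_code A]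
  | fex s A => node 7 [:: ty_code s; fm_code A]
  end.

Lemma fm_code_inj G : injective (@fm_code G).
Proof.
elim=> {G} [G t u|G t u|G|G A IA B IB|G A IA B IB|G A IA B IB|G s A IA|G s A IA] [] //=.
1,2: by move=> t' u' [] /tm_code_inj /(@existT_inj (tm G) _ _ _) ->
  /tm_code_inj /(@existT_inj (tm G) _ _ _) ->.
1-3: by move=> A' B' [] /IA-> /IB->.
all: by move=> s' A' [] /ty_code_inj e; subst s' => /IA->.
Qed.

Definition fm_enum G (k : nat) : fm G :=
  epsilon (inhabits fbot) (fun A => pickle (fm_code A) = k).

Lemma fm_enumP G (A : fm G) : fm_enum G (pickle (fm_code A)) = A.
Proof.
have h : exists B : fm G, pickle (fm_code B) = pickle (fm_code A) by exists A.
by move: (epsilon_spec (inhabits fbot) _ h) => /(pcan_inj pickleK) /fm_code_inj.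
Qed.

(** * Stages of the Henkin construction *)

Definition consistent G (H : list (fm G)) := ~ prf RCA0w H fbot.

Lemma prf_weak G (H : list (fm G)) A B : prf RCA0w H A -> prf RCA0w (B :: H) A.
Proof. by move=> p; apply: (prf_incl p) => C; right. Qed.

Lemma prf_top G (H : list (fm G)) : prf RCA0w H (fimp fbot fbot).
Proof. by apply: p_impI; apply: p_hyp; left. Qed.

Lemma prf_hyp0 G (H : list (fm G)) A : prf RCA0w (A :: H) A.
Proof. by apply: p_hyp; left. Qed.

Lemma consistent_split G (H : list (fm G)) A : consistent H ->
  ~ consistent (A :: H) -> consistent (fnot A :: H).
Proof.
move=> cH /NNPP pA pN; apply: cH; apply: (p_impE (A := A)); first exact: p_impI.
exact: p_raa.
Qed.

Lemma consistent_witness G (H : list (fm G)) s (A : fm (s :: G)) :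
  consistent H -> prf RCA0w H (fex s A) ->
  consistent (A :: List.map (@wk_fm G s) H).
Proof. by move=> cH pE p; apply: cH; apply: (p_exE pE). Qed.

Lemma nat_eq_dec (n m : nat) : {n = m} + {n <> m}.
Proof. exact: PeanoNat.Nat.eq_dec. Qed.

(* A stage lists the formulas accepted so far over the current context.  The
   formula [pending m i] is the i-th formula over the m-th context, read over the
   current one; each is decided, and if existential given a witness, at some
   later stage.  Every stage adds one variable, the Henkin constant. *)
Record stage := Stage {
  sctx : ctx;
  accepted : list (fm sctx);
  pending : nat -> nat -> fm sctx }.

Definition decide_fm (S : stage) (A : fm (sctx S)) : fm (sctx S) :=
  if excluded_middle_informative (consistent (A :: accepted S)) then A else fnot A.

(** A formula that is not existential gets a dummy constant of type 0 and a trivial witness formula,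
    so that every stage adds exactly one variable. *)
Definition witness_ty G (B : fm G) : ty := match B with fex s _ => s | _ => ty0 end.

Definition witness_fm G (B : fm G) : fm (witness_ty B :: G) :=
  match B as B0 return fm (witness_ty B0 :: G) with
  | fex s C => C
  | _ => fimp fbot fbot
  end.

(** The last component of the decoded triple is padding: because of it each pair recurs at
    arbitrarily late stages. *)
Definition agenda (n : nat) : nat * nat :=
  match @unpickle (nat * nat * nat)%type n with Some (p, _) => p | None => (0, 0)%N end.

Lemma agendaP m i k : exists2 n, (k <= n)%N & agenda n = (m, i).
Proof.
have [//|h] := classic (exists2 n, (k <= n)%N & agenda n = (m, i)).
(* Otherwise the k+1 distinct codes of (m, i, j) with j <= k would all be numbers below k. *)
pose f (j : 'I_k.+1) : nat := pickle (m, i, val j).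
have fP j : (f j < k)%N.
  rewrite ltnNge; apply/negP => kf; apply: h; exists (f j) => //.
  by rewrite /agenda /f pickleK.
pose f' j : 'I_k := Ordinal (fP j).
have : injective f'.
  by move=> j j' [] /(pcan_inj pickleK) [] /val_inj.
by move=> /leq_card; rewrite !card_ord ltnn.
Qed.

Definition next_fm (n : nat) (S : stage) : fm (sctx S) :=
  decide_fm (pending S (agenda n).1 (agenda n).2).

Definition next_stage (n : nat) (S : stage) : stage :=
  let B := next_fm n S in
  @Stage (witness_ty B :: sctx S)
    (witness_fm B :: List.map (@wk_fm _ _) (B :: accepted S))
    (fun m i => if m == n.+1 then fm_enum _ i else wk_fm (pending S m i)).

Lemma prf_witness G (H : list (fm G)) (B : fm G) :
  prf RCA0w (B :: H) (fex (witness_ty B) (witness_fm B)).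
Proof.
case: B => [t u|t u||C D|C D|C D|s C|s C] /=;
  try by apply: (p_exI (t := czero)); apply: prf_top.
exact: prf_hyp0.
Qed.

Lemma wk_fm_ex G r (B : fm G) s (C : fm (s :: r :: G)) : wk_fm B = fex s C ->
  exists2 C0, B = fex s C0 & C = ren_fm (up_ren (fun s x => vs x)) C0.
Proof.
case: B => [t u|t u||D E|D E|D E|a D|a D] //= [] e; subst s.
by move=> /(@existT_inj (fun a => fm (a :: r :: G)) _ _ _) <-; exists D.
Qed.

Lemma inst_up_var0 G s (A : fm (s :: G)) :
  inst (ren_fm (up_ren (fun r x => vs x)) A) var0 = A.
Proof.
rewrite /inst sub_fm_ren -[RHS]sub_fm_vars.
by congr (sub_fm _ _); apply: varext_cons.
Qed.

Lemma witness_spec G (B : fm G) s (C : fm (s :: G)) H : B = fex s C ->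
  exists t, prf RCA0w (witness_fm B :: H) (inst (ren_fm (up_ren (fun s x => vs x)) C) t).
Proof.
move=> eB; subst B; exists var0; apply: p_hyp; left.
by rewrite inst_up_var0.
Qed.

(** * Structures and satisfaction *)

Definition env (F : ty -> Type) (G : ctx) := forall s, var G s -> F s.

Definition econs (F : ty -> Type) r G (u : F r) (e : env F G) : env F (r :: G) :=
  fun s x => var_case x (fun E => match E in _ = s' return F s' with erefl => u end) (e s).

Definition enil (F : ty -> Type) : env F nil := fun s x => no_var x (F s).

Lemma econs_eta (F : ty -> Type) r G (e : env F (r :: G)) :
  e = econs (e r vz) (fun s x => e s (vs x)).
Proof. exact: varext_cons. Qed.

(** General models in the sense of Henkin: higher types are arbitrary sets with an application map,
    and equality at type 0 is at first an arbitrary relation. *)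
Record structure := Structure {
  car : ty -> Type;
  sapp : forall s t, car (tarr s t) -> car s -> car t;
  szero : car ty0;
  sone : car ty0;
  sadd : car (tarr ty0 (tarr ty0 ty0));
  smul : car (tarr ty0 (tarr ty0 ty0));
  sK : forall s t, car (tarr s (tarr t s));
  sS : forall r s t, car (tarr (tarr r (tarr s t)) (tarr (tarr r s) (tarr r t)));
  srec : car (tarr (tarr ty0 (tarr ty0 ty0)) (tarr ty0 (tarr ty0 ty0)));
  seq0 : car ty0 -> car ty0 -> Prop;
  slt : car ty0 -> car ty0 -> Prop }.

Fixpoint eval (M : structure) G (e : env (car M) G) s (t : tm G s) : car M s :=
  match t in tm _ s' return car M s' with
  | tvar s x => e s x
  | tapp a b t u => sapp (eval e t) (eval e u)
  | czero => szero M
  | cone => sone M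
  | cadd => sadd M
  | cmul => smul M
  | cK a b => sK M a b
  | cS a b c => sS M a b c
  | crec => srec M
  end.

Fixpoint sat (M : structure) G (e : env (car M) G) (A : fm G) : Prop :=
  match A with
  | feq t u => seq0 (eval e t) (eval e u)
  | flt t u => slt (eval e t) (eval e u)
  | fbot => False
  | fimp A B => sat e A -> sat e B
  | fand A B => sat e A /\ sat e B
  | for_ A B => sat e A \/ sat e B
  | fall s A => forall a, sat (econs a e) A
  | fex s A => exists a, sat (econs a e) A
  end.

Section Semantics.
Variable M : structure.
Implicit Types (G D : ctx).

Lemma eval_sub G D (f : substitution G D) (e : env (car M) D) s (t : tm G s) :
  eval e (sub_tm f t) = eval (fun s x => eval e (f s x)) t.
Proof. by elim: t => //= a b t -> u ->. Qed.

Lemma eval_ren G D (f : renaming G D) (e : env (car M) D) s (t : tm G s) :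
  eval e (ren_tm f t) = eval (fun s x => e s (f s x)) t.
Proof. by rewrite -sub_rs eval_sub. Qed.

Lemma eval_wk G r (a : car M r) (e : env (car M) G) s (t : tm G s) :
  eval (econs a e) (wk t) = eval e t.
Proof. by rewrite /wk eval_ren. Qed.

Lemma eval_up G D r (f : substitution G D) (e : env (car M) D) (a : car M r) :
  (fun s x => eval (econs a e) (up_sub f x)) = econs a (fun s x => eval e (f s x)).
Proof. by apply: varext_cons => [//|s y]; apply: eval_wk. Qed.

Lemma sat_sub G D (f : substitution G D) (e : env (car M) D) (A : fm G) :
  sat e (sub_fm f A) <-> sat (fun s x => eval e (f s x)) A.
Proof.
elim: A D f e => {G} [G t u|G t u|G|G A IA B IB|G A IA B IB|G A IA B IB|G s A IA|G s A IA] D f e /=.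
- by rewrite !eval_sub.
- by rewrite !eval_sub.
- by [].
- by rewrite IA IB.
- by rewrite IA IB.
- by rewrite IA IB.
- by split=> h a; move: (h a); rewrite IA eval_up.
- by split=> -[a h]; exists a; move: h; rewrite IA eval_up.
Qed.

Lemma sat_ren G D (f : renaming G D) (e : env (car M) D) (A : fm G) :
  sat e (ren_fm f A) <-> sat (fun s x => e s (f s x)) A.
Proof. by rewrite -sub_fm_rs sat_sub. Qed.

Lemma eval_scons G D r (t : tm D r) (f : substitution G D) (e : env (car M) D) :
  (fun s x => eval e (scons t f x)) = econs (eval e t) (fun s x => eval e (f s x)).
Proof. exact: varext_cons. Qed.

Lemma sat_inst G r (e : env (car M) G) (A : fm (r :: G)) (t : tm G r) :
  sat e (inst A t) <-> sat (econs (eval e t) e) A.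
Proof. by rewrite /inst sat_sub eval_scons. Qed.

Fixpoint exteq s : car M s -> car M s -> Prop :=
  match s with
  | tnat => @seq0 M
  | tarr a b => fun f g => forall x, exteq (sapp f x) (sapp g x)
  end.

Lemma sat_feqT G (e : env (car M) G) s (t u : tm G s) :
  sat e (feqT t u) <-> exteq (eval e t) (eval e u).
Proof.
elim: s G e t u => [|a Ia b Ib] G e t u //=.
by split=> h x; have := h x; rewrite Ib /= !eval_wk.
Qed.

Definition satisfies_axioms := forall G (A : fm G) (e : env (car M) G), RCA0w A -> sat e A.

End Semantics.

Record is_model (M : structure) : Prop := IsModel {
  model_ax : satisfies_axioms M;
  model_eq : forall a b : car M ty0, seq0 a b <-> a = b;
  model_ext : forall s t (f g : car M (tarr s t)),
    (forall x, sapp f x = sapp g x) -> f = g }.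

(** * The quotient by extensional equality *)

Section Quotient.
Variable M : structure.
Hypothesis axM : satisfies_axioms M.
Hypothesis eqM : forall a : car M ty0, seq0 a a.
Hypothesis substM : forall G (A : fm (ty0 :: G)) (e : env (car M) G) a b,
  seq0 a b -> sat (econs a e) A -> sat (econs b e) A.

Lemma exteq_refl s (a : car M s) : exteq a a.
Proof. by elim: s a => //= s1 I1 s2 I2 a x; apply: I2. Qed.

Lemma exteq_sym s (a b : car M s) : exteq a b -> exteq b a.
Proof.
elim: s a b => [|s1 I1 s2 I2] a b /=; last by move=> h x; apply: I2.
(* Replace a by b on the left of the true equation of a with itself. *)
by move=> ab; apply: (@substM _ (feq var0 (tvar (vs vz))) (econs a (@enil _)) a b ab (eqM a)).
Qed.

Lemma exteq_trans s (a b c : car M s) : exteq a b -> exteq b c -> exteq a c.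
Proof.
elim: s a b c => [|s1 I1 s2 I2] a b c /=; last by move=> h1 h2 z; apply: I2 (h1 z) (h2 z).
by move=> ab bc; apply: (@substM _ (feq (tvar (vs vz)) var0) (econs a (@enil _)) b c bc ab).
Qed.

(** Here the extensionality axiom enters: it makes application well defined on classes. *)
Lemma exteq_sapp s t (f g : car M (tarr s t)) x y :
  exteq f g -> exteq x y -> exteq (sapp f x) (sapp g y).
Proof.
move=> fg xy.
pose e := econs g (econs x (econs y (@enil (car M)))).
have /= := axM e (ax_ext var0 var1 var2).
rewrite !sat_feqT => /(_ xy) h.
exact: exteq_trans (fg x) h.
Qed.

Definition qcar s := {P : car M s -> Prop | exists a, P = exteq a}.
Definition cls s (a : car M s) : qcar s := exist _ (exteq a) (ex_intro _ a erefl).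
Definition rep s (p : qcar s) : car M s :=
  proj1_sig (constructive_indefinite_description _ (proj2_sig p)).

Lemma cls_eq s (a b : car M s) : cls a = cls b <-> exteq a b.
Proof.
split=> [[e]|h]; first by rewrite e; apply: exteq_refl.
apply: eq_sig_hprop => /= [P p q|]; first exact: proof_irrelevance.
apply: functional_extensionality => c; apply: propositional_extensionality.
by split; [apply: exteq_trans; apply: exteq_sym|apply: exteq_trans].
Qed.

Lemma rep_cls s (a : car M s) : exteq (rep (cls a)) a.
Proof.
rewrite /rep; case: constructive_indefinite_description => /= b e.
by rewrite -e; apply: exteq_refl.
Qed.

Lemma cls_rep s (p : qcar s) : cls (rep p) = p.
Proof.
case: p => P [a e]; subst P; apply/cls_eq; exact: (rep_cls a).
Qed.

Definition quotient : structure := {|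
  car := qcar;
  sapp s t f x := cls (sapp (rep f) (rep x));
  szero := cls (szero M); sone := cls (sone M); sadd := cls (sadd M); smul := cls (smul M);
  sK s t := cls (sK M s t); sS r s t := cls (sS M r s t); srec := cls (srec M);
  seq0 := @eq _; slt a b := slt (rep a) (rep b) |}.

Definition cls_env G (e : env (car M) G) : env qcar G := fun s x => cls (e s x).

Lemma cls_sapp s t (f : car M (tarr s t)) x :
  @sapp quotient _ _ (cls f) (cls x) = cls (sapp f x).
Proof. by apply/cls_eq; apply: exteq_sapp; apply: rep_cls. Qed.

Lemma eval_quotient G (e : env (car M) G) s (t : tm G s) :
  @eval quotient _ (cls_env e) s t = cls (eval e t).
Proof. by elim: t => //= a b t -> u ->; exact: cls_sapp. Qed.

Lemma slt_congr a b c d : exteq a b -> exteq c d -> slt a c -> @slt M b d.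
Proof.
move=> ab cd ac.
have h := @substM _ (flt var0 (tvar (vs vz))) (econs c (@enil _)) a b ab ac.
exact: (@substM _ (flt (tvar (vs vz)) var0) (econs b (@enil _)) c d cd h).
Qed.

Lemma sat_quotient G (e : env (car M) G) (A : fm G) :
  @sat quotient _ (cls_env e) A <-> sat e A.
Proof.
have econsE r H (f : env (car M) H) a : @econs qcar r H (cls a) (cls_env f) = cls_env (econs a f).
  exact: varext_cons.
elim: A e => {G} [G t u|G t u|G|G A IA B IB|G A IA B IB|G A IA B IB|G s A IA|G s A IA] e /=.
- by rewrite !eval_quotient cls_eq.
- rewrite !eval_quotient; split; apply: slt_congr; try exact: rep_cls;
  by apply: exteq_sym; apply: rep_cls.
- by [].
- by rewrite IA IB.
- by rewrite IA IB.
- by rewrite IA IB.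
- split=> h a; first by rewrite -IA -econsE.
  by rewrite -(cls_rep a) econsE IA.
- split=> -[a h]; last by exists (cls a); rewrite econsE IA.
  by exists (rep a); rewrite -IA -econsE cls_rep.
Qed.

(** In the quotient, equality at type 0 is identity and functions are determined by their values, so
    that the numbers can carry ordinary algebraic structures. *)
Lemma quotient_model : is_model quotient.
Proof.
split=> // [G A e ax|s t f g fg].
  have -> : e = cls_env (fun s x => rep (e s x)) by apply: varext => s x; rewrite /cls_env cls_rep.
  by rewrite sat_quotient; apply: axM.
rewrite -(cls_rep f) -(cls_rep g); apply/cls_eq => x.
by apply/cls_eq; rewrite -!cls_sapp !cls_rep.
Qed.

End Quotient.

(** * The term model of a consistent sentence *)

Section Henkin.
Variables (phi : fm nil) (phi_cons : consistent [:: phi]).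

Fixpoint stages (n : nat) : stage :=
  match n with
  | 0 => Stage [:: phi] (fun m i => fm_enum nil i)
  | n.+1 => next_stage n (stages n)
  end.

Definition hctx n := sctx (stages n).
Definition hfm n : list (fm (hctx n)) := accepted (stages n).
Definition hnew n : fm (hctx n) := next_fm n (stages n).

Lemma consistent_decide S A : consistent (accepted S) ->
  consistent (decide_fm A :: accepted S).
Proof.
rewrite /decide_fm => cS; case: excluded_middle_informative => // nc.
exact: consistent_split.
Qed.

Lemma hfm_consistent n : consistent (hfm n).
Proof.
elim: n => [//|n IH]; rewrite /hfm /=.
have := @consistent_decide (stages n) (pending (stages n) (agenda n).1 (agenda n).2) IH.
rewrite -/(next_fm n (stages n)).
by move=> cB; apply: consistent_witness cB (prf_witness _ _).
Qed.

Fixpoint default_tm G (s : ty) : tm G s :=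
  match s with tnat => czero | tarr a b => tapp cK (default_tm G b) end.

(* A junk value unless [n <= N]. *)
Fixpoint lift (n N : nat) : substitution (hctx n) (hctx N) :=
  match nat_eq_dec n N with
  | left e => eq_rect n (fun M => substitution (hctx n) (hctx M)) vars N e
  | right _ =>
      match N as N0 return substitution (hctx n) (hctx N0) with
      | 0 => fun s _ => default_tm _ s
      | N'.+1 => fun s x => wk (@lift n N' s x)
      end
  end.
Arguments lift : clear implicits.

Lemma lift_id n : lift n n = vars.
Proof.
by case: n => [|n] /=; case: nat_eq_dec => // e; rewrite (UIP_refl_nat _ e).
Qed.

Lemma liftS n N : (n <= N)%N -> lift n N.+1 = fun s x => wk (lift n N s x).
Proof.
move=> nN /=; case: nat_eq_dec => [e|] //.
by have := nN; rewrite {1}e ltnn.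
Qed.

Lemma lift_comp n m N : (n <= m)%N -> (m <= N)%N ->
  (fun s x => sub_tm (lift m N) (lift n m s x)) = lift n N.
Proof.
move=> nm; elim: N => [|N IH].
  by rewrite leqn0 => /eqP e; subst m; apply: varext => s x; rewrite lift_id sub_vars.
rewrite leq_eqVlt => /orP[/eqP e|mN].
  by subst m; apply: varext => s x; rewrite lift_id sub_vars.
rewrite (liftS (leq_trans nm mN)).
rewrite -IH //; apply: varext => s x.
by rewrite liftS // /wk ren_sub.
Qed.

Lemma lift_wk n N (A : fm (hctx n)) : (n <= N)%N ->
  sub_fm (lift n N.+1) A = wk_fm (sub_fm (lift n N) A).
Proof. by move=> nN; rewrite liftS // /wk_fm ren_sub_fm. Qed.

Lemma prf_lift n N (A : fm (hctx n)) : (n <= N)%N ->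
  prf RCA0w (hfm n) A -> prf RCA0w (hfm N) (sub_fm (lift n N) A).
Proof.
move=> + p; elim: N => [|N IH].
  by rewrite leqn0 => /eqP e; subst n; rewrite lift_id sub_fm_vars.
rewrite leq_eqVlt => /orP[/eqP e|nN]; first by subst n; rewrite lift_id sub_fm_vars.
rewrite lift_wk //; apply: (prf_incl (prf_wk _ (IH nN))).
by move=> C /in_map_iff[D [<- HD]]; right; right; apply: in_map.
Qed.

Lemma pending_enum m N i : (m <= N)%N ->
  pending (stages N) m i = sub_fm (lift m N) (fm_enum (hctx m) i).
Proof.
elim: N => [|N IH].
  by rewrite leqn0 => /eqP e; subst m; rewrite lift_id sub_fm_vars.
rewrite leq_eqVlt => /orP[/eqP e|mN].
  by subst m; rewrite lift_id sub_fm_vars /= eqxx.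
by rewrite lift_wk //= ltn_eqF // IH.
Qed.

(** A is on the agenda at some n >= m. The passage to n+1 adds A or its negation and, if the added
    formula is existential, its body for the new variable. *)
Lemma hfm_complete m (A : fm (hctx m)) : exists2 n, (m <= n)%N &
  let A' := sub_fm (lift m n.+1) A in
  (prf RCA0w (hfm n.+1) A' /\
   forall s (C : fm (s :: _)), A' = fex s C -> exists t, prf RCA0w (hfm n.+1) (inst C t))
  \/ prf RCA0w (hfm n.+1) (fnot A').
Proof.
have [n mn an] := agendaP m (pickle (fm_code A)) m.
exists n => //; rewrite lift_wk //; set A' := sub_fm (lift m n) A.
have eA : pending (stages n) (agenda n).1 (agenda n).2 = A'.
  by rewrite an pending_enum // fm_enumP.
have p : prf RCA0w (hfm n.+1) (wk_fm (hnew n)) by apply: p_hyp; right; left.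
have : hnew n = A' \/ hnew n = fnot A'.
  rewrite /hnew /next_fm /decide_fm eA.
  by case: excluded_middle_informative; [left|right].
case=> hB; rewrite hB in p; [left|right] => //; split=> // s C eC.
have [C0 eC0 ->] := wk_fm_ex eC.
exact: (witness_spec _ (etrans hB eC0)).
Qed.

(** Henkin constants are variables of the stages, so an element is a term over the context of some
    stage; elements are compared after lifting to a common stage. *)
Definition elt (s : ty) := {n : nat & tm (hctx n) s}.
Definition at_stage N s (u : elt s) : tm (hctx N) s := sub_tm (lift (projT1 u) N) (projT2 u).
Definition level s (u : elt s) : nat := projT1 u.
Definition below D (e : env elt D) N := forall s (x : var D s), (level (e s x) <= N)%N.
Definition at_env D (e : env elt D) N : substitution D (hctx N) := fun s x => at_stage N (e s x).
Arguments at_env {D} e N s _ /.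

Lemma below_exists D (e : env elt D) : exists N, below e N.
Proof.
elim: D e => [|r D IH] e; first by exists 0%N => s x; apply: (no_var x).
have [N hN] := IH (fun s x => e s (vs x)).
exists (maxn N (level (e r vz))); apply: var_inv => [|s y]; first exact: leq_maxr.
exact: leq_trans (hN s y) (leq_maxl _ _).
Qed.

Lemma below_le D (e : env elt D) N N' : below e N -> (N <= N')%N -> below e N'.
Proof. by move=> b le s x; apply: leq_trans (b s x) le. Qed.

Lemma at_stage_lift s (u : elt s) N N' : (level u <= N)%N -> (N <= N')%N ->
  sub_tm (lift N N') (at_stage N u) = at_stage N' u.
Proof. by move=> h1 h2; rewrite /at_stage sub_sub lift_comp. Qed.

Lemma at_env_lift D (e : env elt D) N N' (A : fm D) : below e N -> (N <= N')%N ->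
  sub_fm (lift N N') (sub_fm (at_env e N) A) = sub_fm (at_env e N') A.
Proof.
move=> b le; rewrite sub_fm_sub; congr (sub_fm _ _); apply: varext => s x /=.
by rewrite at_stage_lift.
Qed.

Lemma at_stage_self n s (t : tm (hctx n) s) : at_stage n (existT _ n t) = t.
Proof. by rewrite /at_stage (lift_id n) sub_vars. Qed.

Definition holds D (e : env elt D) (A : fm D) : Prop :=
  exists2 N, below e N & prf RCA0w (hfm N) (sub_fm (at_env e N) A).

Lemma holds_at D (e : env elt D) A : holds e A -> forall M,
  exists2 N, (M <= N)%N /\ below e N & forall N', (N <= N')%N ->
    prf RCA0w (hfm N') (sub_fm (at_env e N') A).
Proof.
move=> [N b p] M; exists (maxn M N).
  by split; [apply: leq_maxl|apply: below_le b (leq_maxr _ _)].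
move=> N' le; have le' := leq_trans (leq_maxr _ _) le.
by rewrite -(at_env_lift _ b le'); apply: prf_lift.
Qed.

Lemma holds_imp D (e : env elt D) A B : holds e (fimp A B) -> holds e A -> holds e B.
Proof.
move=> /holds_at h1 /holds_at h2.
have [N1 [_ b] p1] := h1 0%N; have [N2 [le _] p2] := h2 N1.
exists N2; first exact: below_le b le.
exact: p_impE (p1 _ le) (p2 _ (leqnn _)).
Qed.

Lemma holds_rule D (e : env elt D) A B :
  (forall G (f : substitution D G) H, prf RCA0w H (sub_fm f A) -> prf RCA0w H (sub_fm f B)) ->
  holds e A -> holds e B.
Proof. by move=> h [N b p]; exists N => //; apply: h. Qed.

Lemma not_holds_bot D (e : env elt D) : ~ holds e fbot.
Proof. by move=> [N b]; apply: hfm_consistent. Qed.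

(** Consistency of the stages gives one direction, the decision of every formula at some stage the
    other. *)
Lemma holds_not D (e : env elt D) A : holds e (fnot A) <-> ~ holds e A.
Proof.
split=> [hn h|nh]; first exact: not_holds_bot (holds_imp hn h).
have [N b] := below_exists e.
have [n le] := hfm_complete (sub_fm (at_env e N) A).
have le' := leq_trans le (leqnSn n).
rewrite /= at_env_lift // => -[[p _]|p]; last by exists n.+1 => //; apply: below_le b le'.
by case: nh; exists n.+1 => //; apply: below_le b le'.
Qed.

Lemma holds_NNPP D (e : env elt D) A : ~ holds e (fnot A) -> holds e A.
Proof. by rewrite holds_not => /NNPP. Qed.

Lemma at_env_cons r D (u : elt r) (e : env elt D) N :
  at_env (econs u e) N = scons (at_stage N u) (at_env e N).
Proof. exact: varext_cons. Qed.

Lemma holds_ex D (e : env elt D) s (A : fm (s :: D)) :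
  holds e (fex s A) <-> exists u, holds (econs u e) A.
Proof.
split; last first.
  move=> [u [N b p]]; exists N; first by move=> r x; apply: (b _ (vs x)).
  by apply: (p_exI (t := at_stage N u)); rewrite sub_up_inst -at_env_cons.
move=> /holds_at /(_ 0%N) [N [_ b] p].
have [n le] := hfm_complete (sub_fm (at_env e N) (fex s A)).
have le' := leq_trans le (leqnSn n).
rewrite at_env_lift // => -[[_ w]|pn].
  have [t pt] := w s _ erefl.
  exists (existT (fun n => tm (hctx n) s) n.+1 t), n.+1.
    by apply: var_inv => //= r y; apply: below_le b le' r y.
  by rewrite at_env_cons at_stage_self -sub_up_inst.
by case: (hfm_consistent (p_impE pn (p _ le'))).
Qed.

Lemma holds_all D (e : env elt D) s (A : fm (s :: D)) :
  holds e (fall s A) <-> forall u, holds (econs u e) A.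
Proof.
split=> [/holds_at h u|h].
  have [N [le b] p] := h (level u); exists N.
    by apply: var_inv => //= r y; apply: b.
  rewrite at_env_cons -sub_up_inst; apply: p_allE; exact: (p _ (leqnn N)).
apply: holds_NNPP => hn.
(* The calculus derives a counterexample from a negated universal formula; [holds_ex] then names
   it. *)
have : holds e (fex s (fnot A)).
  apply: holds_rule hn => G f H /= p; apply: p_raa.
  apply: (p_impE (prf_weak _ p)); apply: p_allI; apply: p_raa => /=.
  apply: (p_impE (A := wk_fm (fex s (fnot (sub_fm (up_sub f) A))))).
    by apply: p_hyp; right; left.
  by apply: (p_exI (t := var0)); rewrite (inst_up_var0 (fnot _)); apply: prf_hyp0.
by move=> /holds_ex[u] /holds_not; apply.
Qed.

Definition hbinary (A : fm [:: ty0; ty0]) (u v : elt ty0) : Prop :=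
  holds (econs u (econs v (@enil elt))) A.

Definition henkin_structure : structure := {|
  car := elt;
  sapp s t u v := existT _ (maxn (level u) (level v))
    (tapp (at_stage _ u) (at_stage _ v));
  szero := existT _ 0%N czero; sone := existT _ 0%N cone;
  sadd := existT _ 0%N cadd; smul := existT _ 0%N cmul;
  sK s t := existT _ 0%N cK; sS r s t := existT _ 0%N cS; srec := existT _ 0%N crec;
  seq0 := hbinary (feq var0 var1); slt := hbinary (flt var0 var1) |}.

Local Notation HS := henkin_structure.

Lemma at_eval D (e : env elt D) s (t : tm D s) N : below e N ->
  (level (@eval HS _ e _ t) <= N)%N /\
  at_stage N (@eval HS _ e _ t) = sub_tm (at_env e N) t.
Proof.
move=> b; elim: t => [r x|a c t [lt et] u [lu eu]|||||||] //=.
have l : (maxn (level (@eval HS _ e _ t)) (level (@eval HS _ e _ u)) <= N)%N.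
  by rewrite geq_max lt lu.
split=> //; rewrite -et -eu /at_stage /=; congr (tapp _ _).
  exact: (at_stage_lift (leq_maxl _ _) l).
exact: (at_stage_lift (leq_maxr _ _) l).
Qed.

Lemma holds_sub G D (f : substitution G D) (e : env elt D) (A : fm G) :
  holds e (sub_fm f A) <-> holds (fun s x => @eval HS _ e _ (f s x)) A.
Proof.
pose e' : env elt G := fun s x => @eval HS _ e _ (f s x).
have E N : below e N -> sub_fm (at_env e N) (sub_fm f A) = sub_fm (at_env e' N) A.
  move=> b; rewrite sub_fm_sub; congr (sub_fm _ _); apply: varext => s x /=.
  by have [_ ->] := at_eval (f s x) b.
split=> h.
  have [M b'] := below_exists e'; have [N [le b] /(_ _ (leqnn N)) p] := holds_at h M.
  by exists N; [apply: below_le b' le|rewrite -E].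
have [M b'] := below_exists e; have [N [le b] /(_ _ (leqnn N)) p] := holds_at h M.
have bN := below_le b' le.
by exists N => //; rewrite E.
Qed.

Lemma holds_binary (A : fm [:: ty0; ty0]) D (e : env elt D) (t u : tm D ty0) :
  hbinary A (@eval HS _ e _ t) (@eval HS _ e _ u) <->
  holds e (sub_fm (scons t (scons u (fun s x => no_var x _))) A).
Proof.
rewrite holds_sub /hbinary.
set e1 := econs _ _; set e2 := (fun s x => _).
suff -> : e1 = e2 by [].
by apply: varext_cons => //; refine (var_inv _ _) => // s x; apply: (no_var x).
Qed.

(** Implication and disjunction use that each formula or its negation holds; the quantifiers use the
    witnesses supplied by the stages. *)
Lemma truth D (e : env elt D) (A : fm D) : @sat HS _ e A <-> holds e A.
Proof.
elim: A e => {D} [G t u|G t u|G|G A IA B IB|G A IA B IB|G A IA B IB|G s A IA|G s A IA] e /=.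
- exact: holds_binary.
- exact: holds_binary.
- by split=> // /not_holds_bot.
- rewrite IA IB; split; last exact: holds_imp.
  move=> h; have [/h hB|/holds_not nA] := classic (holds e A).
    by apply: holds_rule hB => G' f H p; apply: p_impI; apply: prf_weak.
  apply: holds_rule nA => G' f H /= p; apply: p_impI; apply: p_raa.
  by apply: (p_impE (prf_weak _ (prf_weak _ p))); apply: p_hyp; right; left.
- rewrite IA IB; split=> [[hA hB]|h].
    apply: holds_imp hB; apply: holds_rule hA => G' f H /= p.
    by apply: p_impI; apply: p_andI; [apply: prf_weak|apply: prf_hyp0].
  by split; apply: holds_rule h => G' f H /= p; [apply: p_andE1 p|apply: p_andE2 p].
- rewrite IA IB; split=> [[]|h].
  + by apply: holds_rule => G' f H /= p; apply: p_orI1.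
  + by apply: holds_rule => G' f H /= p; apply: p_orI2.
  have [|/holds_not nA] := classic (holds e A); first by left.
  right; apply: holds_imp h; apply: holds_rule nA => G' f H /= p; apply: p_impI.
  apply: (p_orE (prf_hyp0 _ _)); last exact: prf_hyp0.
  by apply: p_raa; apply: (p_impE (prf_weak _ (prf_weak _ (prf_weak _ p)))); apply: p_hyp; right; left.
- by rewrite holds_all; split=> h a; have := h a; rewrite IA.
- by rewrite holds_ex; split=> -[a h]; exists a; move: h; rewrite IA.
Qed.

Lemma holds_provable (e : env elt nil) (A : fm nil) : prf RCA0w [:: phi] A -> holds e A.
Proof.
move=> p; exists 0%N; first by move=> s x; apply: (no_var x).
by rewrite (_ : at_env e 0 = vars) ?sub_fm_vars //; apply: varext_nil.
Qed.

Lemma henkin_ax : satisfies_axioms HS.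
Proof.
move=> G A e ax.
(* An axiom may have free variables. Its universal closure is a provable sentence, hence true, and
   can be instantiated by any environment. *)
have close : forall D (B : fm D), prf RCA0w nil B -> forall f : env elt D, @sat HS _ f B.
  elim=> [|r D IH] B p f.
    by apply/truth; apply: holds_provable; apply: (prf_incl p) => C [].
  rewrite (econs_eta f).
  by apply: (IH (fall r B)); apply: p_allI.
by apply: close; apply: p_ax.
Qed.

Lemma henkin_phi : @sat HS _ (@enil elt) phi.
Proof. by apply/truth; apply: holds_provable; apply: prf_hyp0. Qed.

Lemma henkin_refl (u : elt ty0) : @seq0 HS u u.
Proof.
have [N b] := below_exists (econs u (econs u (@enil elt))).
by exists N => //; apply: p_refl.
Qed.

Lemma henkin_subst G (A : fm (ty0 :: G)) (e : env elt G) (u v : elt ty0) :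
  @seq0 HS u v -> @sat HS _ (econs u e) A -> @sat HS _ (econs v e) A.
Proof.
move=> huv; rewrite !truth => hu.
have [N [_ b1] p1] := holds_at hu 0%N.
have [M bM] := below_exists (econs v e).
have [K [le b2] p2] := holds_at huv (maxn N M).
have KN := leq_trans (leq_maxl N M) le; have KM := leq_trans (leq_maxr N M) le.
exists K; first exact: below_le bM KM.
have := p1 _ KN; rewrite !at_env_cons -(sub_up_inst _ _ (at_stage K u)) -(sub_up_inst _ _ (at_stage K v)).
apply: p_subst.
exact: (p2 _ (leqnn K)).
Qed.

End Henkin.

Theorem completeness (A : fm nil) :
  (forall M, is_model M -> @sat M _ (@enil (car M)) A) -> provable RCA0w A.
Proof.
move=> valid; apply: p_raa; apply: NNPP => c.
have axM := henkin_ax c; have phM := henkin_phi c.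
pose HS := henkin_structure (fnot A).
have rM : forall a : car HS ty0, seq0 a a by apply: henkin_refl.
have sM := henkin_subst c : forall G (B : fm (ty0 :: G)) (e : env (car HS) G) a b, _.
have := valid _ (quotient_model axM rM sM).
rewrite (_ : enil _ = cls_env (@enil (car HS))); last exact: varext_nil.
by rewrite (sat_quotient axM rM sM).
Qed.
Import GRing.Theory Num.Theory Order.Theory.
Local Open Scope ring_scope.

(** * Arithmetic in a model *)

Record model := Model { mstr :> structure; mP : is_model mstr }.

Section Combinators.
Variable M : model.

Lemma exteq_eq s (a b : car M s) : exteq a b <-> a = b.
Proof.
elim: s a b => [|s _ t IH] a b /=; first exact: (model_eq (mP M)).
split=> [h|-> x]; last exact/IH.
by apply: (model_ext (mP M)) => x; apply/IH.
Qed.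

Lemma sK_eq s t (x : car M s) (y : car M t) : sapp (sapp (sK M s t) x) y = x.
Proof.
have := model_ax (mP M) (econs x (econs y (@enil (car M)))) (ax_K var0 var1).
by rewrite sat_feqT exteq_eq.
Qed.

Lemma sS_eq r s t (x : car M (tarr r (tarr s t))) (y : car M (tarr r s)) (z : car M r) :
  sapp (sapp (sapp (sS M r s t) x) y) z = sapp (sapp x z) (sapp y z).
Proof.
have := model_ax (mP M) (econs x (econs y (econs z (@enil (car M))))) (ax_S var0 var1 var2).
by rewrite sat_feqT exteq_eq.
Qed.

(** Beta conversion for bracket abstraction, an identity of elements because the model is
    extensional. *)
Lemma eval_lam G (e : env (car M) G) r s (t : tm (r :: G) s) a :
  sapp (eval e (lam t)) a = eval (econs a e) t.
Proof.
elim: t => [r' x|b c t It u Iu|||||b c|b c d|] /=; rewrite ?sK_eq //; last by rewrite sS_eq It Iu.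
move: r' x; refine (var_inv _ _) => [|r' y] /=; last by rewrite sK_eq.
by rewrite sS_eq !sK_eq.
Qed.

(** The functions that the model contains; induction is available only for predicates built from
    these. *)
Definition dfn s t (f : car M s -> car M t) := exists c, forall x, sapp c x = f x.

Lemma dfn_sapp s t (c : car M (tarr s t)) : dfn (sapp c).
Proof. by exists c. Qed.

Lemma dfn_id s : dfn (fun x : car M s => x).
Proof. by exists (eval (@enil (car M)) (lam var0)) => x; rewrite eval_lam. Qed.

Lemma dfn_const s t (c : car M t) : dfn (fun _ : car M s => c).
Proof. by exists (sapp (sK M t s) c) => x; rewrite sK_eq. Qed.

Lemma dfn_app r s t (f : car M r -> car M (tarr s t)) (g : car M r -> car M s) :
  dfn f -> dfn g -> dfn (fun x => sapp (f x) (g x)).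
Proof.
move=> [c hc] [d hd]; exists (sapp (sapp (sS M r s t) c) d) => x.
by rewrite sS_eq hc hd.
Qed.

End Combinators.

(* Predicates of numbers that are quantifier-free in some parameters. *)
Inductive qfree (M : model) : (car M ty0 -> Prop) -> Prop :=
| qf_eq (f g : car M ty0 -> car M ty0) : dfn f -> dfn g -> qfree (fun n => f n = g n)
| qf_lt (f g : car M ty0 -> car M ty0) : dfn f -> dfn g -> qfree (fun n => slt (f n) (g n))
| qf_false : qfree (fun _ => False)
| qf_imp P Q : qfree P -> qfree Q -> qfree (fun n => P n -> Q n)
| qf_and P Q : qfree P -> qfree Q -> qfree (fun n => P n /\ Q n)
| qf_or P Q : qfree P -> qfree Q -> qfree (fun n => P n \/ Q n).

Section Induction.
Variable M : model.
Local Notation env := (env (car M)).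

Lemma qfree_atom (at2 : forall G, tm G ty0 -> tm G ty0 -> fm G)
    (rel2 : car M ty0 -> car M ty0 -> Prop) (f g : car M ty0 -> car M ty0) :
  (forall G t u, @qf G (at2 G t u)) ->
  (forall G (e : env G) t u, sat e (at2 G t u) <-> rel2 (eval e t) (eval e u)) ->
  dfn f -> dfn g -> forall D (d : env D), exists G (e : env G) (r : renaming D G) (A : fm (ty0 :: G)),
    [/\ (fun s x => e s (r s x)) = d, qf A & forall n, rel2 (f n) (g n) <-> sat (econs n e) A].
Proof.
move=> q h [c hc] [c' hc'] D d.
exists (_ :: _ :: D)%SEQ, (econs c (econs c' d)), (fun s x => vs (vs x)),
  (at2 _ (tapp var1 var0) (tapp var2 var0)); split=> // n.
by rewrite h /= hc hc'.
Qed.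

(** The parameters of both sides have to meet in one environment. Hence the statement starts from an
    arbitrary environment d and returns an extension of it: that of Q is built on top of that of
    P. *)
Lemma qfree_junct (con : forall G, fm G -> fm G -> fm G) (conP : Prop -> Prop -> Prop)
    (P Q : car M ty0 -> Prop) :
  (forall G A B, @qf G (con G A B) = qf A && qf B) ->
  (forall G (e : env G) A B, sat e (con G A B) <-> conP (sat e A) (sat e B)) ->
  (forall D (d : env D), exists G (e : env G) (r : renaming D G) (A : fm (ty0 :: G)),
    [/\ (fun s x => e s (r s x)) = d, qf A & forall n, P n <-> sat (econs n e) A]) ->
  (forall D (d : env D), exists G (e : env G) (r : renaming D G) (A : fm (ty0 :: G)),
    [/\ (fun s x => e s (r s x)) = d, qf A & forall n, Q n <-> sat (econs n e) A]) ->
  (forall D (d : env D), exists G (e : env G) (r : renaming D G) (A : fm (ty0 :: G)),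
    [/\ (fun s x => e s (r s x)) = d, qf A & forall n, conP (P n) (Q n) <-> sat (econs n e) A]).
Proof.
move=> q h IP IQ D d; have [G1 [e1 [r1 [A1 [E1 q1 h1]]]]] := IP D d.
have [G2 [e2 [r2 [A2 [E2 q2 h2]]]]] := IQ G1 e1.
exists G2, e2, (fun s x => r2 s (r1 s x)), (con _ (ren_fm (up_ren r2) A1) A2).
split=> [||n]; first by rewrite -E1 -E2.
  by rewrite q qf_ren q1 q2.
have E : (fun s x => econs n e2 (up_ren r2 x)) = econs n e1.
  by rewrite -E2; apply: varext_cons.
have pe (X Y : Prop) : (X <-> Y) -> X = Y := @propositional_extensionality X Y.
by rewrite h (pe _ _ (sat_ren _ _ A1)) E (pe _ _ (h1 n)) (pe _ _ (h2 n)).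
Qed.

Lemma qfreeP (P : car M ty0 -> Prop) : qfree P ->
  forall D (d : env D), exists G (e : env G) (r : renaming D G) (A : fm (ty0 :: G)),
    [/\ (fun s x => e s (r s x)) = d, qf A & forall n, P n <-> sat (econs n e) A].
Proof.
elim=> {P} [f g df dg|f g df dg||P Q _ IP _ IQ|P Q _ IP _ IQ|P Q _ IP _ IQ].
- by apply: (@qfree_atom (@feq) (@eq _) f g) => // G e t u; apply: (model_eq (mP M)).
- exact: (@qfree_atom (@flt) (@slt M) f g).
- by move=> D d; exists D, d, (fun s x => x), fbot.
- exact: (@qfree_junct (@fimp) (fun X Y => X -> Y) P Q).
- exact: (@qfree_junct (@fand) and P Q).
- exact: (@qfree_junct (@for_) or P Q).
Qed.

End Induction.

Definition num (M : model) : Type := car M ty0.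

Section ClassicalChoice.
Variable T : Type.
(** The algebraic hierarchy asks for decidable equality and a choice operator; classical logic in
    the metatheory supplies both for an abstract carrier. *)
Definition classic_find (P : pred T) (_ : nat) : option T :=
  match excluded_middle_informative (exists x, P x) with
  | left h => Some (proj1_sig (constructive_indefinite_description _ h))
  | right _ => None
  end.
Lemma classic_find_correct P n x : classic_find P n = Some x -> P x.
Proof.
rewrite /classic_find; case: excluded_middle_informative => // h [<-].
by case: constructive_indefinite_description.
Qed.
Lemma classic_find_complete (P : pred T) : (exists x, P x) -> exists n, classic_find P n.
Proof. by move=> h; exists 0%N; rewrite /classic_find; case: excluded_middle_informative. Qed.
Lemma classic_find_ext (P Q : pred T) : P =1 Q -> classic_find P =1 classic_find Q.
Proof. by move=> /functional_extensionality ->. Qed.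
Definition classic_eq (x y : T) : bool := if excluded_middle_informative (x = y) then true else false.
Lemma classic_eqP : Equality.axiom classic_eq.
Proof. by move=> x y; rewrite /classic_eq; case: excluded_middle_informative => h; constructor. Qed.
End ClassicalChoice.

HB.instance Definition _ (M : model) := hasDecEq.Build (num M) (@classic_eqP (num M)).
HB.instance Definition _ (M : model) := hasChoice.Build (num M)
  (@classic_find_correct (num M)) (@classic_find_complete (num M)) (@classic_find_ext (num M)).

(** * The commutative semiring of numbers *)

Section Arithmetic.
Variable M : model.
Implicit Types (a b c m n : num M).

Definition nadd a b : num M := sapp (sapp (sadd M) a) b.
Definition nmul a b : num M := sapp (sapp (smul M) a) b.
Definition nzero : num M := szero M.
Definition none : num M := sone M.
Definition nlt a b : Prop := slt a b.
Local Notation nS n := (nadd n none).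

Lemma nadd_dfn s (f g : car M s -> num M) : dfn (t := ty0) f -> dfn (t := ty0) g ->
  dfn (t := ty0) (fun n : car M s => nadd (f n) (g n)).
Proof. by move=> df dg; do 2 apply: dfn_app => //; apply: dfn_const. Qed.
Lemma nmul_dfn s (f g : car M s -> num M) : dfn (t := ty0) f -> dfn (t := ty0) g ->
  dfn (t := ty0) (fun n : car M s => nmul (f n) (g n)).
Proof. by move=> df dg; do 2 apply: dfn_app => //; apply: dfn_const. Qed.

Local Notation e2 a b := (econs a (econs b (@enil (car M)))).

Lemma nS_neq0 a : nS a <> nzero.
Proof. by have := model_ax (mP M) (e2 a a) (ax_succ0 var0); rewrite /= (model_eq (mP M)). Qed.

Lemma nS_inj a b : nS a = nS b -> a = b.
Proof. by have := model_ax (mP M) (e2 a b) (ax_succ_inj var0 var1); rewrite /= !(model_eq (mP M)). Qed.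

Lemma nadd01 : nadd nzero none = none.
Proof. by have := model_ax (mP M) (@enil (car M)) (ax_one nil); rewrite /= (model_eq (mP M)). Qed.

Lemma nadd_n0 a : nadd a nzero = a.
Proof. by have := model_ax (mP M) (e2 a a) (ax_add0 var0); rewrite /= (model_eq (mP M)). Qed.

Lemma nadd_nS a b : nadd a (nS b) = nS (nadd a b).
Proof. by have := model_ax (mP M) (e2 a b) (ax_addS var0 var1); rewrite /= (model_eq (mP M)). Qed.

Lemma nmul_n0 a : nmul a nzero = nzero.
Proof. by have := model_ax (mP M) (e2 a a) (ax_mul0 var0); rewrite /= (model_eq (mP M)). Qed.

Lemma nmul_nS a b : nmul a (nS b) = nadd (nmul a b) a.
Proof. by have := model_ax (mP M) (e2 a b) (ax_mulS var0 var1); rewrite /= (model_eq (mP M)). Qed.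

Lemma nlt0 a : ~ nlt a nzero.
Proof. exact: (model_ax (mP M) (e2 a a) (ax_lt0 var0)). Qed.

Lemma nltS a b : nlt a (nS b) <-> nlt a b \/ a = b.
Proof.
have := model_ax (mP M) (e2 a b) (ax_ltS var0 var1); rewrite /= (model_eq (mP M)).
by case=> h1 h2; split.
Qed.

Lemma qf_ind_raw (P : num M -> Prop) : qfree (M := M) P -> P nzero ->
  (forall n, P n -> P (nS n)) -> forall n, P n.
Proof.
move=> qP P0 PS n; have [G [e [_ [A [_ qA hA]]]]] := qfreeP qP (@enil (car M)).
rewrite hA; have := model_ax (mP M) e (ax_ind qA) => /=; apply.
  by rewrite sat_inst -hA.
move=> m /= Am; rewrite /at_succ sat_sub.
set e' := (fun s x => _).
have -> : e' = econs (nS m) e by apply: varext_cons.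
by rewrite -hA; apply: PS; rewrite hA.
Qed.

Ltac dfn := repeat first [exact: dfn_id | exact: dfn_const | apply: nadd_dfn | apply: nmul_dfn
 | exact: dfn_sapp | apply: dfn_app].
Ltac qfr := repeat first [apply: qf_eq | apply: qf_lt | apply: qf_imp | apply: qf_and
 | apply: qf_or | exact: qf_false]; dfn.
Ltac ind n := move: n; apply: qf_ind_raw => [| |n]; first by qfr.

Lemma nadd_0n a : nadd nzero a = a.
Proof. by ind a => [|IH]; rewrite ?nadd_n0 // nadd_nS IH. Qed.

Lemma nadd_Sn a b : nadd (nS a) b = nS (nadd a b).
Proof. by ind b => [|IH]; rewrite ?nadd_n0 // !nadd_nS IH. Qed.

Lemma nadd_comm a b : nadd a b = nadd b a.
Proof. by ind b => [|IH]; rewrite ?nadd_n0 ?nadd_0n // nadd_nS nadd_Sn IH. Qed.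

Lemma nadd_assoc a b c : nadd a (nadd b c) = nadd (nadd a b) c.
Proof. by ind c => [|IH]; rewrite ?nadd_n0 // !nadd_nS IH. Qed.

Lemma nmul_0n a : nmul nzero a = nzero.
Proof. by ind a => [|IH]; rewrite ?nmul_n0 // nmul_nS IH nadd_n0. Qed.

Lemma nmul_Sn a b : nmul (nS a) b = nadd (nmul a b) b.
Proof.
ind b => [|IH]; first by rewrite !nmul_n0 nadd_n0.
rewrite !nmul_nS IH -!nadd_assoc; congr nadd.
by rewrite !nadd_assoc (nadd_comm b a).
Qed.

Lemma nmul_comm a b : nmul a b = nmul b a.
Proof. by ind b => [|IH]; rewrite ?nmul_n0 ?nmul_0n // nmul_nS nmul_Sn IH. Qed.

Lemma nmul_addl a b c : nmul (nadd a b) c = nadd (nmul a c) (nmul b c).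
Proof.
ind c => [|IH]; first by rewrite !nmul_n0 nadd_n0.
rewrite !nmul_nS IH -!nadd_assoc; congr nadd.
by rewrite !nadd_assoc (nadd_comm _ a).
Qed.

Lemma nmul_addr a b c : nmul a (nadd b c) = nadd (nmul a b) (nmul a c).
Proof. by rewrite !(nmul_comm a) nmul_addl. Qed.

Lemma nmul_assoc a b c : nmul a (nmul b c) = nmul (nmul a b) c.
Proof.
ind c => [|IH]; first by rewrite !nmul_n0.
by rewrite !nmul_nS nmul_addr IH.
Qed.

Lemma nmul_1n a : nmul none a = a.
Proof. by rewrite -nadd01 nmul_Sn nmul_0n nadd_0n. Qed.

Lemma none_neq0 : (none != nzero :> num M).
Proof. by apply/eqP; rewrite -nadd01; apply: nS_neq0. Qed.

HB.instance Definition _ := GRing.isNmodule.Build (num M) nadd_assoc nadd_comm nadd_0n.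
HB.instance Definition _ := GRing.Nmodule_isComNzSemiRing.Build (num M)
  nmul_assoc nmul_comm nmul_1n nmul_addl nmul_0n none_neq0.

End Arithmetic.

(** * Order and truncated subtraction *)

Section Order.
Variable M : model.
Implicit Types (a b c d m n : num M).

Lemma num_ind (P : num M -> Prop) : qfree (M := M) P -> P 0 ->
  (forall n, P n -> P (n + 1)) -> forall n, P n.
Proof. exact: qf_ind_raw. Qed.

Lemma num_dfn_add s (f g : car M s -> num M) : dfn (t := ty0) f -> dfn (t := ty0) g ->
  dfn (t := ty0) (fun n : car M s => f n + g n).
Proof. exact: nadd_dfn. Qed.
Lemma num_dfn_mul s (f g : car M s -> num M) : dfn (t := ty0) f -> dfn (t := ty0) g ->
  dfn (t := ty0) (fun n : car M s => f n * g n).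
Proof. exact: nmul_dfn. Qed.

Lemma num_lt0 a : ~ nlt a 0. Proof. exact: nlt0. Qed.
Lemma num_ltS a b : nlt a (b + 1) <-> nlt a b \/ a = b. Proof. exact: nltS. Qed.
Lemma num_S_neq0 a : a + 1 <> 0. Proof. exact: nS_neq0. Qed.
Lemma num_S_inj a b : a + 1 = b + 1 -> a = b. Proof. exact: nS_inj. Qed.

Lemma rec0 (f : car M (tarr ty0 (tarr ty0 ty0))) m :
  sapp (sapp (sapp (srec M) f) m) (0 : num M) = m.
Proof.
have := model_ax (mP M) (econs f (econs (m : car M ty0) (@enil (car M)))) (ax_rec0 var0 var1).
by rewrite /= (model_eq (mP M)).
Qed.

Lemma recS (f : car M (tarr ty0 (tarr ty0 ty0))) m n :
  sapp (sapp (sapp (srec M) f) m) (n + 1 : num M) =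
  sapp (sapp f n) (sapp (sapp (sapp (srec M) f) m) n).
Proof.
have := model_ax (mP M) (econs f (econs (m : car M ty0) (econs (n : car M ty0) (@enil (car M)))))
  (ax_recS var0 var1 var2).
by rewrite /= (model_eq (mP M)).
Qed.

Definition npred n : num M := sapp (eval (@enil (car M)) cpred) n.
Definition nsub a b : num M := sapp (sapp (eval (@enil (car M)) cmonus) a) b.

Lemma npred0 : npred 0 = 0. Proof. exact: rec0. Qed.
Lemma npredS n : npred (n + 1) = n.
Proof. by rewrite /npred [LHS](recS (eval (@enil (car M)) (lam (lam var1))) 0 n) !eval_lam. Qed.

Lemma eval_cmonus G (e : env (car M) G) a b : sapp (sapp (eval e cmonus) a) b = nsub a b.
Proof. by []. Qed.

Lemma nsub0 a : nsub a 0 = a.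
Proof. by rewrite /nsub /cmonus !eval_lam; exact: rec0. Qed.

Lemma nsubS a b : nsub a (b + 1) = npred (nsub a b).
Proof.
rewrite /nsub /cmonus !eval_lam.
by rewrite [LHS](recS (eval (econs b (econs a (@enil (car M)))) (lam (lam (tapp cpred var0)))) a b) !eval_lam.
Qed.

Lemma qf_not (P : num M -> Prop) : qfree (M := M) P -> qfree (M := M) (fun n => ~ P n).
Proof. by move=> q; apply: qf_imp q (qf_false M). Qed.

Lemma npred_dfn s (f : car M s -> num M) : dfn (t := ty0) f ->
  dfn (t := ty0) (fun n : car M s => npred (f n)).
Proof. by move=> df; apply: dfn_app => //; apply: dfn_const. Qed.
Lemma nsub_dfn s (f g : car M s -> num M) : dfn (t := ty0) f -> dfn (t := ty0) g ->
  dfn (t := ty0) (fun n : car M s => nsub (f n) (g n)).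
Proof. by move=> df dg; do 2 apply: dfn_app => //; apply: dfn_const. Qed.

End Order.

Ltac dfn := repeat first [exact: dfn_id | exact: dfn_const | apply: num_dfn_add
  | apply: num_dfn_mul | apply: npred_dfn | apply: nsub_dfn
  | exact: dfn_sapp | apply: dfn_app].
Ltac qfr := repeat first [apply: qf_not | apply: qf_eq | apply: qf_lt | apply: qf_imp
  | apply: qf_and | apply: qf_or | exact: qf_false]; dfn.
Ltac ind n := move: n; apply: num_ind => [| |n]; first by qfr.

Section Order2.
Variable M : model.
Implicit Types (a b c d m n : num M).

(** Naming the predecessor instead of asserting its existence keeps the induction formula
    quantifier-free. *)
Lemma num_case a : a = 0 \/ a = npred a + 1.
Proof. by ind a => [|_]; [left|right; rewrite npredS]. Qed.

Lemma num_addI a b c : a + b = a + c -> b = c.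
Proof.
ind a => [|IH h]; first by rewrite !add0r.
by apply: IH; apply: num_S_inj; rewrite ![a + _ + 1]addrAC.
Qed.

Lemma nsubSS a b : nsub (a + 1) (b + 1) = nsub a b.
Proof. by ind b => [|IH]; rewrite [in LHS]nsubS ?nsub0 ?npredS // IH -nsubS. Qed.

Lemma nsub_addr a b : nsub (a + b) b = a.
Proof. by ind b => [|IH]; rewrite ?nsub0 ?addr0 // addrA nsubSS. Qed.

Lemma num_ltSS a b : nlt a b -> a + 1 = b \/ nlt (a + 1) b.
Proof.
ind b => [/num_lt0//|IH /num_ltS[/IH[]|->]]; last by left.
- by move=> ->; right; apply/num_ltS; right.
- by move=> h; right; apply/num_ltS; left.
Qed.

Lemma num_lt0S a : nlt 0 (a + 1).
Proof. by ind a => [|IH]; apply/num_ltS; [right|left]. Qed.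

Lemma num_trichotomy a b : nlt a b \/ a = b \/ nlt b a.
Proof.
ind b => [|[h|[->|/num_ltSS[->|h]]]].
- by case: (num_case a) => ->; [right; left|right; right; apply: num_lt0S].
- by left; apply/num_ltS; left.
- by left; apply/num_ltS; right.
- by right; left.
- by right; right.
Qed.

(** Again the difference is an explicit term, so that the claim can be proved by quantifier-free
    induction; the existential form [num_ltP] follows. *)
Lemma num_lt_sub a b : nlt a b -> b = a + nsub b (a + 1) + 1.
Proof.
ind b => [/num_lt0//|IH /num_ltS[/IH e|->]]; last first.
  by rewrite -{2}[b + 1]add0r nsub_addr addr0.
set d := nsub b (a + 1) in e.
have -> : b + 1 = d + 1 + (a + 1) by rewrite {1}e; ring.
by rewrite nsub_addr; ring.
Qed.

Lemma num_ltP a b : nlt a b <-> exists d, b = a + d + 1.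
Proof.
split=> [/num_lt_sub h|[d ->]]; first by exists (nsub b (a + 1)).
by ind d => [|IH]; apply/num_ltS; [right; rewrite addr0|left; rewrite addrA].
Qed.

Lemma num_add_eq0 a b : a + b = 0 -> b = 0.
Proof. by case: (num_case b) => -> //; rewrite addrA => /num_S_neq0. Qed.

Lemma num_total a b : (exists d, b = a + d) \/ (exists d, a = b + d).
Proof.
case: (num_trichotomy a b) => [/num_ltP[d ->]|[->|/num_ltP[d ->]]].
- by left; exists (d + 1); rewrite addrA.
- by left; exists 0; rewrite addr0.
- by right; exists (d + 1); rewrite addrA.
Qed.

Lemma num_mulI c a b : (c + 1) * a = (c + 1) * b -> a = b.
Proof.
have H x y : nlt x y -> (c + 1) * x = (c + 1) * y -> False.
  move=> /num_ltP[d ->] h; apply: (@num_S_neq0 _ (c * d + c + d)).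
  by apply: (@num_addI ((c + 1) * x)); rewrite addr0 [RHS]h; ring.
by case: (num_trichotomy a b) => [lt /(H _ _ lt)|[//|lt /esym /(H _ _ lt)]].
Qed.

(** * Fractions as classes of triples *)

Definition triple := (num M * num M * num M)%type.
Implicit Types t u v : triple.

(* [(a, b, d)] stands for the fraction (a - b) / (d + 1). *)
Definition fnum t u : num M := t.1.1 * (u.2 + 1) + u.1.2 * (t.2 + 1).
Definition feqv t u : Prop := fnum t u = fnum u t.

Lemma feqv_trans t u v : feqv t u -> feqv u v -> feqv t v.
Proof.
case: t u v => [[a b] d] [[a' b'] d'] [[a'' b''] d'']; rewrite /feqv /fnum /= => h1 h2.
apply: (@num_mulI d'); apply: (@num_addI (b' * (d + 1) * (d'' + 1))).
transitivity ((a * (d' + 1) + b' * (d + 1)) * (d'' + 1) + b'' * (d + 1) * (d' + 1)); first by ring.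
rewrite h1.
transitivity ((a' * (d'' + 1) + b'' * (d' + 1)) * (d + 1) + b * (d'' + 1) * (d' + 1)); first by ring.
by rewrite h2; ring.
Qed.

Definition fraction := {P : triple -> Prop | exists t, P = feqv t}.
Definition fcls t : fraction := exist _ (feqv t) (ex_intro _ t erefl).
Definition frep (x : fraction) : triple :=
  proj1_sig (constructive_indefinite_description _ (proj2_sig x)).

Lemma fcls_eq t u : fcls t = fcls u <-> feqv t u.
Proof.
split=> [[e]|h]; first by rewrite e.
apply: eq_sig_hprop => /= [P p q|]; first exact: proof_irrelevance.
apply: functional_extensionality => c; apply: propositional_extensionality.
by split; [apply: feqv_trans; rewrite /feqv h|apply: feqv_trans].
Qed.

Lemma frep_cls t : feqv (frep (fcls t)) t.
Proof. by rewrite /frep; case: constructive_indefinite_description => /= b <-. Qed.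

Lemma fcls_rep x : fcls (frep x) = x.
Proof. by case: x => P [a e]; subst P; apply/fcls_eq; exact: (frep_cls a). Qed.

Lemma fcls_ind (P : fraction -> Prop) : (forall a b d, P (fcls (a, b, d))) -> forall x, P x.
Proof. by move=> h x; rewrite -(fcls_rep x); case: (frep x) => [[a b] d]. Qed.

(** A triple stores its denominator minus one, and (d + 1)(d' + 1) - 1 is [d * d' + d + d']. *)
Definition fadd x y : fraction :=
  let: (a, b, d) := frep x in let: (a', b', d') := frep y in
  fcls (a * (d' + 1) + a' * (d + 1), b * (d' + 1) + b' * (d + 1), d * d' + d + d').
Definition fmul x y : fraction :=
  let: (a, b, d) := frep x in let: (a', b', d') := frep y in
  fcls (a * a' + b * b', a * b' + b * a', d * d' + d + d').
Definition fopp x : fraction := let: (a, b, d) := frep x in fcls (b, a, d).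

Lemma faddE a b d a' b' d' : fadd (fcls (a, b, d)) (fcls (a', b', d')) =
  fcls (a * (d' + 1) + a' * (d + 1), b * (d' + 1) + b' * (d + 1), d * d' + d + d').
Proof.
rewrite /fadd; have := frep_cls (a, b, d); have := frep_cls (a', b', d').
case: (frep _) => [[r s] q]; case: (frep _) => [[r' s'] q'].
rewrite /feqv /fnum /= => h' h; apply/fcls_eq; rewrite /feqv /fnum /=.
transitivity ((r' * (d + 1) + b * (q' + 1)) * (d' + 1) * (q + 1) +
  (r * (d' + 1) + b' * (q + 1)) * (d + 1) * (q' + 1)); first by ring.
by rewrite h h'; ring.
Qed.

Lemma fmulE a b d a' b' d' : fmul (fcls (a, b, d)) (fcls (a', b', d')) =
  fcls (a * a' + b * b', a * b' + b * a', d * d' + d + d').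
Proof.
rewrite /fmul; have := frep_cls (a, b, d); have := frep_cls (a', b', d').
case: (frep _) => [[r s] q]; case: (frep _) => [[r' s'] q'].
rewrite /feqv /fnum /= => h' h; apply/fcls_eq.
(* The representatives are exchanged one factor at a time, through the product in which only the
   second one has been replaced. *)
apply: (@feqv_trans _ (r' * a' + s' * b', r' * b' + s' * a', q' * d' + q' + d')).
  rewrite /feqv /fnum /=.
  transitivity ((r * (d' + 1) + b' * (q + 1)) * r' * (q' + 1) +
    (a' * (q + 1) + s * (d' + 1)) * s' * (q' + 1)); first by ring.
  transitivity ((a' * (q + 1) + s * (d' + 1)) * r' * (q' + 1) +
    (r * (d' + 1) + b' * (q + 1)) * s' * (q' + 1)); first by rewrite h'.
  by ring.
rewrite /feqv /fnum /=.
transitivity ((r' * (d + 1) + b * (q' + 1)) * a' * (d' + 1) +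
    (a * (q' + 1) + s' * (d + 1)) * b' * (d' + 1)); first by ring.
transitivity ((a * (q' + 1) + s' * (d + 1)) * a' * (d' + 1) +
    (r' * (d + 1) + b * (q' + 1)) * b' * (d' + 1)); first by rewrite h.
by ring.
Qed.

Lemma foppE a b d : fopp (fcls (a, b, d)) = fcls (b, a, d).
Proof.
rewrite /fopp; have := frep_cls (a, b, d).
case: (frep _) => [[r s] q]; rewrite /feqv /fnum /= => h; apply/fcls_eq.
by rewrite /feqv /fnum /= [LHS]addrC -h addrC.
Qed.

End Order2.
HB.instance Definition _ (M : model) := hasDecEq.Build (fraction M) (@classic_eqP (fraction M)).
HB.instance Definition _ (M : model) := hasChoice.Build (fraction M)
  (@classic_find_correct (fraction M)) (@classic_find_complete (fraction M))
  (@classic_find_ext (fraction M)).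

(** * The ordered field of fractions *)

Section FractionField.
Variable M : model.
Implicit Types (x y z : fraction M).

Lemma faddC : commutative (@fadd M).
Proof.
elim/fcls_ind => a b d; elim/fcls_ind => a' b' d'.
by rewrite !faddE; apply/fcls_eq; rewrite /feqv /fnum /=; ring.
Qed.

Lemma faddA : associative (@fadd M).
Proof.
elim/fcls_ind => a b d; elim/fcls_ind => a' b' d'; elim/fcls_ind => a'' b'' d''.
by rewrite !faddE; apply/fcls_eq; rewrite /feqv /fnum /=; ring.
Qed.

Definition fzero : fraction M := fcls (0, 0, 0).
Definition fone : fraction M := fcls (1, 0, 0).

Lemma fadd0 : left_id fzero (@fadd M).
Proof.
elim/fcls_ind => a b d.
by rewrite !faddE; apply/fcls_eq; rewrite /feqv /fnum /=; ring.
Qed.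

Lemma faddN : left_inverse fzero (@fopp M) (@fadd M).
Proof.
elim/fcls_ind => a b d.
by rewrite foppE !faddE; apply/fcls_eq; rewrite /feqv /fnum /=; ring.
Qed.

Lemma fmulC : commutative (@fmul M).
Proof.
elim/fcls_ind => a b d; elim/fcls_ind => a' b' d'.
by rewrite !fmulE; apply/fcls_eq; rewrite /feqv /fnum /=; ring.
Qed.

Lemma fmulA : associative (@fmul M).
Proof.
elim/fcls_ind => a b d; elim/fcls_ind => a' b' d'; elim/fcls_ind => a'' b'' d''.
by rewrite !fmulE; apply/fcls_eq; rewrite /feqv /fnum /=; ring.
Qed.

Lemma fmul1 : left_id fone (@fmul M).
Proof.
elim/fcls_ind => a b d.
by rewrite !fmulE; apply/fcls_eq; rewrite /feqv /fnum /=; ring.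
Qed.

Lemma fmulD : left_distributive (@fmul M) (@fadd M).
Proof.
elim/fcls_ind => a b d; elim/fcls_ind => a' b' d'; elim/fcls_ind => a'' b'' d''.
by rewrite ?(faddE, fmulE); apply/fcls_eq; rewrite /feqv /fnum /=; ring.
Qed.

Lemma fone_neq0 : fone != fzero.
Proof.
apply/eqP => /fcls_eq; rewrite /feqv /fnum /= !add0r !mul1r !mul0r !addr0.
by move/eqP; rewrite oner_eq0.
Qed.

HB.instance Definition _ := GRing.isZmodule.Build (fraction M) faddA faddC fadd0 faddN.
HB.instance Definition _ := GRing.Zmodule_isComNzRing.Build (fraction M)
  fmulA fmulC fmul1 fmulD fone_neq0.

(** The sign of the numerator decides where d + 1 goes; the new denominator |a - b| is again stored
    minus one. *)
Definition finv x : fraction M :=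
  let: (a, b, d) := frep x in
  if excluded_middle_informative (nlt b a) then fcls (d + 1, 0, nsub a (b + 1))
  else if excluded_middle_informative (nlt a b) then fcls (0, d + 1, nsub b (a + 1))
  else 0.

Lemma fmulV x : x != 0 -> finv x * x = 1.
Proof.
rewrite -{1 3}(fcls_rep x) /finv; case: (frep x) => [[a b] d] nz.
case: excluded_middle_informative => [lt|nlt1] /=; first have := num_lt_sub lt.
  move: (nsub _ _) => c ->; rewrite [LHS]fmulE -[RHS]/fone; apply/fcls_eq.
  by rewrite /feqv /fnum /=; ring.
case: excluded_middle_informative => [lt|nlt2] /=; first have := num_lt_sub lt.
  move: (nsub _ _) => c ->; rewrite [LHS]fmulE -[RHS]/fone; apply/fcls_eq.
  by rewrite /feqv /fnum /=; ring.
case: (num_trichotomy a b) => [//|[e|//]]; case/eqP: nz.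
by subst b; rewrite -[RHS]/fzero; apply/fcls_eq; rewrite /feqv /fnum /=; ring.
Qed.

Lemma finv0 : finv 0 = 0.
Proof.
rewrite /finv; have := frep_cls ((0, 0, 0) : triple M).
rewrite -[fcls _]/(0 : fraction M); case: (frep 0) => [[a b] d].
rewrite /feqv /fnum /= !mul0r !addr0 !add0r !mulr1 => ->.
have irr : ~ nlt b b.
  move=> /num_ltP[c h]; apply: (@num_S_neq0 _ c); apply: (@num_addI _ b).
  by rewrite addr0 addrA -h.
by do 2 case: excluded_middle_informative => //.
Qed.

HB.instance Definition _ := GRing.ComNzRing_isField.Build (fraction M) fmulV finv0.

Definition fnonneg x : Prop := exists c, (frep x).1.1 = (frep x).1.2 + c.

Lemma fnonnegE a b d : fnonneg (fcls (a, b, d)) <-> exists c, a = b + c.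
Proof.
rewrite /fnonneg; have := frep_cls (a, b, d); case: (frep _) => [[r s] q].
have main (a1 b1 d1 r1 s1 q1 : num M) : r1 * (d1 + 1) + b1 * (q1 + 1) = a1 * (q1 + 1) + s1 * (d1 + 1) ->
    (exists c, r1 = s1 + c) -> exists c, a1 = b1 + c.
  move=> h [c e]; case: (num_total a1 b1) => [[f ef]|[f ->]]; last by exists f.
  exists 0; rewrite ef; suff -> : f = 0 by rewrite !addr0.
  (* If b1 = a1 + f and r1 = s1 + c, then cross multiplication gives c (d1 + 1) + f (q1 + 1) = 0,
     which forces f = 0. *)
  have : (c * (d1 + 1) + f * q1) + f = 0.
    apply: (@num_addI _ (a1 * (q1 + 1) + s1 * (d1 + 1))).
    by rewrite addr0 -[RHS]h e ef; ring.
  exact: num_add_eq0.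
rewrite /feqv /fnum /= => h; split; first exact: main h.
exact: main (esym h).
Qed.

Definition fle x y : bool := if excluded_middle_informative (fnonneg (y - x)) then true else false.
Definition flt x y : bool := (y != x) && fle x y.
Definition fnorm x : fraction M := if fle 0 x then x else - x.

Lemma fleP x y : reflect (fnonneg (y - x)) (fle x y).
Proof. by rewrite /fle; case: excluded_middle_informative => h; constructor. Qed.

Lemma fle0_add x y : fle 0 x -> fle 0 y -> fle 0 (x + y).
Proof.
move=> /fleP + /fleP h2; rewrite subr0; move: h2; rewrite subr0 => + h1.
move: h1; elim/fcls_ind: x => a b d /fnonnegE[c ->].
elim/fcls_ind: y => a' b' d' /fnonnegE[c' ->].
apply/fleP; rewrite subr0 [_ + _]faddE; apply/fnonnegE.
by exists (c * (d' + 1) + c' * (d + 1)); ring.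
Qed.

Lemma fle0_mul x y : fle 0 x -> fle 0 y -> fle 0 (x * y).
Proof.
move=> /fleP + /fleP h2; rewrite subr0; move: h2; rewrite subr0 => + h1.
move: h1; elim/fcls_ind: x => a b d /fnonnegE[c ->].
elim/fcls_ind: y => a' b' d' /fnonnegE[c' ->].
apply/fleP; rewrite subr0 [_ * _]fmulE; apply/fnonnegE.
by exists (c * c'); ring.
Qed.

Lemma fle0_anti x : fle 0 x -> fle x 0 -> x = 0.
Proof.
move=> /fleP + /fleP; rewrite subr0 sub0r; elim/fcls_ind: x => a b d.
rewrite [- _]foppE => /fnonnegE[c e] /fnonnegE[c' e'].
rewrite -[RHS]/fzero; apply/fcls_eq; rewrite /feqv /fnum /=; suff c0 : c = 0 by rewrite e c0; ring.
apply: (@num_add_eq0 _ c'); apply: (@num_addI _ b).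
by rewrite addr0 {2}e' e; ring.
Qed.

Lemma fsub_ge0 x y : fle 0 (y - x) = fle x y.
Proof. by rewrite /fle subr0. Qed.

Lemma fle0_total x : fle 0 x || fle x 0.
Proof.
apply/orP; elim/fcls_ind: x => a b d.
case: (num_total a b) => h; [right|left]; apply/fleP.
  by rewrite sub0r [- _]foppE fnonnegE.
by rewrite subr0 fnonnegE.
Qed.

Lemma fnormN x : fnorm (- x) = fnorm x.
Proof.
have fle0N z : fle 0 (- z) = fle z 0 by rewrite -sub0r fsub_ge0.
rewrite /fnorm fle0N opprK; case: (boolP (fle 0 x)) => h1; case: (boolP (fle x 0)) => h2 //.
  by rewrite (fle0_anti h1 h2) oppr0.
by have := fle0_total x; rewrite (negPf h1) (negPf h2).
Qed.

Lemma fge0_norm x : fle 0 x -> fnorm x = x.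
Proof. by rewrite /fnorm => ->. Qed.

HB.instance Definition _ := Num.IntegralDomain_isLeReal.Build (fraction M)
  fle0_add fle0_mul fle0_anti fsub_ge0 fle0_total fnormN fge0_norm (fun x y => erefl).

Definition kval (n : num M) : fraction M := fcls (n, 0, 0).

Lemma kval_inj : injective kval.
Proof. by move=> a b /fcls_eq; rewrite /feqv /fnum /= !mul0r !addr0 !add0r !mulr1. Qed.

Lemma kval0 : kval 0 = 0. Proof. by []. Qed.
Lemma kval1 : kval 1 = 1. Proof. by []. Qed.
Lemma kvalD a b : kval (a + b) = kval a + kval b.
Proof. by symmetry; rewrite [LHS]faddE; apply/fcls_eq; rewrite /feqv /fnum /=; ring. Qed.
Lemma kvalM a b : kval (a * b) = kval a * kval b.
Proof. by symmetry; rewrite [LHS]fmulE; apply/fcls_eq; rewrite /feqv /fnum /=; ring. Qed.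

Lemma kval_ge0 a : 0 <= kval a.
Proof. by apply/fleP; rewrite subr0 fnonnegE; exists a; rewrite add0r. Qed.

Lemma kval_lt a b : kval a < kval b <-> nlt a b.
Proof.
split=> [h|/num_ltP[c ->]]; last by rewrite !kvalD; have := kval_ge0 c; rewrite kval1; lra.
case: (num_trichotomy a b) => [//|[e|/num_ltP[c e]]]; first by rewrite e ltxx in h.
by move: h; rewrite e !kvalD kval1; have := kval_ge0 c; lra.
Qed.

Lemma kval_ltS a b : kval a < kval b -> kval a + 1 <= kval b.
Proof. by move=> /kval_lt /num_ltP[c ->]; rewrite !kvalD kval1; have := kval_ge0 c; lra. Qed.

Lemma fcls_kval a b d : fcls (a, b, d) = (kval a - kval b) / (kval d + 1).
Proof.
have dnz : kval d + 1 != 0 by have := kval_ge0 d; apply: contraTneq => e; lra.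
apply: (mulIf dnz); rewrite divfK // -kval1 -kvalD [LHS]fmulE [- _]foppE [RHS]faddE.
by apply/fcls_eq; rewrite /feqv /fnum /=; ring.
Qed.

Lemma fraction_kval x : exists a b d, x = (kval a - kval b) / (kval d + 1).
Proof. by elim/fcls_ind: x => a b d; exists a, b, d; rewrite fcls_kval. Qed.

End FractionField.
(** * Rational and real numbers *)

Ltac ev := cbn beta iota zeta delta [eval econs var_case].

Lemma addf_frac (F : realFieldType) (x y a a' b b' : F) : 0 < y + 1 -> 0 < x + 1 ->
  (a * (y + 1) + b * (x + 1) - (a' * (y + 1) + b' * (x + 1))) /
    ((x + 1) * (y + 1) - 1 + 1) = (a - a') / (x + 1) + (b - b') / (y + 1).
Proof. by move=> hy hx; field; rewrite subrK mulf_neq0 !gt_eqF. Qed.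

(** * Values of the codes of pairs and rationals *)

Section Codes.
Variable M : model.
Implicit Types (a b c d m n w : num M).
Local Notation K := (fraction M).

Lemma kval_leP a b : kval a <= kval b <-> exists d, b = a + d.
Proof.
split=> [h|[d ->]]; last by rewrite kvalD; have := kval_ge0 d; lra.
case: (num_total a b) => // -[d e]; exists 0.
have : kval d = 0 by move: h; rewrite e kvalD; have := kval_ge0 d; lra.
by rewrite -kval0 => /kval_inj d0; rewrite e d0 !addr0.
Qed.

Lemma kval_le_lt a b : kval a <= kval b <-> nlt a (b + 1).
Proof.
rewrite -kval_lt; split=> [h|/kval_ltS]; rewrite kvalD kval1; lra.
Qed.

Lemma qfree_ext (P Q : num M -> Prop) : (forall n, P n <-> Q n) ->
  qfree (M := M) P -> qfree (M := M) Q.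
Proof.
move=> h; suff -> : P = Q by [].
by apply: functional_extensionality => n; apply: propositional_extensionality.
Qed.

(** Field inequalities between numbers are quantifier-free, so inductions can be carried out in
    field notation and closed by linear arithmetic. *)
Lemma qf_kle (f g : num M -> num M) : dfn (s := ty0) (t := ty0) f ->
  dfn (s := ty0) (t := ty0) g -> qfree (M := M) (fun n => kval (f n) <= kval (g n)).
Proof.
move=> df dg; apply: (@qfree_ext (fun n => nlt (f n) (g n + 1))).
  by move=> n; rewrite kval_le_lt.
by apply: qf_lt => //; apply: num_dfn_add => //; apply: dfn_const.
Qed.

Lemma qf_klt (f g : num M -> num M) : dfn (s := ty0) (t := ty0) f ->
  dfn (s := ty0) (t := ty0) g -> qfree (M := M) (fun n => kval (f n) < kval (g n)).
Proof.
move=> df dg; apply: (@qfree_ext (fun n => nlt (f n) (g n))); last exact: qf_lt.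
by move=> n; rewrite kval_lt.
Qed.

Lemma nsub_le a b : kval b <= kval a -> kval (nsub a b) = kval a - kval b.
Proof. by move=> /kval_leP[d ->]; rewrite addrC nsub_addr kvalD addrK. Qed.

Lemma nsub_ge a b : kval a <= kval b -> nsub a b = 0.
Proof.
have nsub0n : forall d, nsub 0 d = 0.
  by move=> d; ind d => [|IH]; rewrite ?nsub0 // nsubS IH npred0.
move=> /kval_leP[d ->]; rewrite -(nsub0n d).
by ind a => [|IH]; rewrite ?add0r // addrAC nsubSS.
Qed.

Lemma kval_nsub a b : kval (nsub a b) = Num.max (kval a - kval b) 0.
Proof.
case: (lerP (kval b) (kval a)) => h; first by rewrite nsub_le // max_l //; lra.
by rewrite nsub_ge ?kval0 ?max_r //; lra.
Qed.

Definition ntri n : num M := sapp (eval (@enil (car M)) ctri) n.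
Definition ntroot n : num M := sapp (eval (@enil (car M)) ctroot) n.
Definition npair a b : num M := sapp (sapp (eval (@enil (car M)) cpair) a) b.
Definition nsnd c : num M := locked (nsub c (ntri (ntroot c))).
Definition nfst c : num M := locked (nsub (ntroot c) (nsnd c)).
Definition npow n : num M := sapp (eval (@enil (car M)) cpow2) n.

Lemma eval_ctri G (e : env (car M) G) n : sapp (eval e ctri) n = ntri n.
Proof. by []. Qed.

Lemma eval_ctroot G (e : env (car M) G) n : sapp (eval e ctroot) n = ntroot n.
Proof. by []. Qed.

Lemma eval_cpow2 G (e : env (car M) G) n : sapp (eval e cpow2) n = npow n.
Proof. by []. Qed.

Lemma eval_csnd G (e : env (car M) G) n : sapp (eval e csnd) n = nsnd n.
Proof. by rewrite /nsnd -lock /csnd eval_lam; ev; rewrite eval_cmonus eval_ctroot eval_ctri. Qed.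

Lemma eval_cfst G (e : env (car M) G) n : sapp (eval e cfst) n = nfst n.
Proof. by rewrite /nfst -lock /cfst eval_lam; ev; rewrite eval_cmonus eval_ctroot eval_csnd. Qed.

Lemma eval_cpair_raw G (e : env (car M) G) a b :
  sapp (sapp (eval e cpair) a) b = ntri (a + b) + b.
Proof. by rewrite /cpair !eval_lam; ev; rewrite eval_ctri. Qed.

Lemma eval_cpair G (e : env (car M) G) a b : sapp (sapp (eval e cpair) a) b = npair a b.
Proof. by rewrite /npair !eval_cpair_raw. Qed.

Lemma ntri0 : ntri 0 = 0. Proof. exact: rec0. Qed.

Lemma ntriS n : ntri (n + 1) = ntri n + (n + 1).
Proof.
by rewrite /ntri [LHS](recS (eval (@enil (car M)) (lam (lam (tapp (tapp cadd var0)
  (tapp (tapp cadd var1) cone))))) 0 n) !eval_lam.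
Qed.

Lemma ntroot0 : ntroot 0 = 0. Proof. exact: rec0. Qed.

Lemma ntrootS c : ntroot (c + 1) =
  ntroot c + nsub 1 (nsub (ntri (ntroot c + 1)) (c + 1)).
Proof.
rewrite {1}/ntroot /ctroot; ev; rewrite recS !eval_lam; ev.
by rewrite !eval_cmonus eval_ctri.
Qed.

Lemma ntri_dfn s (f : car M s -> num M) : dfn (t := ty0) f ->
  dfn (t := ty0) (fun n : car M s => ntri (f n)).
Proof. by move=> df; apply: dfn_app => //; apply: dfn_const. Qed.
Lemma ntroot_dfn s (f : car M s -> num M) : dfn (t := ty0) f ->
  dfn (t := ty0) (fun n : car M s => ntroot (f n)).
Proof. by move=> df; apply: dfn_app => //; apply: dfn_const. Qed.
Lemma npow_dfn s (f : car M s -> num M) : dfn (t := ty0) f ->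
  dfn (t := ty0) (fun n : car M s => npow (f n)).
Proof. by move=> df; apply: dfn_app => //; apply: dfn_const. Qed.

Lemma ntri_mono a b : kval a <= kval b -> kval (ntri a) <= kval (ntri b).
Proof.
move=> /kval_leP[d ->]; move: d; apply: num_ind => [||d].
- by apply: qf_kle; do ?apply: ntri_dfn; dfn.
- by rewrite addr0.
- rewrite addrA ntriS 2!kvalD; have := kval_ge0 (a + d); have := kval_ge0 (1 : num M).
  by rewrite [kval (_ + _)]kvalD kval1; have := kval_ge0 (a + d); rewrite kvalD; lra.
Qed.

Lemma ntroot_spec c : kval (ntri (ntroot c)) <= kval c /\ kval c < kval (ntri (ntroot c + 1)).
Proof.
move: c; apply: num_ind => [||c].
- by apply: qf_and; [apply: qf_kle|apply: qf_klt]; do ?apply: ntri_dfn; dfn;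
    do ?apply: num_dfn_add; do ?apply: ntroot_dfn; dfn.
- by rewrite ntroot0 ntriS ntri0 !kvalD kval0 kval1; split; lra.
rewrite ntrootS => -[h1 h2].
(* The root grows exactly when c + 1 reaches the next triangular number. *)
case: (lerP (kval (ntri (ntroot c + 1))) (kval (c + 1))) => h.
  rewrite (nsub_ge h) nsub0; split=> //.
  rewrite [ntri (_ + 1 + 1)]ntriS kvalD; have := kval_ltS h2; rewrite !kvalD kval1.
  by have := kval_ge0 (ntroot c); lra.
have h3 : nsub 1 (nsub (ntri (ntroot c + 1)) (c + 1)) = 0.
  by apply: nsub_ge; rewrite nsub_le; [have := kval_ltS h; rewrite kval1; lra|exact: ltW].
by rewrite h3 addr0; split=> //; rewrite kvalD kval1; lra.
Qed.

Lemma ntroot_uniq w c : kval (ntri w) <= kval c -> kval c < kval (ntri (w + 1)) ->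
  ntroot c = w.
Proof.
have [h1 h2] := ntroot_spec c => h3 h4.
have S x y : kval x < kval y -> kval (ntri (x + 1)) <= kval (ntri y).
  by move=> h; apply: ntri_mono; have := kval_ltS h; rewrite kvalD kval1.
apply: kval_inj; apply/eqP; rewrite eq_le; apply/andP; split; rewrite leNgt; apply/negP => /S; lra.
Qed.

Lemma ntroot_pair a b : ntroot (npair a b) = a + b.
Proof.
rewrite /npair eval_cpair_raw; apply: ntroot_uniq.
  by rewrite kvalD; have := kval_ge0 b; lra.
by rewrite ntriS 4!kvalD kval1; have := kval_ge0 a; lra.
Qed.

Lemma nsnd_pair a b : nsnd (npair a b) = b.
Proof. by rewrite /nsnd -lock ntroot_pair /npair eval_cpair_raw addrC nsub_addr. Qed.

Lemma nfst_pair a b : nfst (npair a b) = a.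
Proof. by rewrite /nfst -lock nsnd_pair ntroot_pair nsub_addr. Qed.

Lemma npow0 : npow 0 = 1. Proof. exact: rec0. Qed.

Lemma npowS n : npow (n + 1) = npow n + npow n.
Proof.
by rewrite /npow [LHS](recS (eval (@enil (car M)) (lam (lam (tapp (tapp cadd var0) var0)))) 1 n)
  !eval_lam.
Qed.

Lemma npow_gt n : kval n + 1 <= kval (npow n).
Proof.
rewrite -kval1 -kvalD; move: n; apply: num_ind => [||n IH].
- by apply: qf_kle; do ?apply: npow_dfn; dfn.
- by rewrite npow0 add0r.
- by rewrite npowS !kvalD kval1; move: IH; rewrite kvalD kval1; have := kval_ge0 n; lra.
Qed.

Lemma npow_gt0 n : 0 < kval (npow n).
Proof. by have := npow_gt n; have := kval_ge0 n; lra. Qed.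

Lemma npowD n m : npow (n + m) = npow n * npow m.
Proof.
move: m; apply: num_ind => [||m IH].
- by apply: qf_eq; dfn; do ?apply: npow_dfn; dfn.
- by rewrite npow0 addr0 mulr1.
- by rewrite addrA !npowS IH mulrDr.
Qed.

Definition eps n : K := (kval (npow n))^-1.

Lemma eps_gt0 n : 0 < eps n. Proof. by rewrite invr_gt0 npow_gt0. Qed.
Lemma eps0 : eps 0 = 1. Proof. by rewrite /eps npow0 kval1 invr1. Qed.
Lemma epsD n m : eps (n + m) = eps n * eps m.
Proof. by rewrite /eps npowD kvalM invfM. Qed.
Lemma eps1 : eps 1 = 1 / 2.
Proof. by rewrite /eps -[X in npow X]add0r npowS npow0 kvalD kval1; field. Qed.
Lemma epsS n : eps (n + 1) = eps n / 2.
Proof. by rewrite epsD eps1; lra. Qed.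
Lemma eps_le1 n : eps n <= 1.
Proof.
rewrite /eps invf_le1 ?npow_gt0 //.
by have := npow_gt n; have := kval_ge0 n; lra.
Qed.
Lemma eps_add_le n m : eps (n + m) <= eps n.
Proof. by rewrite epsD; have := eps_le1 m; have := eps_gt0 n; nra. Qed.
Lemma eps_le n m : kval n <= kval m -> eps m <= eps n.
Proof. by move=> /kval_leP[d ->]; apply: eps_add_le. Qed.

(** The field is archimedean relative to the numbers of the model: a positive (a - b) / (d + 1) is
    at least 1 / (d + 1), and 2^d >= d + 1. *)
Lemma eps_small (x : K) : 0 < x -> exists n, eps n < x.
Proof.
move=> x0; have [a [b [d e]]] := fraction_kval x.
exists (d + 1); rewrite epsS; have d0 : 0 < kval d + 1 by have := kval_ge0 d; lra.
have xd : x * (kval d + 1) = kval a - kval b by rewrite e divfK // gt_eqF.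
have ab : kval b + 1 <= kval a by apply: kval_ltS; rewrite -subr_gt0 -xd mulr_gt0.
have ed : eps d * kval (npow d) = 1 by rewrite mulVf // gt_eqF ?npow_gt0.
have := npow_gt d; have := eps_gt0 d; nra.
Qed.

Definition nmk a b d : num M := npair a (npair b d).
Definition qval c : K := (kval (nfst c) - kval (nfst (nsnd c))) / (kval (nsnd (nsnd c)) + 1).

Lemma qval_mk a b d : qval (nmk a b d) = (kval a - kval b) / (kval d + 1).
Proof. by rewrite /qval /nmk !(nfst_pair, nsnd_pair). Qed.

Section Terms.
Variables (G : ctx) (e : env (car M) G).
Implicit Types (s t : tm G ty0).

Lemma eval_qpos s : eval e (qpos s) = nfst (eval e s).
Proof. by rewrite /qpos; ev; rewrite eval_cfst. Qed.
Lemma eval_qneg s : eval e (qneg s) = nfst (nsnd (eval e s)).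
Proof. by rewrite /qneg; ev; rewrite eval_cfst eval_csnd. Qed.
Lemma eval_qden1 s : eval e (qden1 s) = nsnd (nsnd (eval e s)).
Proof. by rewrite /qden1; ev; rewrite !eval_csnd. Qed.
Lemma eval_qden s : eval e (qden s) = nsnd (nsnd (eval e s)) + 1.
Proof. by rewrite /qden; ev; rewrite eval_qden1. Qed.
Lemma eval_qmk s t r : eval e (qmk s t r) = nmk (eval e s) (eval e t) (eval e r).
Proof. by rewrite /qmk; ev; rewrite !eval_cpair. Qed.
Lemma eval_add s t : eval e (s + t)%tm = (eval e s : num M) + eval e t.
Proof. by []. Qed.
Lemma eval_mul s t : eval e (s * t)%tm = (eval e s : num M) * eval e t.
Proof. by []. Qed.
Lemma eval_zero : @eval M _ e _ czero = (0 : num M).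
Proof. by []. Qed.
Lemma eval_one : @eval M _ e _ cone = (1 : num M).
Proof. by []. Qed.
Lemma eval_monus s t : eval e (s -| t)%tm = nsub (eval e s) (eval e t).
Proof. by ev; rewrite eval_cmonus. Qed.
End Terms.

Lemma qden_gt0 c : 0 < kval (nsnd (nsnd c)) + 1 :> K.
Proof. by have := kval_ge0 (nsnd (nsnd c)); lra. Qed.

Definition evq := (eval_qmk, eval_add, eval_mul, eval_zero, eval_one, eval_monus, eval_qpos, eval_qneg,
  eval_qden1, eval_qden).

Lemma qval_qhalf G (e : env (car M) G) (t : tm G ty0) : qval (eval e (qhalf t)) = eps (eval e t).
Proof.
rewrite /qhalf !evq qval_mk kval0 subr0 kval1.
have -> : eval e (cpow2 $ t)%tm = npow (eval e t) by exact: (eval_cpow2 e (eval e t)).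
rewrite nsub_le; first by rewrite kval1 subrK div1r.
by rewrite kval1; have := npow_gt (eval e t); have := kval_ge0 (eval e t); lra.
Qed.

Lemma qval_qadd G (e : env (car M) G) a b :
  qval (sapp (sapp (eval e qadd) a) b) = qval a + qval b.
Proof.
rewrite /qadd !eval_lam !evq; ev; rewrite qval_mk /qval.
have := qden_gt0 a; have := qden_gt0 b.
set da := nsnd (nsnd a); set db := nsnd (nsnd b) => hb ha.
have := kval_ge0 da; have := kval_ge0 db => hb' ha'.
rewrite nsub_le ?(kvalD, kvalM, kval1); last by nra.
move: (kval (nfst a)) (kval (nfst (nsnd a))) (kval (nfst b)) (kval (nfst (nsnd b))).
move: (kval da) (kval db) ha hb {ha' hb'} => {a b da db} da db ha hb a a' b b'.
exact: addf_frac.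
Qed.

Lemma qval_qopp G (e : env (car M) G) a : qval (sapp (eval e qopp) a) = - qval a.
Proof. by rewrite /qopp eval_lam !evq; ev; rewrite qval_mk /qval -mulNr opprB. Qed.

Lemma qval_qsub G (e : env (car M) G) a b :
  qval (sapp (sapp (eval e qsub) a) b) = qval a - qval b.
Proof. by rewrite /qsub !eval_lam; ev; rewrite qval_qadd qval_qopp. Qed.

Lemma max_norm (x : K) : Num.max x 0 + Num.max (- x) 0 = `|x|.
Proof.
case: (lerP 0 x) => h.
  by rewrite max_r ?oppr_le0 // addr0 ger0_norm.
by rewrite max_l ?oppr_ge0 ?ltW // add0r ltr0_norm.
Qed.

Lemma qval_qabs G (e : env (car M) G) a : qval (sapp (eval e qabs) a) = `|qval a|.
Proof.
rewrite /qabs eval_lam !evq; ev; rewrite qval_mk kvalD kval0 subr0 /qval normrM.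
rewrite (@ger0_norm _ (_^-1)) ?invr_ge0 ?ltW ?qden_gt0 //; congr (_ / _).
by rewrite !kval_nsub -(opprB (kval (nfst a))) max_norm.
Qed.

Lemma qval_qplus G (e : env (car M) G) a : qval (sapp (eval e qplus) a) = Num.max (qval a) 0.
Proof.
rewrite /qplus eval_lam !evq; ev; rewrite qval_mk kval0 subr0 /qval kval_nsub.
by rewrite maxr_pMl ?mul0r // invr_ge0 ltW // qden_gt0.
Qed.

Lemma frac_ltP (a b d a' b' d' : num M) :
  (kval a - kval b) / (kval d + 1) < (kval a' - kval b') / (kval d' + 1) <->
  nlt (a * (d' + 1) + b' * (d + 1)) (a' * (d + 1) + b * (d' + 1)).
Proof.
have hd : 0 < kval d + 1 by have := kval_ge0 d; lra.
have hd' : 0 < kval d' + 1 by have := kval_ge0 d'; lra.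
rewrite -kval_lt ?(kvalD, kvalM, kval1) ltr_pdivrMr // mulrAC ltr_pdivlMr //.
by split; lra.
Qed.

Lemma sat_flt G (e : env (car M) G) (s t : tm G ty0) :
  sat e (Defs.flt s t) <-> nlt (eval e s) (eval e t).
Proof. by []. Qed.

Lemma sat_qlt G (e : env (car M) G) (s t : tm G ty0) : sat e (qlt s t) <-> qval (eval e s) < qval (eval e t).
Proof. by rewrite /qval frac_ltP /qlt sat_flt !evq. Qed.

Lemma sat_nle G (e : env (car M) G) (s t : tm G ty0) :
  sat e (nle s t) <-> kval (eval e s) <= kval (eval e t).
Proof.
rewrite kval_le_lt num_ltS; split=> -[h|h]; [by left|by right; apply/(model_eq (mP M))|by left|].
by right; apply/(model_eq (mP M)).
Qed.

Lemma sat_qle G (e : env (car M) G) (s t : tm G ty0) : sat e (qle s t) <-> qval (eval e s) <= qval (eval e t).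
Proof.
rewrite /qle sat_nle !evq !leNgt; split=> /negP h; apply/negP => lt; apply: h.
  exact/kval_lt/(frac_ltP _ _ _ _ _ _).1.
exact/(frac_ltP _ _ _ _ _ _).2/kval_lt.
Qed.

End Codes.

(** * Reals as sequences of fractions *)

Section Reals.
Variable M : model.
Local Notation K := (fraction M).
Implicit Types (n m i : num M) (x y z : num M -> K).

(* Reals enter the analysis only through their sequences of rational values. *)
Definition isR x : Prop := forall n i, `|x n - x (n + i)| < eps n.
Definition Req x y : Prop := forall n, `|x n - y n| <= eps n + eps n.
Definition Rle x y : Prop := forall n, x n <= y n + (eps n + eps n).
Definition Rlt x y : Prop := exists n, x n + (eps n + eps n) < y n.

Definition Rsub x y : num M -> K := fun n => x (n + 1) - y (n + 1).
Definition Radd x y : num M -> K := fun n => x (n + 1) + y (n + 1).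
Definition Rdist x y : num M -> K := fun n => `|x (n + 1) - y (n + 1)|.

Definition rv (x : car M ty1) : num M -> K := fun n => qval (sapp x n).

Section Terms.
Variables (G : ctx) (e : env (car M) G).
Implicit Types (s t : tm G ty1).

Lemma sat_isReal t : sat e (isReal t) <-> isR (rv (eval e t)).
Proof.
have E n i : @sat M _ (econs i (econs n e)) (qlt (qabs $ (qsub $ (wk (wk t) $ var1) $
    (wk (wk t) $ (var1 + var0)))) (qhalf var1))%tm <-> `|rv (eval e t) n - rv (eval e t) (n + i)| < eps n.
  by rewrite sat_qlt qval_qhalf; ev; rewrite qval_qabs qval_qsub !eval_wk.
by split=> h n i; [apply/E; exact: (h n i)|exact: ((E n i).2 (h n i))].
Qed.

Lemma sat_req s t : sat e (req s t) <-> Req (rv (eval e s)) (rv (eval e t)).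
Proof.
have E n : @sat M _ (econs n e) (qle (qabs $ (qsub $ (wk s $ var0) $ (wk t $ var0)))
    (qadd $ qhalf var0 $ qhalf var0))%tm <-> `|rv (eval e s) n - rv (eval e t) n| <= eps n + eps n.
  by rewrite sat_qle; ev; rewrite qval_qabs qval_qsub qval_qadd !qval_qhalf !eval_wk.
by split=> h n; [apply/E; exact: (h n)|exact: ((E n).2 (h n))].
Qed.

Lemma sat_rle s t : sat e (rle s t) <-> Rle (rv (eval e s)) (rv (eval e t)).
Proof.
have E n : @sat M _ (econs n e) (qle (wk s $ var0) (qadd $ (wk t $ var0) $
    (qadd $ qhalf var0 $ qhalf var0)))%tm <-> rv (eval e s) n <= rv (eval e t) n + (eps n + eps n).
  by rewrite sat_qle; ev; rewrite !qval_qadd !qval_qhalf !eval_wk.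
by split=> h n; [apply/E; exact: (h n)|exact: ((E n).2 (h n))].
Qed.

Lemma sat_rlt s t : sat e (rlt s t) <-> Rlt (rv (eval e s)) (rv (eval e t)).
Proof.
have E n : @sat M _ (econs n e) (qlt (qadd $ (wk s $ var0) $ (qadd $ qhalf var0 $ qhalf var0))
    (wk t $ var0))%tm <-> rv (eval e s) n + (eps n + eps n) < rv (eval e t) n.
  by rewrite sat_qlt; ev; rewrite !qval_qadd !qval_qhalf !eval_wk.
by split=> -[n h]; exists n; [apply/E; exact: h|exact: ((E n).2 h)].
Qed.

Lemma qval_q0 : qval (eval e q0) = 0.
Proof. by rewrite /q0 eval_qmk qval_mk !eval_zero subrr mul0r. Qed.
Lemma qval_q1 : qval (eval e q1) = 1.
Proof. by rewrite /q1 eval_qmk qval_mk !eval_zero eval_one kval0 kval1 subr0 add0r divr1. Qed.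

Lemma rv_rconst (c : tm G ty0) : rv (eval e (rconst c)) = fun _ => qval (eval e c).
Proof. by apply: functional_extensionality => n; rewrite /rv /rconst; ev; rewrite sK_eq. Qed.

Lemma rv_rconst0 : rv (eval e (rconst q0)) = fun _ => 0.
Proof. by rewrite rv_rconst qval_q0. Qed.

Lemma rv_rconst1 : rv (eval e (rconst q1)) = fun _ => 1.
Proof. by rewrite rv_rconst qval_q1. Qed.

Lemma rv_radd s t : rv (eval e (radd $ s $ t)%tm) = Radd (rv (eval e s)) (rv (eval e t)).
Proof.
apply: functional_extensionality => n; rewrite /rv; ev.
by rewrite /radd !eval_lam; ev; rewrite qval_qadd.
Qed.

Lemma rv_rsub s t : rv (eval e (rsub $ s $ t)%tm) = Rsub (rv (eval e s)) (rv (eval e t)).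
Proof.
apply: functional_extensionality => n; rewrite /rv; ev.
by rewrite /rsub !eval_lam; ev; rewrite qval_qsub.
Qed.

Lemma rv_rdist s t : rv (eval e (rdist s t)) = Rdist (rv (eval e s)) (rv (eval e t)).
Proof.
apply: functional_extensionality => n.
rewrite /Rdist -[_ - _]/(Rsub (rv (eval e s)) (rv (eval e t)) n) -rv_rsub /rv.
rewrite /rdist; ev; move: (sapp (sapp (eval e rsub) (eval e s)) (eval e t)) => d.
by rewrite /rabs !eval_lam; ev; rewrite qval_qabs.
Qed.

End Terms.

End Reals.

(** * The two principles read in a model *)

Section Principles.
Variable M : model.
Local Notation K := (fraction M).
Local Notation real := (num M -> K).
Implicit Types (n m i k : num M) (x y z : real) (F : car M (tarr ty1 ty1)).

Definition cst (q : K) : real := fun _ => q.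
Definition unitI x : Prop := [/\ isR x, Rle (cst 0) x & Rle x (cst 1)].
Definition posR x : Prop := isR x /\ Rlt (cst 0) x.

Definition pos_on (D : real -> Prop) F : Prop :=
  (forall x : car M ty1, D (rv x) -> posR (rv (sapp F x))) /\
  (forall x y : car M ty1, D (rv x) -> D (rv y) -> Req (rv x) (rv y) ->
    Req (rv (sapp F x)) (rv (sapp F y))).

Definition in_canon F (y : car M ty1) x : Prop :=
  Rlt (Rsub (rv y) (rv (sapp F y))) x /\ Rlt x (Radd (rv y) (rv (sapp F y))).

Definition finite_cover F : Prop := exists k (Y : car M (tarr ty0 ty1)),
  (forall i, kval i <= kval k -> unitI (rv (sapp Y i))) /\
  (forall x : car M ty1, unitI (rv x) -> exists i, kval i <= kval k /\ in_canon F (sapp Y i) (rv x)).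

Definition in_itv x (c : num M) : Prop :=
  Rlt (cst (qval (nfst c))) x /\ Rlt x (cst (qval (nsnd c))).
Definition in_open (u : car M ty1) x : Prop := isR x /\ exists n, in_itv x (sapp u n).
Definition in_closed (u : car M ty1) x : Prop := isR x /\ ~ in_open u x.

(** Partial sums are described by their recursion equations, which frees [null] from the term
    [length_sum] and its environment; definability of l permits induction along it. *)
Definition is_length_sum (v : car M ty1) (l : num M -> num M) : Prop :=
  [/\ dfn (s := ty0) (t := ty0) l, qval (l 0) = 0 &
   forall n, qval (l (n + 1)) =
     qval (l n) + Num.max (qval (nsnd (sapp v n)) - qval (nfst (sapp v n))) 0].

Definition null (A : real -> Prop) : Prop := forall eps : car M ty1, posR (rv eps) ->
  exists v, (forall x : car M ty1, A (rv x) -> in_open v (rv x)) /\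
    exists s : car M ty1, [/\ isR (rv s), Rlt (rv s) (rv eps) &
      forall l, is_length_sum v l -> forall n, Rle (cst (qval (l n))) (rv s)].

Definition cont_at (D : real -> Prop) F (x : car M ty1) : Prop :=
  forall eps : car M ty1, posR (rv eps) -> exists2 d : car M ty1, posR (rv d) &
    forall y : car M ty1, D (rv y) -> Rlt (Rdist (rv x) (rv y)) (rv d) ->
      Rlt (Rdist (rv (sapp F x)) (rv (sapp F y))) (rv eps).

Definition cont_ae F : Prop := exists u,
  [/\ forall x : car M ty1, in_closed u (rv x) -> unitI (rv x), null (in_closed u) &
   forall x : car M ty1, unitI (rv x) -> ~ in_closed u (rv x) -> cont_at unitI F x].

Section Terms.
Variables (G : ctx) (e : env (car M) G).

Lemma sat_wk_set r (a : car M r) (A : rset G) (x : car M ty1) :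
  sat (econs x (econs a e)) (wk_set A) <-> sat (econs x e) A.
Proof.
rewrite /wk_set sat_ren.
have -> // : (fun s v => econs x (econs a e) (up_ren (fun s w => vs w) v)) = econs x e.
exact: varext_cons.
Qed.

Lemma sat_mem (A : rset G) (t : tm G ty1) : sat e (mem t A) <-> sat (econs (eval e t) e) A.
Proof. exact: sat_inst. Qed.

Lemma sat_setR (x : car M ty1) : sat (econs x e) setR <-> isR (rv x).
Proof. exact: sat_isReal. Qed.

Lemma sat_setI (x : car M ty1) : sat (econs x e) setI <-> unitI (rv x).
Proof.
rewrite /setI /unitI /cst -(rv_rconst0 (econs x e)) -(rv_rconst1 (econs x e)).
split=> [[/sat_isReal h1 [/sat_rle h2 /sat_rle h3]]|[h1 h2 h3]]; first by split.
by split; [apply/sat_isReal|split; apply/sat_rle].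
Qed.

Lemma sat_rpos t : sat e (rpos t) <-> posR (rv (eval e t)).
Proof.
rewrite /posR /cst -(rv_rconst0 e).
by split=> -[h1 h2]; split; [apply/sat_isReal|apply/sat_rlt|apply/sat_isReal|apply/sat_rlt].
Qed.

Lemma sat_in_interval t c : sat e (in_interval t c) <-> in_itv (rv (eval e t)) (eval e c).
Proof.
have E1 : rv (eval e (rconst (cfst $ c)))%tm = cst (qval (nfst (eval e c))).
  by rewrite rv_rconst; ev; rewrite eval_cfst.
have E2 : rv (eval e (rconst (csnd $ c)))%tm = cst (qval (nsnd (eval e c))).
  by rewrite rv_rconst; ev; rewrite eval_csnd.
rewrite /in_itv -E1 -E2.
by split=> -[h1 h2]; split; apply/sat_rlt.
Qed.

End Terms.

Lemma sat_open_set G (e : env (car M) G) u (x : car M ty1) :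
  sat (econs x e) (open_set u) <-> in_open (eval e u) (rv x).
Proof.
have E n : @sat M _ (econs n (econs x e)) (in_interval var1 (wk (wk u) $ var0)%tm) <->
    in_itv (rv x) (sapp (eval e u) n) by rewrite sat_in_interval; ev; rewrite !eval_wk.
split=> -[h [n hn]].
  by split; [apply/(sat_isReal (econs x e) var0)|exists n; apply/E].
by split; [apply/(sat_isReal (econs x e) var0)|exists n; apply/E].
Qed.

Lemma sat_closed_set G (e : env (car M) G) u (x : car M ty1) :
  sat (econs x e) (closed_set u) <-> in_closed (eval e u) (rv x).
Proof.
by split=> -[h1 h2]; (split; [by apply/(sat_isReal (econs x e) var0)|by move=> /(sat_open_set e u x)]).
Qed.

Lemma sat_pos_function G (e : env (car M) G) (A : rset G) (D : real -> Prop) t :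
  (forall x : car M ty1, sat (econs x e) A <-> D (rv x)) ->
  sat e (pos_function A t) <-> pos_on D (eval e t).
Proof.
move=> hA.
have E1 (x : car M ty1) : @sat M _ (econs x e) (rpos (wk t $ var0)%tm) <-> posR (rv (sapp (eval e t) x)).
  by rewrite sat_rpos; ev; rewrite eval_wk.
have E2 (x y : car M ty1) : @sat M _ (econs y (econs x e)) (req (wk (wk t) $ var1) (wk (wk t) $ var0))%tm <->
    Req (rv (sapp (eval e t) x)) (rv (sapp (eval e t) y)).
  by rewrite sat_req; ev; rewrite !eval_wk.
have E3 (x y z : car M ty1) : @sat M _ (econs z (econs y (econs x e))) (wk_set (wk_set A)) <-> D (rv z).
  by rewrite !sat_wk_set.
split=> -[h1 h2]; split.
- by move=> x /hA /h1 /E1.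
- move=> x y Dx Dy xy; apply/E2; apply: (h2 x y); split; first by apply/sat_mem/E3.
  by split; [apply/sat_mem/E3|apply/sat_req].
- by move=> x /hA Dx; apply/E1; apply: h1.
- move=> x y [/sat_mem/E3 Dx [/sat_mem/E3 Dy /sat_req xy]]; apply/E2; exact: h2.
Qed.

Lemma sat_in_canonical G (e : env (car M) G) (F : tm G (tarr ty1 ty1)) (y z : tm G ty1) :
  sat e (in_canonical F y z) <-> in_canon (eval e F) (eval e y) (rv (eval e z)).
Proof.
have E1 := @sat_rlt M _ e (rsub $ y $ (F $ y))%tm z; rewrite rv_rsub in E1.
have E2 := @sat_rlt M _ e z (radd $ y $ (F $ y))%tm; rewrite rv_radd in E2.
by split=> -[h1 h2]; [exact: (conj (E1.1 h1) (E2.1 h2))|exact: (conj (E1.2 h1) (E2.2 h2))].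
Qed.

Lemma sat_finite_subcover G (e : env (car M) G) t :
  sat e (finite_subcover t) <-> finite_cover (eval e t).
Proof.
have E1 k Y i : @sat M _ (econs i (econs Y (econs k e)))
    (nle var0 var2 ->> mem (var1 $ var0)%tm setI)%fm <->
    (kval i <= kval k -> unitI (rv (sapp Y i))).
  have Em := @sat_mem _ (econs i (econs Y (econs k e))) setI (var1 $ var0)%tm.
  have En := @sat_nle M _ (econs i (econs Y (econs k e))) var0 var2.
  have Es := @sat_setI _ (econs i (econs Y (econs k e))) (sapp Y i).
  split=> h hk; first exact: (Es.1 (Em.1 (h (En.2 hk)))).
  exact: (Em.2 (Es.2 (h (En.1 hk)))).
have E2 k Y (x : car M ty1) i : @sat M _ (econs i (econs x (econs Y (econs k e))))
    (nle var0 (tvar (vs (vs (vs vz)))) //\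
     in_canonical (wk (wk (wk (wk t)))) (var2 $ var0)%tm var1)%fm <->
    kval i <= kval k /\ in_canon (eval e t) (sapp Y i) (rv x).
  have En := @sat_nle M _ (econs i (econs x (econs Y (econs k e)))) var0 (tvar (vs (vs (vs vz)))).
  have Ec := @sat_in_canonical _ (econs i (econs x (econs Y (econs k e))))
    (wk (wk (wk (wk t)))) (var2 $ var0)%tm var1.
  have ew : eval (econs i (econs x (econs Y (econs k e)))) (wk (wk (wk (wk t)))) = eval e t.
    by rewrite !eval_wk.
  rewrite ew in Ec; split=> -[h1 h2]; first exact: (conj (En.1 h1) (Ec.1 h2)).
  exact: (conj (En.2 h1) (Ec.2 h2)).
split=> -[k [Y [h1 h2]]]; exists k, Y; split.
- by move=> i; apply/E1; apply: h1.
- by move=> x /(sat_setI (econs Y (econs k e)) x) /h2 [i /E2]; exists i.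
- by move=> i; apply/E1; apply: h1.
- by move=> x /sat_setI /h2 [i /E2]; exists i.
Qed.

Lemma length_sum_spec G (e : env (car M) G) (v : car M ty1) :
  is_length_sum v (fun n => sapp (sapp (eval e length_sum) v) n).
Proof.
have E : sapp (eval e length_sum) v = sapp (sapp (srec M)
    (eval (econs v e) (lam (lam (qadd $ var0 $ ilength (var2 $ var1))))%tm)) (eval (econs v e) q0).
  by rewrite /length_sum eval_lam.
split; first exact: dfn_sapp.
  by rewrite E rec0 qval_q0.
move=> n; rewrite E recS !eval_lam; ev.
by rewrite qval_qadd /ilength; ev; rewrite qval_qplus qval_qsub eval_cfst eval_csnd.
Qed.

Lemma sat_measure_zero G (e : env (car M) G) (A : rset G) (P : real -> Prop) :
  (forall x : car M ty1, sat (econs x e) A <-> P (rv x)) ->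
  null P -> sat e (measure_zero A).
Proof.
move=> hA nP ep /sat_rpos/nP [v [cov [s [Rs sep bnd]]]]; exists v; split.
  move=> x /sat_wk_set/sat_wk_set/hA/cov.
  by move/(sat_open_set (econs v (econs ep e)) var0 x).
exists s; split; first exact/(sat_isReal (econs s (econs v (econs ep e))) var0).
split; first by apply/(sat_rlt (econs s (econs v (econs ep e))) var0 (wk var1)).
move=> n; apply/(sat_rle (econs n (econs s (econs v (econs ep e))))
  (rconst (length_sum $ wk (wk var0) $ var0)) var1)%tm.
rewrite rv_rconst; ev.
exact: (bnd _ (length_sum_spec (econs n (econs s (econs v (econs ep e)))) v) n).
Qed.

Lemma sat_continuous_at G (e : env (car M) G) (A : rset G) (D : real -> Prop)
    (F : tm G (tarr ty1 ty1)) (x : tm G ty1) :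
  (forall y : car M ty1, sat (econs y e) A <-> D (rv y)) ->
  cont_at D (eval e F) (eval e x) -> sat e (continuous_at A F x).
Proof.
move=> hA hc ep /sat_rpos/hc [d pd hd]; exists d; split.
  by apply/(sat_rpos (econs d (econs ep e)) var0).
move=> y; pose e' := econs y (econs d (econs ep e)).
case=> /sat_mem/sat_wk_set/sat_wk_set/sat_wk_set/hA Dy.
move=> /(sat_rlt e' (rdist (wk (wk (wk x))) var0) var1); rewrite rv_rdist; ev.
rewrite !eval_wk => /(hd _ Dy) h.
apply/(sat_rlt e' (rdist (wk (wk (wk F)) $ wk (wk (wk x))) (wk (wk (wk F)) $ var0)) var2)%tm.
by rewrite rv_rdist; ev; rewrite !eval_wk.
Qed.

(** The direction from the semantic notion to the formula, by which a concrete function is shown to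
    be admissible for [HBUae]. *)
Lemma sat_continuous_ae G (e : env (car M) G) (F : tm G (tarr ty1 ty1)) :
  cont_ae (eval e F) -> sat e (continuous_ae F).
Proof.
case=> u [cI nu hc]; exists u; split.
  by move=> x /(sat_closed_set (econs u e) var0 x) /cI h; apply/(sat_setI (econs u e) x).
split; first by apply: (sat_measure_zero (P := in_closed u)) nu => x; apply: (sat_closed_set (econs u e) var0 x).
move=> x [/sat_setI Ix nx].
apply: (@sat_continuous_at _ (econs x (econs u e)) setI unitI (wk (wk F)) var0).
  by move=> y; apply: sat_setI.
by rewrite !eval_wk; apply: hc Ix _ => /(sat_closed_set (econs u e) var0 x).
Qed.

Definition hbu : Prop := forall F, pos_on (@isR M) F -> finite_cover F.
Definition hbu_ae : Prop := forall F, pos_on unitI F -> cont_ae F -> finite_cover F.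

Lemma sat_HBU : sat (@enil (car M)) HBU <-> hbu.
Proof.
have E F := @sat_pos_function _ (econs F (@enil (car M))) setR (@isR M) var0 (@sat_setR _ _).
have E' F := @sat_finite_subcover _ (econs F (@enil (car M))) var0.
by split=> h F; [move=> /E /h /E'|move=> /E /h /E'].
Qed.

Lemma sat_HBUae_imp : sat (@enil (car M)) HBUae -> hbu_ae.
Proof.
move=> h F pF cF.
apply/(@sat_finite_subcover _ (econs F (@enil (car M))) var0); apply: h; split.
  have Es (x : car M ty1) : sat (econs x (econs F (@enil (car M)))) setI <-> unitI (rv x).
    exact: sat_setI.
  exact/(sat_pos_function _ Es).
exact: sat_continuous_ae.
Qed.

Lemma imp_sat_HBUae : (forall F, pos_on unitI F -> finite_cover F) -> sat (@enil (car M)) HBUae.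
Proof.
move=> h F [pF _]; apply/(@sat_finite_subcover _ (econs F (@enil (car M))) var0); apply: h.
have Es (x : car M ty1) : sat (econs x (econs F (@enil (car M)))) setI <-> unitI (rv x).
  exact: sat_setI.
by move: pF => /(sat_pos_function _ Es).
Qed.

End Principles.

(** * Comparison of reals, and HBU on the unit interval *)

Section RealTheory.
Variable M : model.
Local Notation K := (fraction M).
Local Notation real := (num M -> K).
Implicit Types (n m i k : num M) (x y z : real) (q d : K).

Lemma isR_near x n m : isR x -> kval n <= kval m -> `|x n - x m| < eps n.
Proof. by move=> h /kval_leP[i ->]. Qed.

Lemma kval_addl n m : kval n <= kval (n + m).
Proof. by rewrite kvalD; have := kval_ge0 m; lra. Qed.
Lemma kval_addr n m : kval n <= kval (m + n).
Proof. by rewrite kvalD; have := kval_ge0 m; lra. Qed.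

Lemma eps_small_le d m : 0 < d -> exists2 n, kval m <= kval n & eps n + eps n < d.
Proof.
move=> d0; have [k hk] : exists k, eps k < d / 2 by apply: eps_small; lra.
exists (m + k); first exact: kval_addl.
by have := eps_le (kval_addr k m); lra.
Qed.

(** Past the witnessing index n each side moves by less than [eps n], so what the difference has
    beyond [eps n + eps n] survives as a gap. *)
Lemma Rlt_ev x y : isR x -> isR y -> Rlt x y ->
  exists2 d, 0 < d & exists n0, forall n, kval n0 <= kval n -> x n + d <= y n.
Proof.
move=> hx hy [n h]; exists (y n - x n - (eps n + eps n)); first by lra.
exists n => m nm; have := isR_near hx nm; have := isR_near hy nm.
by rewrite !ltr_norml => /andP[h1 h2] /andP[h3 h4]; lra.
Qed.

Lemma Rlt_of x y d n0 : 0 < d -> (forall n, kval n0 <= kval n -> x n + d <= y n) -> Rlt x y.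
Proof.
move=> d0 h; have [n le e] := eps_small_le n0 d0.
by exists n; have := h n le; lra.
Qed.

Lemma Rle_of x y : isR x -> isR y ->
  (forall d n0, 0 < d -> exists2 n, kval n0 <= kval n & x n <= y n + d) -> Rle x y.
Proof.
move=> hx hy h n; rewrite leNgt; apply/negP => lt.
pose d := (x n - (y n + (eps n + eps n))) / 2.
have [m nm le] := h d n ltac:(rewrite /d; lra).
have := isR_near hx nm; have := isR_near hy nm; move: le; rewrite /d !ltr_norml.
by move=> le /andP[h1 h2] /andP[h3 h4]; lra.
Qed.

Lemma Req_le x y : Req x y <-> Rle x y /\ Rle y x.
Proof.
split=> [h|[h1 h2] n].
  by split=> n; have := h n; rewrite ler_norml => /andP[]; lra.
by rewrite ler_norml; have := h1 n; have := h2 n => *; apply/andP; split; lra.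
Qed.

Lemma Req_ev x y d : Req x y -> 0 < d ->
  exists n0, forall n, kval n0 <= kval n -> `|x n - y n| <= d.
Proof.
move=> h d0; have [n0 _ e] := eps_small_le 0 d0.
by exists n0 => n /eps_le le; have := h n; lra.
Qed.

Lemma Req_of x y : isR x -> isR y ->
  (forall d n0, 0 < d -> exists2 n, kval n0 <= kval n & `|x n - y n| <= d) -> Req x y.
Proof.
move=> hx hy h; apply/Req_le; split; apply: Rle_of => // d n0 d0;
  have [n le] := h d n0 d0; rewrite ler_norml => /andP[h1 h2]; exists n => //; lra.
Qed.

Lemma isR_cst q : isR (cst (M := M) q).
Proof. by move=> n i; rewrite subrr normr0 eps_gt0. Qed.

Lemma isR_Rsub x y : isR x -> isR y -> isR (Rsub x y).
Proof.
move=> hx hy n i; rewrite /Rsub [n + i + 1]addrAC.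
have := hx (n + 1) i; have := hy (n + 1) i; rewrite epsS !ltr_norml.
by move=> /andP[h1 h2] /andP[h3 h4]; apply/andP; split; lra.
Qed.

Lemma isR_Radd x y : isR x -> isR y -> isR (Radd x y).
Proof.
move=> hx hy n i; rewrite /Radd [n + i + 1]addrAC.
have := hx (n + 1) i; have := hy (n + 1) i; rewrite epsS !ltr_norml.
by move=> /andP[h1 h2] /andP[h3 h4]; apply/andP; split; lra.
Qed.

Lemma isR_Rdist x y : isR x -> isR y -> isR (Rdist x y).
Proof.
move=> hx hy n i; apply: le_lt_trans (isR_Rsub hx hy n i).
exact: ler_dist_dist.
Qed.

Lemma posR_ev x : posR x -> exists2 d, 0 < d &
  exists n0, forall n, kval n0 <= kval n -> d <= x n.
Proof.
move=> [hx /(Rlt_ev (isR_cst 0) hx) [d d0 [n0 h]]].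
by exists d => //; exists n0 => n /h; rewrite /cst add0r.
Qed.

(** Replaces the shifted sequences of [Rsub] and [Radd] by one eventual inequality with positive
    slack; later estimates handle canonical intervals only in this form. *)
Lemma in_canonP F (y : car M ty1) x : isR (rv y) -> isR (rv (sapp F y)) -> isR x ->
  in_canon F y x <-> exists2 d, 0 < d &
    exists n0, forall n, kval n0 <= kval n -> `|x n - rv y n| + d <= rv (sapp F y) n.
Proof.
set r := rv (sapp F y) => hy hr hx; split.
  case=> /(Rlt_ev (isR_Rsub hy hr) hx) [d1 d10 [n1 h1]] /(Rlt_ev hx (isR_Radd hy hr)) [d2 d20 [n2 h2]].
  (* The shift from n + 1 to n costs [2 * eps n], made smaller than d; a quarter of the gaps leaves
     ample room. *)
  pose d := Num.min d1 d2 / 4.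
  have d0 : 0 < d by rewrite divr_gt0 // ?lt_min ?d10 ?d20 //; lra.
  have dd1 : d *+ 4 <= d1 by rewrite /d -mulr_natr divfK ?ge_min ?lexx //; lra.
  have dd2 : d *+ 4 <= d2 by rewrite /d -mulr_natr divfK ?ge_min ?lexx ?orbT //; lra.
  have [n3 _ e3] := eps_small_le 0 d0.
  exists d => //; exists (n1 + n2 + n3) => n le.
  have l1 : kval n1 <= kval n by move: le; rewrite !kvalD; have := kval_ge0 n2; have := kval_ge0 n3; lra.
  have l2 : kval n2 <= kval n by move: le; rewrite !kvalD; have := kval_ge0 n1; have := kval_ge0 n3; lra.
  have l3 : eps n <= eps n3.
    by apply: eps_le; move: le; rewrite !kvalD; have := kval_ge0 n2; have := kval_ge0 n1; lra.
  have := h1 n l1; have := h2 n l2; rewrite /Rsub /Radd.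
  have := hy n 1; have := hr n 1; rewrite !ltr_norml => /andP[a1 a2] /andP[a3 a4] b1 b2.
  suff : `|x n - rv y n| <= r n - d by lra.
  by rewrite ler_norml; apply/andP; split; lra.
case=> d d0 [n0 h]; have [n3 _ e3] := eps_small_le 0 d0.
have bnd n : kval (n0 + n3) <= kval n -> eps n < d / 2 /\ `|x (n + 1) - rv y (n + 1)| + d <= r (n + 1).
  rewrite kvalD => le; split; last by apply: h; rewrite kvalD kval1; have := kval_ge0 n3; lra.
  have : eps n <= eps n3 by apply: eps_le; have := kval_ge0 n0; lra.
  lra.
split; apply: (@Rlt_of _ _ (d / 2) (n0 + n3)); try lra; move=> n /bnd [e]; rewrite /Rsub /Radd -/r.
  rewrite -lerBrDr ler_norml => /andP[a1 a2]; have := hx n 1; rewrite ltr_norml => /andP[a3 a4]; lra.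
rewrite -lerBrDr ler_norml => /andP[a1 a2]; have := hx n 1; rewrite ltr_norml => /andP[a3 a4]; lra.
Qed.

(** This is min(1, max(q, 0)), written with the truncation max(., 0) that [qplus] computes. *)
Definition unit_clamp q : K := 1 - Num.max (1 - Num.max q 0) 0.

Lemma unit_clampP q : [\/ q <= 0 /\ unit_clamp q = 0, 1 <= q /\ unit_clamp q = 1 |
  0 <= q <= 1 /\ unit_clamp q = q].
Proof.
rewrite /unit_clamp; case: (lerP q 0) => h.
  by constructor 1; split=> //; rewrite max_l; lra.
case: (lerP q 1) => h'.
  by constructor 3; split; [lra|rewrite max_l; lra].
by constructor 2; split; [lra|rewrite max_r; lra].
Qed.

Lemma unit_clamp_lip p q : `|unit_clamp p - unit_clamp q| <= `|p - q|.
Proof.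
have : - `|p - q| <= p - q <= `|p - q| by rewrite -ler_norml.
have := normr_ge0 (p - q); rewrite ler_norml => h /andP[h1 h2].
by case: (unit_clampP p) => -[a ->]; case: (unit_clampP q) => -[b ->]; apply/andP; split; lra.
Qed.

Definition unit_clamp_tm G : tm G (tarr ty0 ty0) :=
  lam (qsub $ q1 $ (qplus $ (qsub $ q1 $ (qplus $ var0))))%tm.

Lemma qval_clamp G (e : env (car M) G) c :
  qval (sapp (eval e (unit_clamp_tm G)) c) = unit_clamp (qval c).
Proof.
by rewrite /unit_clamp_tm eval_lam; ev; rewrite qval_qsub qval_qplus qval_qsub qval_qplus qval_q1.
Qed.

Definition rclamp : car M (tarr ty1 ty1) :=
  eval (@enil (car M)) (lam (lam (unit_clamp_tm _ $ (var1 $ var0))))%tm.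

Lemma rv_rclamp (x : car M ty1) : rv (sapp rclamp x) = fun n => unit_clamp (rv x n).
Proof.
apply: functional_extensionality => n; rewrite /rv /rclamp !eval_lam; ev.
exact: qval_clamp.
Qed.

Lemma isR_lip (f : K -> K) x : (forall p q, `|f p - f q| <= `|p - q|) -> isR x ->
  isR (fun n => f (x n)).
Proof. by move=> lip hx n i; apply: le_lt_trans (lip _ _) (hx n i). Qed.

Lemma Req_lip (f : K -> K) x y : (forall p q, `|f p - f q| <= `|p - q|) -> Req x y ->
  Req (fun n => f (x n)) (fun n => f (y n)).
Proof. by move=> lip xy n; apply: le_trans (lip _ _) (xy n). Qed.

Lemma unitI_clamp x : isR x -> unitI (fun n => unit_clamp (x n)).
Proof.
move=> hx; split; first exact: (isR_lip unit_clamp_lip).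
  by move=> n; rewrite /cst; have := eps_gt0 n; case: (unit_clampP (x n)) => -[h ->]; lra.
by move=> n; rewrite /cst; have := eps_gt0 n; case: (unit_clampP (x n)) => -[h ->]; lra.
Qed.

Lemma clamp_id x : unitI x -> Req (fun n => unit_clamp (x n)) x.
Proof.
move=> [_ h0 h1] n; have := h0 n; have := h1 n; have := eps_gt0 n; rewrite /cst ler_norml => *.
by case: (unit_clampP (x n)) => -[h ->]; apply/andP; split; lra.
Qed.

Lemma hbu_finite_cover F : hbu M -> pos_on (@unitI M) F -> finite_cover F.
Proof.
move=> H [pF eF].
have [F' hF'] : dfn (fun x : car M ty1 => sapp F (sapp rclamp x)).
  by apply: dfn_app; [apply: dfn_const|apply: dfn_sapp].
have cl (x : car M ty1) : isR (rv x) -> unitI (rv (sapp rclamp x)).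
  by move=> hx; rewrite rv_rclamp; apply: unitI_clamp.
have [|k [Y [hY cov]]] := H F'.
  split=> [x hx|x y hx hy xy]; rewrite !hF'; first by apply: pF; apply: cl.
  apply: eF; try exact: cl.
  by rewrite !rv_rclamp; apply: Req_lip xy => p q; apply: unit_clamp_lip.
exists k, Y; split=> // x Ix; have [i [ik cx]] := cov x Ix; exists i; split=> //.
have Iy := hY i ik; have [ry _ _] := Iy; have [rx _ _] := Ix.
have Icy := cl _ ry; have [rF _] := pF _ Iy; have [rF' _] := pF _ Icy.
move/(in_canonP ry _ rx): cx; rewrite hF' => /(_ rF') [d d0 [n0 h]].
apply/in_canonP => //; exists (d / 2); first by lra.
(* The point lies in [0,1], so clamping does not change it as a real; F respects this equality, and
   half of the slack d pays for the difference of the two sequences. *)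
have E : Req (rv (sapp F (sapp rclamp (sapp Y i)))) (rv (sapp F (sapp Y i))).
  by apply: eF => //; rewrite rv_rclamp; apply: clamp_id.
have [n1 h1] := @Req_ev _ _ (d / 2) E ltac:(lra).
exists (n0 + n1) => n le; have := h n (le_trans (kval_addl _ _) le).
by have := h1 n (le_trans (kval_addr _ _) le); rewrite ler_norml => /andP[]; lra.
Qed.

End RealTheory.
(** * A function of the Cantor type *)

Section CantorCount.
Variable M : model.
Local Notation K := (fraction M).
Implicit Types (a b c d i j k m n q : num M).

(** Division by recursion on the dividend: at i + 1 the quotient q grows by one iff (q + 1) b <= i +
    1, and the nested truncated subtractions give 1 or 0 accordingly. *)
Definition div_step G : tm [:: ty0, ty0, ty0, ty0 & G] ty0 :=
  (var0 + (1 -| ((var0 + 1) * var2 -| (var1 + 1))))%tm.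
Definition div_tm G : tm G (tarr ty0 (tarr ty0 ty0)) :=
  locked (lam (lam (crec $ lam (lam (div_step G)) $ 0 $ var1)))%tm.
(** Equals 1 if the binary digit of k at place 2i + 1 is 0, that is, if the i-th base-4 digit of k
    is 0 or 1, and 0 otherwise. *)
Definition bit_body G : tm [:: ty0, ty0 & G] ty0 :=
  (1 -| (div_tm _ $ var0 $ (cpow2 $ (var1 + var1 + 1)) -|
    (1 + 1) * (div_tm _ $ var0 $ (cpow2 $ (var1 + var1 + 1 + 1)))))%tm.
Definition bit_tm G : tm G (tarr ty0 (tarr ty0 ty0)) := locked (lam (lam (bit_body G))).
Definition good_step G : tm [:: ty0, ty0, ty0, ty0 & G] ty0 :=
  (var0 * (bit_tm _ $ var1 $ var2))%tm.
Definition good_tm G : tm G (tarr ty0 (tarr ty0 ty0)) :=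
  locked (lam (lam (crec $ lam (lam (good_step G)) $ 1 $ var1)))%tm.
Definition count_step G : tm [:: ty0, ty0, ty0, ty0 & G] ty0 :=
  (var0 + (good_tm _ $ tvar (vs (vs (vs vz))) $ var1))%tm.
Definition count_tm G : tm G (tarr ty0 (tarr ty0 ty0)) :=
  locked (lam (lam (crec $ lam (lam (count_step G)) $ 0 $ var0)))%tm.

Lemma eval_lam2 G (e : env (car M) G) r s t (b : tm (s :: r :: G) t) x y :
  sapp (sapp (eval e (lam (lam b))) x) y = eval (econs y (econs x e)) b.
Proof. by rewrite !eval_lam. Qed.

(** One step term gets evaluated in several environments; by extensionality only its values matter,
    so the recursions coincide. *)
Lemma rec_congr (f g : car M (tarr ty0 (tarr ty0 ty0))) (a n : car M ty0) :
  (forall i c : car M ty0, sapp (sapp f i) c = sapp (sapp g i) c) ->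
  sapp (sapp (sapp (srec M) f) a) n = sapp (sapp (sapp (srec M) g) a) n.
Proof.
move=> fg; suff -> : f = g by [].
by apply: (model_ext (mP M)) => i; apply: (model_ext (mP M)) => c.
Qed.

Definition ndiv a b : num M := sapp (sapp (eval (@enil (car M)) (div_tm _)) a) b.

Lemma eval_div_rec G (e : env (car M) G) a b : sapp (sapp (eval e (div_tm G)) a) b =
  sapp (sapp (sapp (srec M) (eval (econs b (econs a e)) (lam (lam (div_step G))))) (0 : num M)) a.
Proof. rewrite /div_tm -lock; exact: (eval_lam2 e (crec $ lam (lam (div_step G)) $ 0 $ var1)%tm a b). Qed.

Lemma eval_div G (e : env (car M) G) a b : sapp (sapp (eval e (div_tm G)) a) b = ndiv a b.
Proof.
rewrite /ndiv !eval_div_rec; apply: rec_congr => i c.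
by rewrite !eval_lam2 /div_step; ev; rewrite !eval_cmonus.
Qed.

Definition nbit i k : num M :=
  nsub 1 (nsub (ndiv k (npow (i + i + 1))) ((1 + 1) * ndiv k (npow (i + i + 1 + 1)))).

Lemma eval_bit G (e : env (car M) G) i k : sapp (sapp (eval e (bit_tm G)) i) k = nbit i k.
Proof.
rewrite /bit_tm -lock [LHS](eval_lam2 e (bit_body G) i k) /bit_body /nbit; ev.
by rewrite !eval_cmonus !eval_div !eval_cpow2.
Qed.

(* [good m k] is 1 if the last m base-4 digits of k are all 0 or 1, and 0
   otherwise; [count m k] is the number of j < k with [good m j = 1]. *)
Definition good m k : num M := sapp (sapp (eval (@enil (car M)) (good_tm _)) m) k.

Lemma eval_good_rec G (e : env (car M) G) m k : sapp (sapp (eval e (good_tm G)) m) k =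
  sapp (sapp (sapp (srec M) (eval (econs k (econs m e)) (lam (lam (good_step G))))) (1 : num M)) m.
Proof. rewrite /good_tm -lock; exact: (eval_lam2 e (crec $ lam (lam (good_step G)) $ 1 $ var1)%tm m k). Qed.

Lemma eval_good G (e : env (car M) G) m k : sapp (sapp (eval e (good_tm G)) m) k = good m k.
Proof.
rewrite /good !eval_good_rec; apply: rec_congr => i c.
by rewrite !eval_lam2 /good_step; ev; rewrite !eval_bit.
Qed.

Definition count m k : num M := sapp (sapp (eval (@enil (car M)) (count_tm _)) m) k.

Lemma eval_count_rec G (e : env (car M) G) m k : sapp (sapp (eval e (count_tm G)) m) k =
  sapp (sapp (sapp (srec M) (eval (econs k (econs m e)) (lam (lam (count_step G))))) (0 : num M)) k.
Proof. rewrite /count_tm -lock; exact: (eval_lam2 e (crec $ lam (lam (count_step G)) $ 0 $ var0)%tm m k). Qed.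

Lemma eval_count G (e : env (car M) G) m k : sapp (sapp (eval e (count_tm G)) m) k = count m k.
Proof.
rewrite /count !eval_count_rec; apply: rec_congr => i c.
by rewrite !eval_lam2 /count_step; ev; rewrite !eval_good.
Qed.

Lemma ndiv0 b : ndiv 0 b = 0.
Proof. by rewrite /ndiv eval_div_rec rec0. Qed.

Lemma ndivS a b : ndiv (a + 1) b = ndiv a b + nsub 1 (nsub ((ndiv a b + 1) * b) (a + 1)).
Proof.
have F : ndiv (a + 1) b = sapp (sapp (sapp (srec M)
    (eval (econs b (econs a (@enil (car M)))) (lam (lam (div_step nil))))) (0 : num M)) (a + 1 : num M).
  rewrite /ndiv eval_div_rec; apply: rec_congr => i c.
  by rewrite !eval_lam2 /div_step; ev.
by rewrite F recS -eval_div_rec eval_lam2 /div_step; ev; rewrite !eval_cmonus -!/(ndiv a b).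
Qed.

Lemma good0 k : good 0 k = 1.
Proof. by rewrite /good eval_good_rec rec0. Qed.

Lemma goodS m k : good (m + 1) k = good m k * nbit m k.
Proof.
have F : good (m + 1) k = sapp (sapp (sapp (srec M)
    (eval (econs k (econs m (@enil (car M)))) (lam (lam (good_step nil))))) (1 : num M)) (m + 1 : num M).
  rewrite /good eval_good_rec; apply: rec_congr => i c.
  by rewrite !eval_lam2 /good_step; ev; rewrite !eval_bit.
by rewrite F recS -eval_good_rec eval_lam2 /good_step; ev; rewrite eval_bit.
Qed.

Lemma count0 m : count m 0 = 0.
Proof. by rewrite /count eval_count_rec rec0. Qed.

Lemma countS m k : count m (k + 1) = count m k + good m k.
Proof.
have F : count m (k + 1) = sapp (sapp (sapp (srec M)
    (eval (econs k (econs m (@enil (car M)))) (lam (lam (count_step nil))))) (0 : num M)) (k + 1 : num M).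
  rewrite /count eval_count_rec; apply: rec_congr => i c.
  by rewrite !eval_lam2 /count_step; ev; rewrite !eval_good.
by rewrite F recS -eval_count_rec eval_lam2 /count_step; ev; rewrite eval_good.
Qed.

Lemma count_dfn s (m : num M) (f : car M s -> num M) : dfn (t := ty0) f ->
  dfn (t := ty0) (fun k : car M s => count m (f k)).
Proof. by move=> df; apply: dfn_app => //; apply: dfn_const. Qed.
Lemma good_dfnl s (k : num M) (f : car M s -> num M) : dfn (t := ty0) f ->
  dfn (t := ty0) (fun m : car M s => good (f m) k).
Proof. by move=> df; do 2 (apply: dfn_app => //; try exact: dfn_const). Qed.
Lemma count_dfnl s (g f : car M s -> num M) : dfn (t := ty0) f -> dfn (t := ty0) g ->
  dfn (t := ty0) (fun m : car M s => count (f m) (g m)).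
Proof. by move=> df dg; do 2 (apply: dfn_app => //; try exact: dfn_const). Qed.
Lemma ndiv_dfn s (f : car M s -> num M) b : dfn (t := ty0) f ->
  dfn (t := ty0) (fun k : car M s => ndiv (f k) b).
Proof. by move=> df; do 2 (apply: dfn_app => //; try exact: dfn_const). Qed.

Lemma nsub_le_kval a b : kval (nsub a b) <= kval a.
Proof.
have := kval_ge0 a; have := kval_ge0 b.
case: (lerP (kval b) (kval a)) => [/nsub_le ->|/ltW/nsub_ge ->]; rewrite ?kval0; lra.
Qed.

Lemma ndiv_spec a b : 0 < kval b -> kval (ndiv a b * b) <= kval a /\
  kval a < kval ((ndiv a b + 1) * b).
Proof.
move=> b0; move: a; apply: num_ind => [||a].
- by apply: qf_and; [apply: qf_kle|apply: qf_klt]; dfn; do ?apply: num_dfn_mul;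
    do ?apply: num_dfn_add; do ?apply: ndiv_dfn; dfn.
- by rewrite ndiv0 mul0r kval0 add0r mul1r.
rewrite ndivS => -[h1 h2].
case: (lerP (kval ((ndiv a b + 1) * b)) (kval (a + 1))) => h.
  rewrite (nsub_ge h) nsub0; split=> //.
  have b1 : 1 <= kval b by rewrite -[1]add0r -(kval0 M); apply: kval_ltS; rewrite kval0.
  by have := kval_ltS h2; rewrite !(kvalD, kvalM, kval1); lra.
have h3 : nsub 1 (nsub ((ndiv a b + 1) * b) (a + 1)) = 0.
  by apply: nsub_ge; rewrite nsub_le; [have := kval_ltS h; rewrite kval1; lra|exact: ltW].
by rewrite h3 addr0; split=> //; rewrite kvalD kval1; lra.
Qed.

Lemma ndiv_uniq a b q : kval (q * b) <= kval a -> kval a < kval ((q + 1) * b) -> ndiv a b = q.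
Proof.
rewrite !kvalM kvalD kval1 => h1 h2.
have b0 : 0 < kval b by have := kval_ge0 b; nra.
have [] := ndiv_spec a b0; rewrite !kvalM kvalD kval1 => h3 h4.
have S x y : kval x < kval y -> (kval x + 1) * kval b <= kval y * kval b.
  by move=> /kval_ltS h; rewrite ler_pM2r.
apply: kval_inj; apply/eqP; rewrite eq_le; apply/andP; split; rewrite leNgt; apply/negP => /S; lra.
Qed.

Definition quad k : num M := k + k + (k + k).

Lemma ndiv_quad q c d : 0 < kval c -> kval d < kval (quad 1) ->
  ndiv (quad q + d) (quad c) = ndiv q c.
Proof.
move=> c0 hd; have [h1 h2] := ndiv_spec q c0.
move: hd (kval_ltS h2) h1; rewrite /quad; set u := ndiv q c.
rewrite !(kvalM, kvalD, kval1) => hd h3 h1; have := kval_ge0 d => d0.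
apply: ndiv_uniq; rewrite !(kvalM, kvalD, kval1); nra.
Qed.

Lemma nbitS i q d : kval d < kval (quad 1) -> nbit (i + 1) (quad q + d) = nbit i q.
Proof.
move=> hd; rewrite /nbit.
have -> : i + 1 + (i + 1) + 1 = i + i + 1 + 1 + 1 by ring.
have E a : npow (a + 1 + 1) = quad (npow a) by rewrite !npowS.
by rewrite (E (i + i + 1)) (E (i + i + 1 + 1)) !ndiv_quad ?npow_gt0.
Qed.

Lemma nbit0 q d : kval d < kval (quad 1) ->
  nbit 0 (quad q + d) = if kval d < kval (1 + 1 : num M) then 1 else 0.
Proof.
move=> hd; have p1 : npow 1 = 1 + 1 :> num M by rewrite -[X in npow X]add0r npowS npow0.
have p2 : npow (1 + 1) = quad 1 by rewrite npowS p1.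
rewrite /nbit addr0 add0r p2 p1.
have := kval_ge0 d => d0; have := kval_ge0 q => q0.
have E4 : ndiv (quad q + d) (quad 1) = q.
  by apply: ndiv_uniq; move: hd; rewrite /quad !(kvalM, kvalD, kval1); lra.
case: ifP => h1.
  rewrite E4 (@ndiv_uniq _ _ (q + q)).
  - by rewrite (_ : nsub (q + q) _ = 0) ?nsub0 // nsub_ge // mulrDl mul1r.
  - by rewrite /quad !(kvalM, kvalD, kval1); lra.
  - by move: h1; rewrite /quad !(kvalM, kvalD, kval1); lra.
rewrite E4 (@ndiv_uniq _ _ (q + q + 1)).
- have -> : q + q + 1 = 1 + (1 + 1) * q by ring.
  by rewrite nsub_addr nsub_ge.
- by move/negbT: h1; rewrite -leNgt /quad !(kvalM, kvalD, kval1); lra.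
- by move: hd; rewrite /quad !(kvalM, kvalD, kval1); lra.
Qed.

(** The last m + 1 digits of 4q + d are the last m digits of q followed by d. Recursion in [good]
    tests digits from the lowest up, so removing the lowest one takes an induction on m. *)
Lemma good_quad m q d : kval d < kval (quad 1) ->
  good (m + 1) (quad q + d) = nbit 0 (quad q + d) * good m q.
Proof.
move=> hd; move: m; apply: num_ind => [||m IH].
- apply: qf_eq; last apply: num_dfn_mul; try exact: dfn_const; apply: good_dfnl; dfn.
- by rewrite goodS !good0 mul1r mulr1.
- by rewrite goodS IH goodS nbitS // mulrA.
Qed.

(** Self-similarity: of the four numbers 4k, ..., 4k + 3 exactly the first two inherit goodness from
    k. This makes the step functions of different levels fit together. *)
Lemma count_quad m k : count (m + 1) (quad k) = count m k + count m k.
Proof.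
move: k; apply: num_ind => [||k IH].
- by apply: qf_eq; rewrite /quad; do ?apply: num_dfn_add; apply: count_dfn; dfn.
- by rewrite /quad !addr0 !count0 addr0.
have -> : quad (k + 1) = quad k + 0 + 1 + 1 + 1 + 1 by rewrite /quad; ring.
have e2 : quad k + 0 + 1 + 1 = quad k + (1 + 1) by ring.
have e3 : quad k + 0 + 1 + 1 + 1 = quad k + (1 + 1 + 1) by ring.
have e1 : quad k + 0 + 1 = quad k + 1 by ring.
have lt0 : kval (0 : num M) < kval (1 + 1 : num M) by rewrite !(kvalD, kval1, kval0); lra.
have lt1 : kval (1 : num M) < kval (1 + 1 : num M) by rewrite !(kvalD, kval1, kval0); lra.
have l0 : kval (0 : num M) < kval (quad 1) by rewrite /quad !(kvalD, kval1, kval0); lra.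
have l1 : kval (1 : num M) < kval (quad 1) by rewrite /quad !(kvalD, kval1); lra.
have l2 : kval (1 + 1 : num M) < kval (quad 1) by rewrite /quad !(kvalD, kval1); lra.
have l3 : kval (1 + 1 + 1 : num M) < kval (quad 1) by rewrite /quad !(kvalD, kval1); lra.
have n3 : kval (1 + 1 + 1 : num M) < kval (1 + 1 : num M) = false.
  by apply/negbTE; rewrite -leNgt !(kvalD, kval1); lra.
have g0 : good (m + 1) (quad k) = good m k.
  by rewrite -[quad k]addr0 good_quad // nbit0 // lt0 mul1r.
have g1 : good (m + 1) (quad k + 1) = good m k by rewrite good_quad // nbit0 // lt1 mul1r.
have g2 : good (m + 1) (quad k + (1 + 1)) = 0 by rewrite good_quad // nbit0 // ltxx mul0r.
have g3 : good (m + 1) (quad k + (1 + 1 + 1)) = 0 by rewrite good_quad // nbit0 // n3 mul0r.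
by rewrite 4!countS e3 e2 e1 addr0 g0 g1 g2 g3 IH countS; ring.
Qed.

Lemma count_zero k : count 0 k = k.
Proof.
move: k; apply: num_ind => [||k IH]; last by rewrite countS IH good0.
  by apply: qf_eq; [apply: count_dfn|]; dfn.
exact: count0.
Qed.

(** Iterated self-similarity. For m = 0 and k = 1 it says that 2^i of the numbers below 4^i are
    counted. *)
Lemma count_pow m i k : count (m + i) (npow (i + i) * k) = npow i * count m k.
Proof.
move: i; apply: num_ind => [||i IH].
- apply: qf_eq; last by apply: num_dfn_mul; [apply: npow_dfn|]; dfn.
  by apply: count_dfnl; [|apply: num_dfn_mul; [apply: npow_dfn|]]; dfn.
- by rewrite !addr0 npow0 !mul1r.
have -> : i + 1 + (i + 1) = i + i + 1 + 1 by ring.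
have -> : npow (i + i + 1 + 1) * k = quad (npow (i + i) * k) by rewrite !npowS /quad; ring.
by rewrite addrA count_quad IH npowS; ring.
Qed.

Lemma good_le1 m k : kval (good m k) <= 1.
Proof.
rewrite -(kval1 M); move: m; apply: num_ind => [||m].
- by apply: qf_kle; [apply: good_dfnl|]; dfn.
- by rewrite good0.
rewrite goodS kvalM => h; have := nsub_le_kval 1 (nsub (ndiv k (npow (m + m + 1)))
  ((1 + 1) * ndiv k (npow (m + m + 1 + 1)))).
rewrite -/(nbit m k) kval1; move: h; rewrite kval1.
by have := kval_ge0 (nbit m k); have := kval_ge0 (good m k); nra.
Qed.

Lemma count_mono m k l : kval k <= kval l -> kval (count m k) <= kval (count m l) /\
  kval (count m l) <= kval (count m k) + (kval l - kval k).
Proof.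
move=> /kval_leP[d ->]; have -> : kval (count m k) + (kval (k + d) - kval k) = kval (count m k + d).
  by rewrite !kvalD; ring.
move: d; apply: num_ind => [||d [h1 h2]].
- by apply: qf_and; apply: qf_kle; dfn; do ?apply: num_dfn_add; do ?apply: count_dfn; dfn.
- by rewrite !addr0 lexx.
rewrite addrA countS; have := good_le1 m (k + d); have := kval_ge0 (good m (k + d)).
by move: h2; rewrite !(kvalD, kval1); split; lra.
Qed.

End CantorCount.

(** * The step functions of all levels *)

Section CantorFunction.
Variable M : model.
Local Notation K := (fraction M).
Implicit Types (a b c i j k l m n : num M) (p q v w : K).

Lemma eps_npow n : eps n * kval (npow n) = 1.
Proof. by rewrite mulVf // gt_eqF // npow_gt0. Qed.

Definition is_floor m q k : Prop :=
  kval k <= kval (npow m) ^+ 2 * q /\ kval (npow m) ^+ 2 * q < kval k + 1.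

(* The graph of the step function of level [m]; the intervals on which it grows
   make up a fraction 2^-m of [0,1], and its jumps are of size 2^-m. *)
Definition gam m q v : Prop := exists2 k, is_floor m q k & v = eps m * kval (count m k).

Lemma code_of q : exists c, qval c = q.
Proof. by have [a [b [d ->]]] := fraction_kval q; exists (nmk a b d); rewrite qval_mk. Qed.

Lemma floor_code m c : 0 <= qval c ->
  is_floor m (qval c) (ndiv (npow (m + m) * nsub (nfst c) (nfst (nsnd c))) (nsnd (nsnd c) + 1)).
Proof.
rewrite /qval => h; have d0 := qden_gt0 c.
set D := kval (nsnd (nsnd c)) + 1 in h d0 *.
have {}h : kval (nfst (nsnd c)) <= kval (nfst c) by move: h; rewrite pmulr_lge0 ?invr_gt0 // subr_ge0.
have b0 : 0 < kval (nsnd (nsnd c) + 1) by rewrite kvalD kval1.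
have [] := ndiv_spec (npow (m + m) * nsub (nfst c) (nfst (nsnd c))) b0.
rewrite /is_floor; set k := ndiv _ _; rewrite npowD !kvalM nsub_le // !kvalD kval1 -/D.
set s := kval _ - kval _; rewrite -expr2 mulrA => h1 h2.
by rewrite ler_pdivlMr // ltr_pdivrMr.
Qed.

Lemma gam_ex m q : 0 <= q -> exists v, gam m q v.
Proof.
have [c <-] := code_of q => /(floor_code m) h.
by eexists; eexists; first exact: h.
Qed.

Lemma gam_ge0 m q v : gam m q v -> 0 <= v.
Proof. by case=> k _ ->; rewrite mulr_ge0 ?kval_ge0 // ltW // eps_gt0. Qed.

Lemma kval_leS k l : kval k < kval l + 1 -> kval k <= kval l.
Proof.
by move=> h; rewrite leNgt; apply/negP => /kval_ltS; lra.
Qed.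

Lemma gam_mono m p q v w : gam m p v -> gam m q w -> p <= q -> v <= w.
Proof.
move=> [k [k1 k2] ->] [l [l1 l2] ->] pq; rewrite ler_pM2l ?eps_gt0 //.
apply: (count_mono m _).1; apply: kval_leS.
have : kval (npow m) ^+ 2 * p <= kval (npow m) ^+ 2 * q.
  by rewrite ler_pM2l // exprn_gt0 // npow_gt0.
lra.
Qed.

(** With e = 2^-m and P = 2^m: the count grows by at most the number of indices passed, hence by at
    most P^2 (q - p) + 1, and e P = 1 turns e times this into (q - p) P + e. *)
Lemma gam_lip_aux (F : realFieldType) (P e k l p q ck cl : F) : e * P = 1 -> 0 < e ->
  cl <= ck + (l - k) -> l <= P ^+ 2 * q -> P ^+ 2 * p < k + 1 ->
  e * cl <= e * ck + ((q - p) * P + e).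
Proof.
move=> eP e0 h1 h2 h3.
have h4 : e * (cl - ck) <= e * (P ^+ 2 * (q - p) + 1) by rewrite ler_pM2l //; lra.
have h5 : e * (P ^+ 2 * (q - p) + 1) = e * P * (q - p) * P + e by ring.
by move: h4; rewrite h5 eP mul1r; lra.
Qed.

Lemma gam_lip_le m p q v w : gam m p v -> gam m q w -> p <= q ->
  w <= v + ((q - p) * kval (npow m) + eps m).
Proof.
move=> gp gq pq; have [k [k1 k2] ev] := gp; have [l [l1 l2] ew] := gq.
case: (lerP (kval k) (kval l)) => [kl|/ltW lk].
  rewrite ev ew; apply: (gam_lip_aux (eps_npow m) (eps_gt0 m) _ l1 k2).
  exact: (count_mono m kl).2.
have h : kval (count m l) <= kval (count m k) := (count_mono m lk).1.
have : w <= v by rewrite ev ew ler_pM2l ?eps_gt0.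
have : 0 <= (q - p) * kval (npow m) by rewrite mulr_ge0 ?kval_ge0 // subr_ge0.
by have := eps_gt0 m; lra.
Qed.

Lemma gam_lip m p q v w : gam m p v -> gam m q w ->
  `|v - w| <= `|p - q| * kval (npow m) + eps m.
Proof.
wlog pq : p q v w / p <= q => [H gp gq|gp gq].
  case/orP: (le_total p q) => pq; first exact: H.
  by rewrite (distrC v) (distrC p); apply: H.
have := gam_lip_le gp gq pq; have := gam_mono gp gq pq => h1 h2.
have -> : `|p - q| = q - p by rewrite distrC ger0_norm // subr_ge0.
have -> : `|v - w| = w - v by rewrite distrC ger0_norm // subr_ge0.
lra.
Qed.

(** By [count_pow] the value at a / 4^m is the same on level m as on level m + i; monotonicity of
    the finer step function then traps its value at q. *)
Lemma floor_refine m i q a b l : is_floor (m + i) q l ->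
  kval a <= kval (npow m) ^+ 2 * q -> kval (npow m) ^+ 2 * q <= kval b ->
  eps m * kval (count m a) <= eps (m + i) * kval (count (m + i) l) /\
  eps (m + i) * kval (count (m + i) l) <= eps m * kval (count m b).
Proof.
rewrite /is_floor npowD kvalM => -[l1 l2] ha hb.
set Q := kval (npow i) in l1 l2; set P := kval (npow m) in l1 l2 ha hb.
have Q2 : 0 < Q ^+ 2 by rewrite exprn_gt0 // npow_gt0.
have E x : eps m * kval (count m x) = eps (m + i) * kval (count (m + i) (npow (i + i) * x)).
  by rewrite count_pow kvalM epsD -(mulrA (eps m)) (mulrA (eps i)) eps_npow mul1r.
have K2 x : kval (npow (i + i) * x) = Q ^+ 2 * kval x by rewrite npowD !kvalM expr2.
have e : (P * Q) ^+ 2 * q = Q ^+ 2 * (P ^+ 2 * q) by rewrite exprMn -mulrA mulrCA.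
rewrite e in l1 l2; rewrite !E; split; rewrite ler_pM2l ?eps_gt0 //.
  apply: (count_mono _ _).1; apply: kval_leS; rewrite K2; apply: le_lt_trans l2.
  by rewrite ler_pM2l.
apply: (count_mono _ _).1; rewrite K2; apply: le_trans l1 _.
by rewrite ler_pM2l.
Qed.

(** Take a = k and b = k + 1 in [floor_refine]: one step raises the count by at most 1. This gives
    the rate of convergence of the levels. *)
Lemma gam_level m i q v w : gam m q v -> gam (m + i) q w -> v <= w <= v + eps m.
Proof.
move=> [k [k1 k2] ->] [l hl ->].
have k2' : kval (npow m) ^+ 2 * q <= kval (k + 1) by rewrite kvalD kval1 ltW.
have [-> h] /= := floor_refine hl k1 k2'; apply: le_trans h _.
rewrite countS kvalD mulrDr lerD2l -[leRHS]mulr1 ler_pM2l ?eps_gt0 //.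
exact: good_le1.
Qed.

(** A plateau of level m stays a plateau, with the same value, on all finer levels; hence the limit
    is constant there. *)
Lemma gam_const m i q a b w : gam (m + i) q w -> count m a = count m b ->
  kval a <= kval (npow m) ^+ 2 * q -> kval (npow m) ^+ 2 * q <= kval b ->
  w = eps m * kval (count m a).
Proof.
move=> [l hl ->] e ha hb; have [h1] := floor_refine hl ha hb; rewrite -e => h2.
by apply/eqP; rewrite eq_le h1 h2.
Qed.

Lemma gam_one m v : gam m 1 v -> v = 1.
Proof.
move=> h; have P0 := npow_gt0 m.
have e : kval (npow (m + m)) = kval (npow m) ^+ 2 by rewrite npowD kvalM expr2.
rewrite -[m in gam m]addr0 in h.
have -> := gam_const (a := npow (m + m)) (b := npow (m + m)) h erefl.
- by have := count_pow 0 m 1; rewrite add0r !mulr1 count_zero mulr1 => ->; exact: eps_npow.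
- by rewrite e mulr1.
- by rewrite e mulr1.
Qed.

(** A discrete intermediate value theorem: the count climbs from 0 to 2^m in steps of at most 1. *)
Lemma count_onto m n : kval n <= kval (npow m) ->
  exists2 k, kval k <= kval (npow (m + m)) & count m k = n.
Proof.
move=> hn; apply: NNPP => nex.
have n0 : n != 0.
  by apply/eqP => n0; apply: nex; exists 0; rewrite ?count0 // kval0 kval_ge0.
(* Were n never attained, the count could never get past n; unlike the existence of k, this is
   quantifier-free. *)
have H : forall k, kval k <= kval (npow (m + m)) -> kval (count m k) < kval n.
  apply: num_ind => [||k IH].
  - by apply: qf_imp; [apply: qf_kle|apply: qf_klt; [apply: count_dfn|]]; dfn.
  - rewrite count0 kval0 => _; rewrite lt_neqAle kval_ge0 andbT eq_sym.
    by apply: contraNneq n0 => e; apply/eqP/kval_inj; rewrite kval0.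
  move=> kS; have k1 : kval k <= kval (npow (m + m)).
    by apply: le_trans kS; apply: kval_addl.
  have lt := IH k1; rewrite lt_neqAle; apply/andP; split.
    by apply/eqP => /kval_inj e; apply: nex; exists (k + 1).
  have := kval_ltS lt; have := good_le1 m k; rewrite countS kvalD; lra.
have := H (npow (m + m)) (lexx _).
by have := count_pow 0 m 1; rewrite add0r !mulr1 count_zero mulr1 => ->; lra.
Qed.

End CantorFunction.

(** * The limit function on reals and the radius function *)

Section CantorReal.
Variable M : model.
Local Notation K := (fraction M).
Implicit Types (a b c i j k l m n : num M) (p q : K) (x y : num M -> K).

(** The n-th approximation of g x applies level n + 2 to the clamped approximation of x with index
    2n + 5: an error 2^-(2n+5), stretched by 2^(n+2), is 2^-n / 8. *)
Definition five : num M := 1 + 1 + 1 + 1 + 1.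

Lemma unit_clamp_ge0 q : 0 <= unit_clamp q.
Proof. by case: (unit_clampP q) => -[h ->]; lra. Qed.
Lemma unit_clamp_le1 q : unit_clamp q <= 1.
Proof. by case: (unit_clampP q) => -[h ->]; lra. Qed.

Definition clamp_at G : tm [:: ty0, ty1 & G] ty0 :=
  (unit_clamp_tm _ $ (var1 $ (var0 + var0 + (1 + 1 + 1 + 1 + 1))))%tm.
Definition cantor_body G : tm [:: ty0, ty1 & G] ty0 :=
  qmk (count_tm _ $ (var0 + 1 + 1) $ (div_tm _ $
    ((cpow2 $ (var0 + 1 + 1 + (var0 + 1 + 1))) * (qpos (clamp_at G) -| qneg (clamp_at G))) $
    qden (clamp_at G)))%tm 0%tm (cpow2 $ (var0 + 1 + 1) -| 1)%tm.
Definition cantor : car M (tarr ty1 ty1) := eval (@enil (car M)) (lam (lam (cantor_body _))).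

Lemma qval_mk_eps k m : qval (nmk k 0 (nsub (npow m) 1)) = kval k * eps m.
Proof.
rewrite qval_mk kval0 subr0 nsub_le; first by rewrite kval1 subrK.
by rewrite kval1; have := npow_gt m; have := kval_ge0 m; lra.
Qed.

Lemma eval_count_tm G (e : env (car M) G) (s t : tm G ty0) :
  eval e (count_tm _ $ s $ t)%tm = count (eval e s) (eval e t).
Proof. exact: eval_count. Qed.
Lemma eval_good_tm G (e : env (car M) G) (s t : tm G ty0) :
  eval e (good_tm _ $ s $ t)%tm = good (eval e s) (eval e t).
Proof. exact: eval_good. Qed.
Lemma eval_div_tm G (e : env (car M) G) (s t : tm G ty0) :
  eval e (div_tm _ $ s $ t)%tm = ndiv (eval e s) (eval e t).
Proof. exact: eval_div. Qed.
Lemma eval_pow_tm G (e : env (car M) G) (t : tm G ty0) : eval e (cpow2 $ t)%tm = npow (eval e t).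
Proof. exact: (eval_cpow2 e). Qed.

Lemma cantor_spec (x : car M ty1) n :
  gam (n + 1 + 1) (unit_clamp (rv x (n + n + five))) (rv (sapp cantor x) n).
Proof.
pose e := econs (n : car M ty0) (econs x (@enil (car M))).
have qc : qval (eval e (clamp_at nil)) = unit_clamp (rv x (n + n + five)).
  by rewrite /clamp_at; ev; rewrite qval_clamp.
have h := unit_clamp_ge0 (rv x (n + n + five)).
rewrite -qc in h *; have hf := floor_code (n + 1 + 1) h.
eexists; first exact: hf.
rewrite /rv /cantor (eval_lam2 (@enil (car M)) (cantor_body nil)) -/e /cantor_body !evq.
by rewrite eval_pow_tm qval_mk_eps mulrC eval_count_tm eval_div_tm !evq eval_pow_tm !evq.
Qed.

Definition is_cantor x y : Prop :=
  forall n, gam (n + 1 + 1) (unit_clamp (x (n + n + five))) (y n).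

Lemma eps_five n : eps (n + n + five) = eps n ^+ 2 / 32.
Proof. by rewrite !epsD eps1 expr2; lra. Qed.
Lemma eps_two n : eps (n + 1 + 1) = eps n / 4.
Proof. by rewrite !epsS; lra. Qed.
Lemma npow_two n : kval (npow (n + 1 + 1)) = 4 * kval (npow n).
Proof. by rewrite !npowS !kvalD; lra. Qed.

Lemma scale_le (F : realFieldType) (E P d c : F) : E * P = 1 -> 0 < P ->
  d <= c * E ^+ 2 -> d * P <= c * E.
Proof.
move=> h P0 hd; have -> : c * E = c * E ^+ 2 * P by rewrite expr2 -!mulrA h mulr1.
by rewrite ler_pM2r.
Qed.

Lemma clamp_near x n m : isR x -> kval n <= kval m ->
  `|unit_clamp (x n) - unit_clamp (x m)| < eps n.
Proof. by move=> hx le; apply: le_lt_trans (unit_clamp_lip _ _) (isR_near hx le). Qed.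

(** The errors are 1/8 of [eps n] from the argument, 1/4 from the size of a step and 1/4 from the
    change of level: together 5/8 of [eps n]. *)
Lemma isR_cantor x y : isR x -> is_cantor x y -> isR y.
Proof.
move=> hx h n i; have := h n; have := h (n + i).
have -> : n + i + 1 + 1 = n + 1 + 1 + i by ring.
have -> : n + i + (n + i) + five = n + n + five + (i + i) by ring.
have := clamp_near hx (kval_addl (n + n + five) (i + i)).
rewrite eps_five; have := unit_clamp_ge0 (x (n + n + five + (i + i))).
move: (unit_clamp (x (n + n + five))) (unit_clamp (x (n + n + five + (i + i)))).
move=> p p' /(gam_ex (n + 1 + 1)) [u gu] near g2 g1.
have /andP[l1 l2] := gam_level gu g2; have := gam_lip g1 gu.
have : `|p - p'| <= 1 / 32 * eps n ^+ 2 by lra.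
move/(scale_le (eps_npow n) (npow_gt0 n)).
rewrite npow_two eps_two in l1 l2 *; have := eps_gt0 n.
set d := `|p - p'|; move=> e0 hd; rewrite ler_norml => /andP[a1 a2].
by rewrite ltr_norml; apply/andP; split; nra.
Qed.

Lemma Req_cantor x x' y y' : is_cantor x y -> is_cantor x' y' -> Req x x' -> Req y y'.
Proof.
move=> h h' xx n; have := gam_lip (h n) (h' n).
have := xx (n + n + five); have := unit_clamp_lip (x (n + n + five)) (x' (n + n + five)).
rewrite eps_five; move: `|unit_clamp _ - _| `|x _ - _| `|y n - y' n| => d e f h1 h2.
have : d <= 1 / 16 * eps n ^+ 2 by lra.
move/(scale_le (eps_npow n) (npow_gt0 n)); rewrite npow_two eps_two.
by have := eps_gt0 n; lra.
Qed.

(** Both values are compared with those of level n, at the cost of one [eps n]; the Lipschitz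
    estimate of that level costs another. Choosing n according to |x - x'| gives exponent 1/2. *)
Lemma cantor_modulus x x' y y' n m : is_cantor x y -> is_cantor x' y' -> kval n <= kval m ->
  `|y m - y' m| <= `|x (m + m + five) - x' (m + m + five)| * kval (npow n) + 2 * eps n.
Proof.
move=> h h' /kval_leP[i ->].
have := h (n + i); have := h' (n + i); have -> : n + i + 1 + 1 = n + (i + 1 + 1) by ring.
set N := n + i + (n + i) + five => g2 g1.
have [u gu] := gam_ex n (unit_clamp_ge0 (x N)); have [v gv] := gam_ex n (unit_clamp_ge0 (x' N)).
have /andP[a1 a2] := gam_level gu g1; have /andP[b1 b2] := gam_level gv g2.
have := gam_lip gu gv.
have : `|unit_clamp (x N) - unit_clamp (x' N)| * kval (npow n) <= `|x N - x' N| * kval (npow n).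
  by rewrite ler_pM2r ?npow_gt0 // unit_clamp_lip.
move: (`|unit_clamp _ - _| * _) (`|x N - _| * _) => d d' hd.
rewrite !ler_norml => /andP[c1 c2]; apply/andP; split; lra.
Qed.

Lemma cantor_unit x y : isR x -> is_cantor x y -> unitI y.
Proof.
move=> hx h; split; first exact: isR_cantor h.
  by move=> n; rewrite /cst; have := gam_ge0 (h n); have := eps_gt0 n; lra.
move=> n; rewrite /cst; have [v gv] := gam_ex (n + 1 + 1) (ler01 : 0 <= 1 :> K).
have := gam_mono (h n) gv (unit_clamp_le1 _); rewrite (gam_one gv).
by have := eps_gt0 n; lra.
Qed.

Lemma cantor_const x y n m a b : is_cantor x y -> kval n <= kval m ->
  count n a = count n b -> 
  kval a <= kval (npow n) ^+ 2 * unit_clamp (x (m + m + five)) ->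
  kval (npow n) ^+ 2 * unit_clamp (x (m + m + five)) <= kval b ->
  y m = eps n * kval (count n a).
Proof.
move=> h /kval_leP[i ->]; have := h (n + i).
have -> : n + i + 1 + 1 = n + (i + 1 + 1) by ring.
exact: gam_const.
Qed.

Lemma is_cantor_rv (x : car M ty1) : is_cantor (rv x) (rv (sapp cantor x)).
Proof. by move=> n; apply: cantor_spec. Qed.

(** Squaring (a - b) / d gives positive part a^2 + b^2, negative part 2ab and denominator d^2; the
    fourth power of four is 256, and the denominator is stored minus one. *)
Definition modulus_body G : tm [:: ty0, ty1 & G] ty0 :=
  let c := (unit_clamp_tm _ $ (var1 $ var0))%tm in
  let four := ((1 + 1) * (1 + 1))%tm in
  qmk (qpos c * qpos c + qneg c * qneg c)%tm (qpos c * qneg c + qpos c * qneg c)%tm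
    (qden c * qden c * (four * four * (four * four)) -| 1)%tm.
Definition rmodulus : car M (tarr ty1 ty1) := eval (@enil (car M)) (lam (lam (modulus_body _))).

(* Chosen so that [|x - y| < modulus r] forces the values of the Cantor-like
   function, which is Hoelder continuous of exponent 1/2, to be within r / 2. *)
Definition modulus q : K := unit_clamp q ^+ 2 / 256.

Lemma modulus_frac (F : realFieldType) (a b d : F) : 1 <= d ->
  (a * a + b * b - (a * b + a * b)) /
    (d * d * ((1 + 1) * (1 + 1) * ((1 + 1) * (1 + 1)) * ((1 + 1) * (1 + 1) * ((1 + 1) * (1 + 1)))) - 1 + 1)
  = ((a - b) / d) ^+ 2 / 256.
Proof.
move=> d1; have d0 : d != 0 by rewrite gt_eqF //; lra.
by rewrite subrK; field.
Qed.

Lemma rv_rmodulus (x : car M ty1) : rv (sapp rmodulus x) = fun n => modulus (rv x n).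
Proof.
apply: functional_extensionality => n.
pose e := econs (n : car M ty0) (econs x (@enil (car M))).
rewrite /rv /rmodulus (eval_lam2 (@enil (car M)) (modulus_body nil)) -/e /modulus_body.
have : qval (eval e (unit_clamp_tm _ $ (var1 $ var0))%tm) = unit_clamp (qval (sapp x n)).
  by ev; rewrite qval_clamp.
rewrite !evq; move: (eval e (unit_clamp_tm _ $ (var1 $ var0))%tm) => c.
rewrite /modulus => <-; rewrite qval_mk /qval.
have d1 : 1 <= kval (nsnd (nsnd c)) + 1 by have := kval_ge0 (nsnd (nsnd c)); lra.
rewrite -modulus_frac // nsub_le; first by rewrite !(kvalD, kvalM, kval1).
by rewrite !(kvalD, kvalM, kval1); nra.
Qed.

Lemma modulus_lip_aux (F : realFieldType) (c d : F) : 0 <= c -> c <= 1 -> 0 <= d -> d <= 1 ->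
  `|c ^+ 2 / 256 - d ^+ 2 / 256| <= `|c - d|.
Proof.
move=> c0 c1 d0 d1; have -> : c ^+ 2 / 256 - d ^+ 2 / 256 = (c - d) * ((c + d) / 256) by field.
rewrite normrM ler_piMr // ger0_norm; lra.
Qed.

(** Since c^2 - d^2 = (c - d)(c + d), clamping to [0,1] makes the map 1-Lipschitz. It can then be
    applied termwise without spoiling fast convergence or equality of reals. *)
Lemma modulus_lip p q : `|modulus p - modulus q| <= `|p - q|.
Proof.
apply: le_trans (unit_clamp_lip p q); apply: modulus_lip_aux;
  by rewrite ?unit_clamp_ge0 ?unit_clamp_le1.
Qed.

(** If no power of 1/2 bracketed q, then q < 2^-n would pass from n to n + 1 for ever, against
    [eps_small]. *)
Lemma eps_bracket q : 0 < q -> q < 1 -> exists j, eps j <= q /\ q < 2 * eps j.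
Proof.
move=> q0 q1; apply: NNPP => nex.
have H : forall n, q < eps n.
  have [a [b [d e]]] := fraction_kval q.
  have d0 : 0 < kval d + 1 by have := kval_ge0 d; lra.
  apply: num_ind => [||n IH].
  (* Clearing denominators turns q < 2^-n into an inequality between numbers, as induction
     requires. *)
  - apply: (@qfree_ext _ (fun n => kval (a * npow n) < kval (d + 1 + b * npow n))).
      move=> n; rewrite e !(kvalD, kvalM, kval1) /eps ltr_pdivrMr // -ltr_pdivrMl ?invr_gt0 ?npow_gt0 //.
      by rewrite invrK; split; lra.
    by apply: qf_klt; do ?apply: num_dfn_add; dfn; do ?apply: npow_dfn; dfn.
  - by rewrite eps0.
  rewrite ltNge; apply/negP => le; apply: nex; exists (n + 1); split=> //.
  by rewrite epsS; lra.
by have [n] := eps_small q0; have := H n; lra.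
Qed.

End CantorReal.

(** * The open set of plateaus and continuity on it *)

Section Gaps.
Variable M : model.
Local Notation K := (fraction M).
Implicit Types (a b c i j k l m n s t z : num M) (p q d : K) (x y : num M -> K).

Definition eventually (P : num M -> Prop) : Prop :=
  exists n0, forall n, kval n0 <= kval n -> P n.

Lemma ev_mono (P Q : num M -> Prop) : (forall n, P n -> Q n) -> eventually P -> eventually Q.
Proof. by move=> h [n0 hn]; exists n0 => n /hn /h. Qed.

Lemma ev_and (P Q : num M -> Prop) : eventually P -> eventually Q ->
  eventually (fun n => P n /\ Q n).
Proof.
move=> [n0 h0] [n1 h1]; exists (n0 + n1) => n le; split.
  by apply: h0; apply: le_trans le; apply: kval_addl.
by apply: h1; apply: le_trans le; apply: kval_addr.
Qed.

Lemma ev_ge m : eventually (fun n => kval m <= kval n).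
Proof. by exists m. Qed.

Lemma ev_ex P m : eventually P -> exists2 n, kval m <= kval n & P n.
Proof. by move=> /(ev_and (ev_ge m)) [n h]; have [] := h n (lexx _); exists n. Qed.

Lemma ev_comp (f : num M -> num M) P : (forall n, kval n <= kval (f n)) -> eventually P ->
  eventually (fun n => P (f n)).
Proof. by move=> hf [n0 h]; exists n0 => n le; apply: h; apply: le_trans (hf n). Qed.

Lemma le_index n : kval n <= kval (n + n + five M).
Proof. by rewrite -addrA; apply: kval_addl. Qed.

Lemma ev_eps d : 0 < d -> eventually (fun n => eps n < d).
Proof.
move=> d0; have [n0 _ h] := eps_small_le 0 d0; exists n0 => n /eps_le le.
by have := eps_gt0 n0; lra.
Qed.

Lemma Req_of_ev x y : isR x -> isR y ->
  (forall d, 0 < d -> eventually (fun n => `|x n - y n| <= d)) -> Req x y.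
Proof. by move=> hx hy h; apply: Req_of => // d n0 /h; apply: ev_ex. Qed.

Lemma not_Rlt x y : ~ Rlt x y -> Rle y x.
Proof. by move=> h n; rewrite leNgt; apply/negP => lt; apply: h; exists n. Qed.

Lemma unit_clamp_mono p q : p <= q -> unit_clamp p <= unit_clamp q.
Proof. by case: (unit_clampP p) => -[h ->]; case: (unit_clampP q) => -[h' ->]; lra. Qed.

(** This is min(t, 4^n), since t - (t - u) in truncated subtraction is the minimum of t and u. *)
Definition capped n t : num M := nsub t (nsub t (npow (n + n))).

Lemma capped_le n t : kval t <= kval (npow (n + n)) -> capped n t = t.
Proof. by move=> h; rewrite /capped (nsub_ge h) nsub0. Qed.

Lemma capped_ge n t : kval (npow (n + n)) <= kval t -> capped n t = npow (n + n).
Proof.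
move=> h; have := h; rewrite kval_leP => -[d e].
by rewrite /capped e [_ + d]addrC nsub_addr addrC nsub_addr.
Qed.

Lemma npow_sq n : kval (npow (n + n)) = kval (npow n) ^+ 2.
Proof. by rewrite npowD kvalM expr2. Qed.

Lemma eps_npow_sq n : eps (n + n) * kval (npow n) ^+ 2 = 1.
Proof. by rewrite -npow_sq eps_npow. Qed.

Lemma kval_capped n a s : kval (capped n (nsub a s)) =
  kval (npow n) ^+ 2 * unit_clamp ((kval a - kval s) * eps (n + n)).
Proof.
have e0 := eps_gt0 (n + n); have := eps_npow_sq n; have := npow_gt0 (n + n); rewrite npow_sq.
move: (eps (n + n)) e0 => E E0 P0 EP.
case: (lerP (kval a) (kval s)) => h.
  rewrite (nsub_ge h) capped_le ?kval0 ?kval_ge0 //.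
  case: (unit_clampP ((kval a - kval s) * E)) => -[h' ->]; rewrite ?mulr0 //; nra.
have hk := nsub_le (ltW h).
case: (lerP (kval (npow (n + n))) (kval (nsub a s))) => h2.
  rewrite (capped_ge h2) npow_sq; move: h2; rewrite hk npow_sq => h2.
  have h3 : 1 <= (kval a - kval s) * E by rewrite -EP mulrC ler_pM2r.
  by case: (unit_clampP ((kval a - kval s) * E)) => -[h' ->]; [nra|rewrite mulr1|nra].
rewrite (capped_le (ltW h2)) hk; move: h2; rewrite hk npow_sq => h2.
have h3 : (kval a - kval s) * E < 1 by rewrite -EP mulrC ltr_pM2l.
have h4 : 0 < (kval a - kval s) * E by rewrite mulr_gt0 // subr_gt0.
case: (unit_clampP ((kval a - kval s) * E)) => -[h' ->]; try lra.
by rewrite mulrCA [_ * E]mulrC EP mulr1.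
Qed.

Lemma npow_sq_gt0 n : 0 < kval (npow n) ^+ 2.
Proof. by rewrite exprn_gt0 // npow_gt0. Qed.

(** 2^n times the value of the level-n step function at (t - s) / 4^n clamped to [0,1]. *)
Definition plateau n s t : num M := count n (capped n (nsub t s)).
(* The interval ((a - s) / 4^n, (b - s) / 4^n) if the step function of level n is
   constant on it, and an empty one otherwise; the shift s accounts for negative
   end points. *)
Definition gap_end n s a b : num M :=
  a + nsub b a * nsub 1 (nsub (plateau n s b) (plateau n s a)).
Definition dyad n s a : num M := nmk a s (nsub (npow (n + n)) 1).
Definition gap n s a b : num M := npair (dyad n s a) (dyad n s (gap_end n s a b)).

Lemma qval_dyad n s a : qval (dyad n s a) = (kval a - kval s) * eps (n + n).
Proof.
rewrite qval_mk nsub_le; first by rewrite kval1 subrK.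
by rewrite kval1; have := npow_gt (n + n); have := kval_ge0 (n + n); lra.
Qed.

Lemma plateau_mono n s a b : kval a <= kval b -> kval (plateau n s a) <= kval (plateau n s b).
Proof.
move=> h; apply: (count_mono _ _).1.
rewrite (kval_capped n a s) (kval_capped n b s) (ler_pM2l (npow_sq_gt0 n)).
by apply: unit_clamp_mono; rewrite ler_pM2r ?eps_gt0 //; lra.
Qed.

Lemma gap_end_eq n s a b : kval a <= kval b -> plateau n s a = plateau n s b ->
  gap_end n s a b = b.
Proof.
move=> h e; rewrite /gap_end e [nsub (plateau _ _ _) _]nsub_ge // nsub0 mulr1.
by apply: kval_inj; rewrite kvalD nsub_le //; ring.
Qed.

Lemma gap_nonempty n s a b : kval a < kval (gap_end n s a b) ->
  gap_end n s a b = b /\ plateau n s a = plateau n s b.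
Proof.
move=> lt; suff [h1 h2] : kval a <= kval b /\ plateau n s a = plateau n s b.
  by split=> //; apply: gap_end_eq.
case: (lerP (kval a) (kval b)) => h; last first.
  by move: lt; rewrite /gap_end (nsub_ge (ltW h)) mul0r addr0 ltxx.
split=> //; apply: kval_inj; apply/eqP; rewrite eq_le plateau_mono //=.
rewrite leNgt; apply/negP => lt'; move: lt; rewrite /gap_end [nsub 1 _]nsub_ge.
  by rewrite mulr0 addr0 ltxx.
by rewrite nsub_le ?(ltW lt') // kval1; have := kval_ltS lt'; lra.
Qed.

Lemma cantor_plateau x y n m s a b : is_cantor x y -> kval n <= kval m ->
  plateau n s a = plateau n s b ->
  qval (dyad n s a) <= x (m + m + five M) -> x (m + m + five M) <= qval (dyad n s b) ->
  y m = eps n * kval (plateau n s a).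
Proof.
rewrite !qval_dyad => h nm e ha hb; apply: (cantor_const h nm e).
  rewrite (kval_capped n a s) (ler_pM2l (npow_sq_gt0 n)); exact: unit_clamp_mono.
rewrite (kval_capped n b s) (ler_pM2l (npow_sq_gt0 n)); exact: unit_clamp_mono.
Qed.

Definition plateau_tm G (n s t : tm G ty0) : tm G ty0 :=
  (count_tm _ $ n $ ((t -| s) -| ((t -| s) -| (cpow2 $ (n + n)))))%tm.
Definition dyad_tm G (n s a : tm G ty0) : tm G ty0 := qmk a s ((cpow2 $ (n + n)) -| 1)%tm.
Definition gap_tm G (n s a b : tm G ty0) : tm G ty0 :=
  (cpair $ dyad_tm n s a $ dyad_tm n s (a + (b -| a) *
    (1 -| (plateau_tm n s b -| plateau_tm n s a))))%tm.
(** Iterated unpairing reads n, s, a, b off one number, so a single sequence lists the gaps of all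
    levels. *)
Definition gaps_body G : tm (ty0 :: G) ty0 :=
  gap_tm (cfst $ var0)%tm (cfst $ (csnd $ var0))%tm (cfst $ (csnd $ (csnd $ var0)))%tm
    (csnd $ (csnd $ (csnd $ var0)))%tm.
Definition gaps : car M ty1 := eval (@enil (car M)) (lam (gaps_body _)).

Lemma eval_plateau_tm G (e : env (car M) G) (r s t : tm G ty0) :
  eval e (plateau_tm r s t) = plateau (eval e r) (eval e s) (eval e t).
Proof. by rewrite /plateau_tm eval_count_tm !evq eval_pow_tm !evq. Qed.

Lemma eval_dyad_tm G (e : env (car M) G) (r s t : tm G ty0) :
  eval e (dyad_tm r s t) = dyad (eval e r) (eval e s) (eval e t).
Proof. by rewrite /dyad_tm !evq eval_pow_tm !evq. Qed.

Lemma eval_pair_tm G (e : env (car M) G) (s t : tm G ty0) :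
  eval e (cpair $ s $ t)%tm = npair (eval e s) (eval e t).
Proof. exact: (eval_cpair e (eval e s) (eval e t)). Qed.
Lemma eval_fst_tm G (e : env (car M) G) (t : tm G ty0) : eval e (cfst $ t)%tm = nfst (eval e t).
Proof. exact: (eval_cfst e (eval e t)). Qed.
Lemma eval_snd_tm G (e : env (car M) G) (t : tm G ty0) : eval e (csnd $ t)%tm = nsnd (eval e t).
Proof. exact: (eval_csnd e (eval e t)). Qed.

Lemma gapsE z : sapp gaps z =
  gap (nfst z) (nfst (nsnd z)) (nfst (nsnd (nsnd z))) (nsnd (nsnd (nsnd z))).
Proof.
rewrite /gaps eval_lam /gaps_body /gap_tm eval_pair_tm !eval_dyad_tm !evq !eval_plateau_tm.
by rewrite !(eval_fst_tm, eval_snd_tm).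
Qed.

Lemma in_gaps x : in_open gaps x <-> isR x /\ exists n s a b,
  [/\ plateau n s a = plateau n s b, Rlt (cst (qval (dyad n s a))) x &
   Rlt x (cst (qval (dyad n s b)))].
Proof.
split=> -[hx h]; split=> //.
  case: h => z []; rewrite gapsE /gap nfst_pair nsnd_pair.
  move: (nfst z) (nfst (nsnd z)) (nfst (nsnd (nsnd z))) (nsnd (nsnd (nsnd z))) => n s a b h1 h2.
  have lt : kval a < kval (gap_end n s a b).
    have [d d0 h1'] := Rlt_ev (isR_cst _) hx h1; have [d' d'0 h2'] := Rlt_ev hx (isR_cst _) h2.
    have [k _ [k1 k2]] := ev_ex 0 (ev_and h1' h2').
    move: k1 k2; rewrite /cst !qval_dyad => k1 k2.
    have := eps_gt0 (n + n); move: (eps (n + n)) k1 k2 => E k1 k2 E0.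
    suff : (kval a - kval s) * E < (kval (gap_end n s a b) - kval s) * E.
      by rewrite ltr_pM2r //; lra.
    lra.
  have [e1 e2] := gap_nonempty lt; rewrite e1 in h2.
  by exists n, s, a, b; split.
case: h => n [s [a [b [e h1 h2]]]].
exists (npair n (npair s (npair a b))); rewrite gapsE !(nfst_pair, nsnd_pair).
rewrite /gap /in_itv nfst_pair nsnd_pair gap_end_eq // leNgt; apply/negP => lt.
have [d d0 h1'] := Rlt_ev (isR_cst _) hx h1; have [d' d'0 h2'] := Rlt_ev hx (isR_cst _) h2.
have [k _ [k1 k2]] := ev_ex 0 (ev_and h1' h2').
move: k1 k2; rewrite /cst !qval_dyad => k1 k2.
have : (kval b - kval s) * eps (n + n) <= (kval a - kval s) * eps (n + n).
  by rewrite ler_pM2r ?eps_gt0 //; lra.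
lra.
Qed.

Lemma archimedean q : exists n, q < kval n.
Proof.
have [a [b [d e]]] := fraction_kval q; exists (a + 1).
have d1 : 1 <= kval d + 1 by have := kval_ge0 d; lra.
have d0 : 0 < kval d + 1 by lra.
rewrite e ltr_pdivrMr // kvalD kval1; have := kval_ge0 a; have := kval_ge0 b; nra.
Qed.

(** Both half-lines outside [0,1] consist of gaps, because g clamps its argument and is constant on
    them. *)
Lemma gaps_closed_unit x : in_closed gaps x -> unitI x.
Proof.
move=> [hx nx]; split=> //; apply: not_Rlt => lt; apply: nx; apply/in_gaps; split=> //.
  (* Left of 0: the level-0 interval from -S to 0, with both ends clamped to 0. *)
  have [S hS] := archimedean (2 - x 0).
  have S0 : 0 <= kval S := kval_ge0 S.
  exists 0, S, 0, S; rewrite /plateau !qval_dyad addr0 eps0; split.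
  - by rewrite !nsub_ge // kval0.
  - by exists 0; rewrite /cst eps0 kval0; lra.
  - by rewrite subrr mul0r.
(* Right of 1: the level-0 interval from 1 to S, with both ends clamped to 1. *)
have [S hS] := archimedean (x 0 + 2).
have [d d0 hd] := Rlt_ev (isR_cst _) hx lt.
have hx0 : 1 <= x 0 + 1.
  have [k _ hk] := ev_ex 0 hd; have := hx 0 k; rewrite add0r eps0 ltr_norml => /andP[].
  by move: hk; rewrite /cst; lra.
exists 0, 0, 1, S; rewrite /plateau !qval_dyad addr0 eps0 !nsub0; split.
- rewrite !capped_ge // addr0 npow0 kval1; lra.
- by rewrite kval0 kval1 subr0 mulr1.
- by exists 0; rewrite /cst eps0 kval0; lra.
Qed.

Lemma cantor_locally_constant x y x' y' n s a b : is_cantor x y -> is_cantor x' y' ->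
  isR x -> isR x' -> plateau n s a = plateau n s b ->
  eventually (fun m => qval (dyad n s a) <= x m <= qval (dyad n s b)) ->
  eventually (fun m => qval (dyad n s a) <= x' m <= qval (dyad n s b)) -> Req y y'.
Proof.
move=> h h' hx hx' e ex ex'; apply: Req_of_ev; [exact: isR_cantor h|exact: isR_cantor h'|].
move=> d d0; have := ev_and (ev_ge n) (ev_and (ev_comp le_index ex) (ev_comp le_index ex')).
apply: ev_mono => m [nm [/andP[a1 a2] /andP[b1 b2]]].
by rewrite (cantor_plateau h nm e a1 a2) (cantor_plateau h' nm e b1 b2) subrr normr0 ltW.
Qed.

Lemma rconst_real q : exists s : car M ty1, rv s = cst q.
Proof.
have [c <-] := code_of q; exists (sapp (sK M ty0 ty0) c).
by apply: functional_extensionality => n; rewrite /rv sK_eq.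
Qed.

(** A function that depends on x only through g x is constant on each gap, whatever its values
    are. *)
Lemma cantor_cont F (x : car M ty1) :
  (forall x y : car M ty1, isR (rv x) -> isR (rv y) ->
    Req (rv (sapp (cantor M) x)) (rv (sapp (cantor M) y)) -> Req (rv (sapp F x)) (rv (sapp F y))) ->
  unitI (rv x) -> ~ in_closed gaps (rv x) -> cont_at (@unitI M) F x.
Proof.
move=> hF [hx _ _] nx ep pe.
have : in_open gaps (rv x) by apply: NNPP => no; apply: nx.
move=> /in_gaps[_ [n [s [a [b [e h1 h2]]]]]].
have [d1 d10 l1] := Rlt_ev (isR_cst _) hx h1; have [d2 d20 l2] := Rlt_ev hx (isR_cst _) h2.
(* A lower bound for the distance from x to the two ends of its gap; points closer than d stay in
   the closed gap. *)
pose d := Num.min d1 d2; have d0 : 0 < d by rewrite lt_min d10.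
have dd1 : d <= d1 by rewrite ge_min lexx.
have dd2 : d <= d2 by rewrite ge_min lexx orbT.
have [dr edr] := rconst_real d; exists dr; rewrite edr.
  by split; [apply: isR_cst|apply: (@Rlt_of _ _ _ d 0) => // k _; rewrite /cst add0r].
move=> y [hy _ _] /(Rlt_ev (isR_Rdist hx hy) (isR_cst _)) [d' d'0 hd'].
have ly : eventually (fun m => `|rv x m - rv y m| <= d).
  case: hd' => n0 hd'; exists (n0 + 1) => m /kval_leP[i ->].
  have := hd' (n0 + i) (kval_addl _ _); rewrite /Rdist /cst [n0 + i + 1]addrAC; lra.
have E : Req (rv (sapp F x)) (rv (sapp F y)).
  apply: hF => //; apply: (cantor_locally_constant (is_cantor_rv x) (is_cantor_rv y) hx hy e).
    apply: ev_mono (ev_and l1 l2) => m; rewrite /cst => -[k1 k2]; apply/andP; split; lra.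
  apply: ev_mono (ev_and ly (ev_and l1 l2)) => m; rewrite /cst ler_norml => -[/andP[k3 k4] [k1 k2]].
  apply/andP; split; lra.
have [ee ee0 he] := posR_ev pe; have := Req_ev E (d := ee / 2) ltac:(lra) => hE.
have [n0 hn] := ev_and (ev_comp (fun k => kval_addl k 1) hE) he.
apply: (@Rlt_of _ _ _ (ee / 2) n0); first by lra.
by move=> m /hn[k1 k2]; rewrite /Rdist; lra.
Qed.

End Gaps.
Lemma floor_scale (F : realFieldType) (E P k c : F) : 0 < E -> E * P = 1 ->
  k <= P * c -> P * c < k + 1 -> k * E <= c /\ c < (k + 1) * E.
Proof.
move=> E0 EP h1 h2; have -> : c = (P * c) * E by rewrite mulrC mulrA EP mul1r.
by rewrite ler_pM2r // ltr_pM2r.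
Qed.

(** * The complement of the gaps has measure zero *)

Section Null.
Variable M : model.
Local Notation K := (fraction M).
Implicit Types (a b c i j k l m n s t z : num M) (p q d : K) (x y : num M -> K).

(* The complement of the gaps is covered by the intervals of length 5 / 4^n around
   the j / 4^n with [good n j = 1], of which there are 2^n; the other intervals of
   the cover are empty. *)
Definition weight n j : num M := good n j * nsub 1 (nsub j (npow (n + n))).

Definition cover_body G : tm [:: ty0, ty0 & G] ty0 :=
  (cpair $ dyad_tm var1 (1 + 1)%tm var0 $ dyad_tm var1 (1 + 1)%tm
    (var0 + (1 + 1 + 1 + 1 + 1) * ((good_tm _ $ var1 $ var0) *
      (1 -| (var0 -| (cpow2 $ (var1 + var1)))))))%tm.
Definition cover n : car M ty1 :=
  eval (econs (n : car M ty0) (@enil (car M))) (lam (cover_body _)).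

Lemma coverE n j : sapp (cover n) j =
  npair (dyad n (1 + 1) j) (dyad n (1 + 1) (j + five M * weight n j)).
Proof.
rewrite /cover eval_lam /cover_body eval_pair_tm !eval_dyad_tm !evq eval_good_tm eval_pow_tm.
by rewrite !evq.
Qed.

Lemma good_step_capped n j : (kval j < kval (npow (n + n)) -> good n j = 0) ->
  count n (capped n (j + 1)) = count n (capped n j).
Proof.
case: (lerP (kval (npow (n + n))) (kval j)) => h.
  by rewrite !capped_ge //; apply: le_trans h (kval_addl _ _).
by move=> /(_ erefl) g; rewrite !capped_le ?(ltW h) ?kvalD ?kval1 ?kval_ltS // countS g addr0.
Qed.

(** The count changes between (k - 1) / 4^n and (k + 2) / 4^n only if one of k - 1, k, k + 1 is
    counted. *)
Lemma good_between n k : plateau n 1 k <> plateau n 1 (k + 1 + 1 + 1) ->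
  exists j, [/\ good n j = 1, kval j < kval (npow (n + n)), kval k <= kval j + 1 &
    kval j <= kval k + 1].
Proof.
move=> ne; apply: NNPP => nex; apply: ne.
have S j : kval k <= kval j + 1 -> kval j <= kval k + 1 ->
    count n (capped n (j + 1)) = count n (capped n j).
  move=> kj jk; apply: good_step_capped => lt; apply: NNPP => g0; apply: nex; exists j; split=> //.
  apply: kval_inj; apply/eqP; rewrite eq_le kval1 good_le1 /= -[1]add0r -(kval0 M).
  apply: kval_ltS; rewrite lt_neqAle kval0 kval_ge0 andbT eq_sym.
  by apply/negP => /eqP e; apply: g0; apply: kval_inj; rewrite e kval0.
rewrite /plateau nsub_addr; case: (num_case k) => e.
  (* For k = 0 the left end is truncated to 0 and two candidates remain instead of three. *)
  subst k; have -> : nsub 0 1 = 0 :> num M by rewrite nsub_ge // kval0 kval_ge0.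
  have c0 := S 0; have c1 := S (0 + 1); move: c0 c1; rewrite !kvalD kval0 kval1 => c0 c1.
  by rewrite c1 ?c0 //; lra.
move: (npred k) e => k' e; subst k; rewrite nsub_addr.
have c0 := S k'; have c1 := S (k' + 1); have c2 := S (k' + 1 + 1).
move: c0 c1 c2; rewrite !kvalD kval1 => c0 c1 c2.
by rewrite c2 ?c1 ?c0 //; lra.
Qed.

(** With k the floor of 4^n x, up to rounding, the interval from (k - 1) / 4^n to (k + 2) / 4^n
    surrounds x. As x is in no gap, the count changes across it, and the j found differs from k by
    at most 1. *)
Lemma in_cover n x : in_closed (gaps M) x -> in_open (cover n) x.
Proof.
(* At the index N one has [eps N] = 4^-n / 8. Clamping moves [x N] by at most two such units and
   later terms by one more, whence the 3/8 below. *)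
move=> cx; have [hx no] := cx; have [_ x0 x1] := gaps_closed_unit cx.
pose N := n + n + 1 + 1 + 1; have eN : eps N = eps (n + n) / 8 by rewrite /N !epsS; lra.
have E0 := eps_gt0 (n + n); have EP := eps_npow_sq n.
have [_ [k [k1 k2] _]] := gam_ex n (unit_clamp_ge0 (x N)).
have near : forall m, kval N <= kval m ->
    (kval k - 3 / 8) * eps (n + n) <= x m /\ x m <= (kval k + 1 + 3 / 8) * eps (n + n).
  move=> m /(isR_near hx); rewrite ltr_norml => /andP[].
  have := x0 N; have := x1 N; rewrite /cst eN.
  have [c1 c2] := floor_scale E0 EP k1 k2.
  move: c1 c2; rewrite !mulrDl !mul1r mulNr; move: (kval k * _) => kE.
  by case: (unit_clampP (x N)) => -[h ->] *; split; lra.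
have [j [gj jn kj jk]] : exists j, [/\ good n j = 1, kval j < kval (npow (n + n)),
    kval k <= kval j + 1 & kval j <= kval k + 1].
  apply: good_between => e; apply: no; apply/in_gaps; split=> //.
  exists n, 1, k, (k + 1 + 1 + 1); split=> //; apply: (@Rlt_of _ _ _ (eps (n + n) / 2) N); try lra;
    move=> m /near[]; rewrite /cst qval_dyad ?kvalD kval1; nra.
have w1 : weight n j = 1 by rewrite /weight gj mul1r (nsub_ge (ltW jn)) nsub0.
split=> //; exists j; rewrite coverE /in_itv nfst_pair nsnd_pair !qval_dyad w1 mulr1.
split; apply: (@Rlt_of _ _ _ (eps (n + n) / 2) N); try lra;
  move=> m /near[]; rewrite /cst /five ?kvalD kval1; nra.
Qed.

Lemma nfst_dfn (r : ty) (f : car M r -> num M) : dfn (t := ty0) f ->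
  dfn (t := ty0) (fun n : car M r => nfst (f n)).
Proof.
move=> [u hu]; have [v hv] := dfn_app (dfn_const ty0 (eval (@enil (car M)) cfst)) (dfn_id M ty0).
have [w hw] := dfn_app (dfn_const r v) (dfn_sapp u).
by exists w => n; rewrite hw hv eval_cfst hu.
Qed.
Lemma nsnd_dfn (r : ty) (f : car M r -> num M) : dfn (t := ty0) f ->
  dfn (t := ty0) (fun n : car M r => nsnd (f n)).
Proof.
move=> [u hu]; have [v hv] := dfn_app (dfn_const ty0 (eval (@enil (car M)) csnd)) (dfn_id M ty0).
have [w hw] := dfn_app (dfn_const r v) (dfn_sapp u).
by exists w => n; rewrite hw hv eval_csnd hu.
Qed.
Lemma npair_dfn (r : ty) (f g : car M r -> num M) : dfn (t := ty0) f -> dfn (t := ty0) g ->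
  dfn (t := ty0) (fun n : car M r => npair (f n) (g n)).
Proof. by move=> df dg; do 2 apply: dfn_app => //; apply: dfn_const. Qed.

Lemma qf_qle (f g : num M -> num M) : dfn (s := ty0) (t := ty0) f ->
  dfn (s := ty0) (t := ty0) g -> qfree (M := M) (fun n => qval (f n) <= qval (g n)).
Proof.
move=> df dg.
apply: (@qfree_ext _ (fun n => ~ nlt (nfst (g n) * (nsnd (nsnd (f n)) + 1) +
    nfst (nsnd (f n)) * (nsnd (nsnd (g n)) + 1)) (nfst (f n) * (nsnd (nsnd (g n)) + 1) +
    nfst (nsnd (g n)) * (nsnd (nsnd (f n)) + 1)))).
  move=> n; rewrite -frac_ltP leNgt; split=> [h|/negP h].
    by apply/negP.
  exact: h.
apply: qf_not; apply: qf_lt; do ?[exact: df | exact: dg | exact: dfn_const | apply: num_dfn_add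
  | apply: num_dfn_mul | apply: nfst_dfn | apply: nsnd_dfn].
Qed.

(** The truncated subtractions form min(k, 4^n + 1): [weight] vanishes for j > 4^n, and each j of
    weight 1 contributes length 5 / 4^n. *)
Lemma cover_sum n (l : num M -> num M) k : is_length_sum (cover n) l ->
  qval (l k) <= qval (dyad n 0 (five M * count n (nsub k (nsub k (npow (n + n) + 1))))).
Proof.
move=> [dl l0 lS]; move: k; apply: num_ind => [||k IH].
- apply: qf_qle => //; rewrite /dyad /nmk; apply: npair_dfn; last exact: dfn_const.
  apply: num_dfn_mul; first exact: dfn_const.
  by apply: count_dfn; dfn.
- by rewrite l0 qval_dyad kval0 subr0 mulr_ge0 ?kval_ge0 // ltW // eps_gt0.
rewrite lS coverE nfst_pair nsnd_pair; move: IH; rewrite !qval_dyad kval0 !subr0 !kvalD.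
rewrite !(kvalM (five M)); set B := count n _; set B' := count n _.
have f5 : kval (five M) = 5 by rewrite /five !kvalD kval1; lra.
have E0 := eps_gt0 (n + n); have w0 := kval_ge0 (weight n k).
have BB : kval B + kval (weight n k) <= kval B'.
  rewrite /B /B' /weight; case: (lerP (kval k) (kval (npow (n + n)))) => h.
    rewrite (nsub_ge h) nsub0 mulr1 -kvalD nsubSS (nsub_ge h).
    have h' : kval k <= kval (npow (n + n) + 1) := le_trans h (kval_addl _ _).
    by rewrite (nsub_ge h') !nsub0 countS.
  have h1 : nsub 1 (nsub k (npow (n + n))) = 0.
    by rewrite nsub_ge // nsub_le ?(ltW h) // kval1; have := kval_ltS h; lra.
  rewrite h1 mulr0 kval0 addr0 nsubSS; apply: (count_mono _ _).1.
  have h2 : kval (npow (n + n) + 1) <= kval k by rewrite kvalD kval1; apply: kval_ltS.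
  rewrite (nsub_le (nsub_le_kval _ _)) (nsub_le h2).
  rewrite nsub_le; first by rewrite nsub_le ?(ltW h) // !kvalD kval1; lra.
  by apply: le_trans (nsub_le_kval _ _) _; apply: kval_addl.
rewrite f5 kval1; move: (kval B) (kval B') BB (kval k) => b b' BB kk IH.
have -> : (kk + 5 * kval (weight n k) - (1 + 1)) * eps (n + n) - (kk - (1 + 1)) * eps (n + n) =
  5 * kval (weight n k) * eps (n + n) by ring.
rewrite max_l; last by rewrite !mulr_ge0 // ltW.
have : 5 * (b + kval (weight n k)) * eps (n + n) <= 5 * b' * eps (n + n).
  by rewrite ler_pM2r //; lra.
by lra.
Qed.

(** At most 2^n + 1 intervals are nonempty, and 5 (2^n + 1) / 4^n <= 10 / 2^n. *)
Lemma cover_total n (l : num M -> num M) k : is_length_sum (cover n) l -> qval (l k) <= 10 * eps n.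
Proof.
move=> /(@cover_sum n l k) h; apply: le_trans h _; rewrite qval_dyad kval0 subr0 kvalM.
have f5 : kval (five M) = 5 by rewrite /five !kvalD kval1; lra.
have : kval (count n (nsub k (nsub k (npow (n + n) + 1)))) <= kval (npow n) + 1.
  have c1 : count n (npow (n + n)) = npow n.
    by have := count_pow 0 n 1; rewrite add0r !mulr1 count_zero mulr1.
  apply: (@le_trans _ _ (kval (count n (npow (n + n) + 1)))).
    apply: (count_mono _ _).1; case: (lerP (kval k) (kval (npow (n + n) + 1))) => h.
      by rewrite (nsub_ge h) nsub0.
    rewrite nsub_le ?nsub_le_kval // nsub_le ?(ltW h) //; lra.
  by rewrite countS kvalD c1; have := good_le1 n (npow (n + n)); lra.
move: (count _ _) => c hc; rewrite f5 epsD.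
have e0 := eps_gt0 n; have e1 := eps_le1 n; have eP := eps_npow n.
have h1 : eps n * kval c <= 1 + eps n.
  have : eps n * kval c <= eps n * (kval (npow n) + 1) by rewrite ler_pM2l.
  by rewrite mulrDr eP mulr1.
have -> : 5 * kval c * (eps n * eps n) = 5 * (eps n * kval c) * eps n by ring.
by move: (eps n * kval c) h1 => z h1; nra.
Qed.

Lemma null_closed : null (in_closed (gaps M)).
Proof.
move=> ep pe; have [ee ee0 he] := posR_ev pe.
have [n hn] : exists n, eps n < ee / 20 by apply: eps_small; lra.
exists (cover n); split=> [x|]; first exact: in_cover.
have [s es] := rconst_real (10 * eps n); exists s; rewrite es; split; first exact: isR_cst.
  by case: he => n0 he; apply: (@Rlt_of _ _ _ (ee / 2) n0) => [|m /he]; rewrite /cst; lra.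
move=> l hl k m; rewrite /cst; have := cover_total k hl; have := eps_gt0 m; lra.
Qed.

End Null.
(** * The equivalence *)

Section Assembly.
Variable M : model.
Local Notation K := (fraction M).
Implicit Types (a b c i j k l m n t : num M) (p q d : K) (x y : num M -> K).

Lemma sat_ac_graph G r s (A : fm [:: s, r & G]) (e : env (car M) G) (Y : car M (tarr r s))
    (u : car M r) :
  sat (econs u (econs Y e)) (ac_graph A) <-> sat (econs (sapp Y u) (econs u e)) A.
Proof.
rewrite /ac_graph sat_sub; set e' := econs _ (econs u e).
rewrite (_ : (fun s0 v => _) = e') //.
apply: varext_cons => // r' v.
by move: r' v; refine (var_inv _ _).
Qed.

(** QF-AC^{1,0} chooses numbers for type-1 objects x, so the index i is read off as x(0); the
    premise i <= k makes any choice admissible beyond k. *)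
Lemma choose_index (W : car M (tarr ty0 ty1)) k :
  (forall i, kval i <= kval k -> exists n, eps n + eps n < rv (sapp W i) n) ->
  exists h : car M ty1, forall i, kval i <= kval k ->
    eps (sapp h i) + eps (sapp h i) < rv (sapp W i) (sapp h i).
Proof.
move=> hW; pose e := econs W (econs (k : car M ty0) (@enil (car M))).
pose A : fm [:: ty0; ty1; tarr ty0 ty1; ty0] :=
  (nle (var1 $ 0) (tvar (vs (vs (vs vz)))) ->>
   qlt (qadd $ qhalf var0 $ qhalf var0) (tvar (vs (vs vz)) $ (var1 $ 0) $ var0))%fm.
have hA (x : car M ty1) (n : num M) : sat (econs (n : car M ty0) (econs x e)) A <->
    (kval (sapp x (0 : num M)) <= kval k ->
     eps n + eps n < rv (sapp W (sapp x (0 : num M))) n).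
  have En := @sat_nle M _ (econs (n : car M ty0) (econs x e)) (var1 $ 0)%tm (tvar (vs (vs (vs vz)))).
  have El := @sat_qlt M _ (econs (n : car M ty0) (econs x e)) (qadd $ qhalf var0 $ qhalf var0)%tm
    (tvar (vs (vs vz)) $ (var1 $ 0) $ var0)%tm.
  have Ea : qval (eval (econs (n : car M ty0) (econs x e)) (qadd $ qhalf var0 $ qhalf var0)%tm) =
      eps n + eps n.
    by ev; rewrite qval_qadd !qval_qhalf.
  rewrite Ea in El; split=> h hk; first exact: (El.1 (h (En.2 hk))).
  exact: (El.2 (h (En.1 hk))).
have [|Y hY] := model_ax (mP M) e (ax_qfac (A := A) erefl).
  move=> x; case: (classic (kval (sapp x (0 : num M)) <= kval k)) => [/hW[n hn]|no].
    by exists n; apply/hA.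
  by exists (0 : num M); apply/hA.
(* Feeding the constant sequence i back into Y turns the choice into a function of i. *)
have [h hh] : dfn (fun i : car M ty0 => sapp Y (sapp (sK M ty0 ty0) i)).
  by apply: dfn_app; [apply: dfn_const|apply: dfn_sapp].
exists h => i hi; have := (sat_ac_graph A e Y (sapp (sK M ty0 ty0) i)).1 (hY _).
by rewrite -hh => /hA; rewrite sK_eq; apply.
Qed.

(** The bound is the sum h(0) + ... + h(k), a value of the recursor. Being explicit, it can be
    verified by quantifier-free induction although k may be nonstandard. *)
Lemma index_bound (h : car M ty1) k : exists N : num M, forall i, kval i <= kval k ->
  kval (sapp h i : num M) <= kval N.
Proof.
pose f := eval (econs h (@enil (car M))) (lam (lam (var0 + (var2 $ var1))))%tm.
pose T := sapp (sapp (srec M) f) (0 : num M).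
have TS j : sapp T (j + 1 : num M) = (sapp T j : num M) + sapp h j :> num M.
  by rewrite /T recS /f eval_lam2.
exists (sapp T (k + 1 : num M)) => i ik.
have : kval i < kval (k + 1) by rewrite kvalD kval1; lra.
have : forall j, kval i < kval j -> kval (sapp h i : num M) <= kval (sapp T j : num M).
  apply: num_ind => [||j IH].
  - by apply: qf_imp; [apply: qf_klt|apply: qf_kle]; dfn.
  - by rewrite kval0 => lt; have := kval_ge0 i; lra.
  rewrite kvalD kval1 TS kvalD => lt.
  case: (ltrP (kval i) (kval j)) => [/IH|ji]; first by have := kval_ge0 (sapp h j : num M); lra.
  have -> : i = j.
    by apply: kval_inj; apply/eqP; rewrite eq_le ji andbT; apply: kval_leS.
  by have := kval_ge0 (sapp T j : num M); lra.
by apply.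
Qed.

(** The units of [eps m] are: one for passing from n to m, two for clamping [y m] and one for
    rounding down to a multiple of 2^-m, which [count_onto] realises as a value of the count. *)
Lemma dyadic_approx y m : unitI y -> exists2 k, kval k <= kval (npow (m + m)) &
  forall n, kval m <= kval n -> `|y n - eps m * kval (count m k)| <= 4 * eps m.
Proof.
move=> [hy y0 y1]; pose q := unit_clamp (y m).
have q0 : 0 <= kval (npow m) * q by rewrite mulr_ge0 ?kval_ge0 ?unit_clamp_ge0.
(* Level 0 serves only to take the floor of 2^m q. *)
have [_ [t [t1 t2] _]] := gam_ex 0 q0.
rewrite npow0 kval1 expr1n mul1r in t1 t2.
have tP : kval t <= kval (npow m).
  apply: le_trans t1 _; rewrite ler_piMr ?kval_ge0 //; exact: unit_clamp_le1.
have [k kP ck] := count_onto tP; exists k => // n /(isR_near hy); rewrite ck.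
have [c1 c2] := floor_scale (eps_gt0 m) (eps_npow m) t1 t2.
have := y0 m; have := y1 m; rewrite /cst /q in c1 c2 *; have e0 := eps_gt0 m.
move: c1 c2; rewrite mulrDl mul1r [kval t * _]mulrC; move: (eps m * kval t) => z c1 c2.
rewrite !ltr_norml !ler_norml => h1 h2 /andP[h3 h4].
by case: (unit_clampP (y m)) c1 c2 => -[h ->] c1 c2; apply/andP; split; lra.
Qed.

(** The constant 256 is spent here: (9/8)^2 / 256 < 1/128, and r/16 < e gives r^2 / 128 < (r/8)
    e. *)
Lemma modulus_scale (F : realFieldType) (e P r d c : F) : e * P = 1 -> 0 < P ->
  r / 8 < 2 * e -> 0 < r -> 0 <= c -> c <= 9 / 8 * r -> d <= c ^+ 2 / 256 -> d * P <= r / 8.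
Proof.
move=> eP P0 he r0 c0 cr hd.
have h1 : c ^+ 2 <= (9 / 8 * r) ^+ 2 by rewrite ler_pXn2r // nnegrE; lra.
have h2 : (9 / 8 * r) ^+ 2 / 256 <= r / 8 * e.
  have : r / 8 * (r / 16) <= r / 8 * e by rewrite ler_pM2l; lra.
  by rewrite expr2; nra.
have -> : r / 8 = r / 8 * e * P by rewrite -mulrA eP mulr1.
by rewrite ler_pM2r //; lra.
Qed.

(** If x and x' are within c^2 / 256, then y and y' are within c/8 + c/4 = 3c/8, where c is the
    clamped radius. So 5/8 of c remains, less d/8 for reading r at different indices. *)
Lemma cantor_close x x' y y' r d : is_cantor x y -> is_cantor x' y' -> isR r ->
  0 < d -> d <= 1 -> eventually (fun n => d <= r n) ->
  eventually (fun n => `|x n - x' n| <= modulus (r n)) ->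
  eventually (fun n => `|y n - y' n| + (5 / 8 * d - d / 8) <= r n).
Proof.
move=> h h' hr d0 d1 dr xx.
have [n1 H] := ev_and (ev_eps (d := d / 8) ltac:(lra)) (ev_and dr xx).
have [e1 [r1 _]] := H n1 (lexx _).
pose c := unit_clamp (r n1).
have cd : d <= c by rewrite /c; case: (unit_clampP (r n1)) => -[? ->]; lra.
have cr : c <= r n1 by rewrite /c; case: (unit_clampP (r n1)) => -[? ->]; lra.
have c1 : c <= 1 := unit_clamp_le1 _.
(* With 2^-j between c/16 and c/8 both terms of the modulus are small: 2^j |x - x'| <= c/8 and 2 *
   2^-j <= c/4. *)
have [j [j1 j2]] := @eps_bracket M (c / 8) ltac:(lra) ltac:(lra).
exists (n1 + j) => n le.
have n1n : kval n1 <= kval n := le_trans (kval_addl _ _) le.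
have jn : kval j <= kval n := le_trans (kval_addr _ _) le.
have := cantor_modulus h h' jn.
have n1f : kval n1 <= kval (n + n + five M) := le_trans n1n (le_index n).
have [_ [_ hx]] := H _ n1f.
have := clamp_near hr n1f; have := isR_near hr n1n.
rewrite -/c /modulus in hx *; set c' := unit_clamp (r (n + n + five M)) in hx *.
rewrite !ltr_norml => /andP[a1 a2] /andP[b1 b2].
have := @modulus_scale _ (eps j) (kval (npow j)) c _ c' (eps_npow j) (npow_gt0 j) j2 ltac:(lra)
  (unit_clamp_ge0 _) ltac:(lra) hx.
move: (_ * kval (npow j)) `|y n - y' n| => z w hz hw; lra.
Qed.

Lemma sqr_scale_mono (F : realFieldType) (c d : F) : 0 <= c -> c <= d ->
  c ^+ 2 / 256 <= d ^+ 2 / 256.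
Proof.
move=> c0 cd; have : c ^+ 2 <= d ^+ 2 by rewrite ler_pXn2r // nnegrE; lra.
lra.
Qed.

Lemma modulus_mono p q : p <= q -> modulus p <= modulus q.
Proof. by move=> /unit_clamp_mono; apply: sqr_scale_mono; apply: unit_clamp_ge0. Qed.

Lemma modulus_gt0 q : 0 < q -> 0 < modulus q.
Proof.
move=> q0; have c0 : 0 < unit_clamp q by case: (unit_clampP q) => -[? ->]; lra.
by rewrite /modulus; have := exprn_gt0 2 c0; move: (_ ^+ 2) => z; lra.
Qed.

Lemma hbu_of_ae : hbu_ae M -> hbu M.
Proof.
move=> H F [pF eF].
have [Phi hPhi] : dfn (fun x : car M ty1 => sapp (rmodulus M) (sapp F (sapp (cantor M) x))).
  by apply: dfn_app; [apply: dfn_const|apply: dfn_app; [apply: dfn_const|apply: dfn_sapp]].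
have rc (x : car M ty1) : isR (rv x) -> isR (rv (sapp (cantor M) x)).
  by move=> hx; apply: isR_cantor hx (is_cantor_rv x).
have ePhi (x y : car M ty1) : isR (rv x) -> isR (rv y) ->
    Req (rv (sapp (cantor M) x)) (rv (sapp (cantor M) y)) -> Req (rv (sapp Phi x)) (rv (sapp Phi y)).
  move=> hx hy xy; rewrite !hPhi !rv_rmodulus; apply: Req_lip (eF _ _ (rc _ hx) (rc _ hy) xy).
  exact: modulus_lip.
have [||k [Y [hY cov]]] := H Phi.
- split=> [x [hx _ _]|x y [hx _ _] [hy _ _] xy].
    have pf := pF _ (rc x hx); have [rf _] := pf; rewrite hPhi rv_rmodulus.
    split; first exact: isR_lip (@modulus_lip M) rf.
    have [d d0 [n0 hd]] := posR_ev pf.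
    apply: (@Rlt_of _ _ _ (modulus d) n0); first exact: modulus_gt0.
    by move=> n /hd /modulus_mono; rewrite /cst add0r.
  exact: ePhi hx hy (Req_cantor (is_cantor_rv x) (is_cantor_rv y) xy).
- exists (gaps M); split; [by move=> x; apply: gaps_closed_unit|exact: null_closed|].
  move=> x Ix nx; exact: cantor_cont.
have [Z hZ] : dfn (fun i : car M ty0 => sapp (cantor M) (sapp Y i)).
  by apply: dfn_app; [apply: dfn_const|apply: dfn_sapp].
have [W hW] : dfn (fun i : car M ty0 => sapp F (sapp Z i)).
  by apply: dfn_app; [apply: dfn_const|apply: dfn_sapp].
have ZI i : kval i <= kval k -> unitI (rv (sapp Z i)).
  by move=> /hY [hy _ _]; rewrite hZ; apply: cantor_unit hy (is_cantor_rv _).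
have WP i : kval i <= kval k -> posR (rv (sapp W i)).
  by move=> /ZI [hz _ _]; rewrite hW; apply: pF.
have [|h hh] := @choose_index W k.
  by move=> i /WP [_ [n hn]]; exists n; move: hn; rewrite /cst add0r.
have [N hN] := index_bound h k.
(* From the chosen index on, F(g y_i) stays above [eps (sapp h i)], hence above 2^-N, for all i <= k
   at once. *)
pose d := eps N; have d0 : 0 < d := eps_gt0 N; have d1 : d <= 1 := eps_le1 N.
have dW i : kval i <= kval k -> eventually (fun n => d <= rv (sapp W i) n).
  move=> ik; have [rW _] := WP i ik; exists (sapp h i) => n /(isR_near rW).
  have := hh i ik; have := eps_le (hN i ik); rewrite -/d ltr_norml => le lt /andP[_].
  by move: lt le; move: (eps _) (rv _ _) (rv _ _) => e r r'; lra.
exists k, Z; split=> // y Iy; have [hy _ _] := Iy.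
(* The dyadic approximation then errs by at most 4 * d/32 = d/8, against a slack of d/2 from
   [cantor_close]. *)
have [m _ em] := ev_ex 0 (@ev_eps M (d / 32) ltac:(lra)).
have [l lP hl] := dyadic_approx m Iy.
(* The approximate preimage of y is the rational l / 4^m, to which the given cover is applied. *)
have [x ex] := rconst_real (kval l * eps (m + m)).
have lq : 0 <= kval l * eps (m + m) <= 1.
  rewrite mulr_ge0 ?kval_ge0 ?(ltW (eps_gt0 _)) //= -(eps_npow (m + m)) mulrC.
  by rewrite ler_pM2l ?eps_gt0.
have Ix : unitI (rv x).
  by rewrite ex; split; [apply: isR_cst|move=> n|move=> n]; rewrite /cst; have := eps_gt0 n; lra.
(* Here 4^m x is exactly l, so [cantor_const] with both ends equal to l fixes the value on all
   levels from m on. *)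
have cx n : kval m <= kval n -> rv (sapp (cantor M) x) n = eps m * kval (count m l).
  have e : kval (npow m) ^+ 2 * unit_clamp (kval l * eps (m + m)) = kval l.
    have -> : unit_clamp (kval l * eps (m + m)) = kval l * eps (m + m).
      by case: (unit_clampP (kval l * eps (m + m))) => -[hq ->]; lra.
    by rewrite mulrC -mulrA eps_npow_sq mulr1.
  by move=> mn; apply: (cantor_const (is_cantor_rv x) mn erefl); rewrite ex /cst e.
have [i [ik ci]] := cov x Ix; exists i; split=> //.
have [hYi _ _] := hY i ik; have [hx _ _] := Ix; have [rW _] := WP i ik; have [hZi _ _] := ZI i ik.
have PhiE : rv (sapp Phi (sapp Y i)) = fun n => modulus (rv (sapp W i) n).
  by rewrite hPhi rv_rmodulus hW hZ.
have rPhi : isR (rv (sapp Phi (sapp Y i))).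
  by rewrite PhiE; apply: isR_lip rW; apply: modulus_lip.
move/(in_canonP hYi rPhi hx): ci => [d' d'0]; rewrite PhiE => near.
have near' : eventually (fun n => `|rv x n - rv (sapp Y i) n| <= modulus (rv (sapp W i) n)).
  by apply: ev_mono near => n; lra.
have cl := cantor_close (is_cantor_rv x) (is_cantor_rv (sapp Y i)) rW d0 d1 (dW i ik) near'.
have rFZ : isR (rv (sapp F (sapp Z i))) by rewrite -hW.
apply/(in_canonP hZi rFZ hy); rewrite -hW.
(* Of the slack d/2 the approximation of y uses d/8, so d/8 is certainly left over. *)
exists (d / 8); first by lra.
apply: ev_mono (ev_and (ev_ge m) cl) => n [mn]; rewrite (cx n mn) hZ.
have := hl n mn; rewrite -[leLHS]/(`| _ |) => h1; rewrite -lerBrDr => h2; rewrite -lerBrDr.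
move: h1 h2; rewrite !ler_norml => /andP[a1 a2] /andP[b1 b2]; apply/andP; split; lra.
Qed.

End Assembly.

Theorem theorem1 : provable RCA0w (HBU <<->> HBUae)%fm.
Proof.
apply: completeness => M mM; pose M' := Model mM; split=> h.
  apply: (@imp_sat_HBUae M') => F; apply: hbu_finite_cover.
  by apply/(@sat_HBU M').
by apply/(@sat_HBU M'); apply: hbu_of_ae; apply: sat_HBUae_imp.
Qed.
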